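(* Let $\mathcal M=\langle M,<,+,\dots\rangle$ be a reduct of a real closed field $\mathcal R=\langle M,<,+,\cdot\rangle$ (with the same $<$ and $+$). Fix a real number $\beta$ with $1\le\beta<\frac43$. Then the following are equivalent: (1) The multiplication $\cdot$ is not definable in $\mathcal M$. (2) For all positive integers $d_1,d_2$ and every definable binary relation $E\subseteq M^{d_1}\times M^{d_2}$, there are $\alpha\in\mathbb R_{>0}$ and $m\in M_{\ge0}$ such that if $E$ is $k$-free for some $k\in\mathbb N$, then for every $m$-distant $n$-grid $B\subseteq M^{d_1}\times M^{d_2}$ (for any $n\in\mathbb N$) we have $|E\cap B|\le\alpha n^\beta$.
   Context: $\mathcal M$ being a reduct of $\mathcal R$ means $\mathcal M$ has universe $M$ and every $\emptyset$-definable set of $\mathcal M$ is $\emptyset$-definable in $\mathcal R$. ''Definable'' means definable in $\mathcal M$ with parameters. For $x\in M^d$, $|x|=\max_i|x_i|$; a set $X\subseteq M^d$ is $m$-distant if $|x-y|>m$ for all distinct $x,y\in X$. A grid in $M^{d_1}\times M^{d_2}$ is a product $B=B_1\times B_2$ with $B_i\subseteq M^{d_i}$; it is an $n$-grid if $|B_1|=|B_2|=n$, and it is $m$-distant if both $B_1,B_2$ are $m$-distant. $E$ is $k$-free if it contains no $k$-grid. *)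

(* Defs.v *)
From Stdlib Require Reals.
From HB Require Import structures.
From mathcomp Require Import all_boot all_order all_algebra.
Set Implicit Arguments. Unset Strict Implicit. Unset Printing Implicit Defensive.
Import Order.TTheory GRing.Theory Num.Theory.
Local Open Scope ring_scope.

(* Variables are natural numbers; relation symbols are applied to lists of
   variables (a symbol may be used at any arity; the interpretation decides). *)
Inductive formula (S : Type) : Type :=
| FRel of S & seq nat
| FEq of nat & nat
| FNot of formula S
| FAnd of formula S & formula S
| FEx of nat & formula S.

Arguments FRel {S}. Arguments FEq {S}. Arguments FNot {S}.
Arguments FAnd {S}. Arguments FEx {S}.

(* A structure with universe T in signature S is an interpretation I. *)
Fixpoint sat (S T : Type) (I : S -> seq T -> Prop) (e : nat -> T)
  (f : formula S) : Prop :=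
  match f with
  | FRel s vs => I s (map e vs)
  | FEq i j => e i = e j
  | FNot g => ~ sat I e g
  | FAnd g h => sat I e g /\ sat I e h
  | FEx x g => exists a : T, sat I (fun j => if j == x then a else e j) g
  end.

Definition env (T : Type) (x : seq T) (p : nat -> T) : nat -> T :=
  fun j => if (j < size x)%N then nth (p j) x j else p j.

(* X ⊆ T^d (points of T^d are sequences of size d) is definable with
   parameters: the other variables act as parameters. *)
Definition definable (S T : Type) (I : S -> seq T -> Prop) (d : nat)
  (X : seq T -> Prop) : Prop :=
  exists (f : formula S) (p : nat -> T),
    forall x : seq T, size x = d -> (X x <-> sat I (env x p) f).

(* emptyset-definable: the defining formula works whatever the values of the
   other variables (i.e. no parameters). *)
Definition zdefinable (S T : Type) (I : S -> seq T -> Prop) (d : nat)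
  (X : seq T -> Prop) : Prop :=
  exists f : formula S,
    forall (x : seq T) (p : nat -> T), size x = d -> (X x <-> sat I (env x p) f).

Inductive orf_sym := OLt | OAdd | OMul.

Definition orf_interp (R : rcfType) (s : orf_sym) (l : seq R) : Prop :=
  match s, l with
  | OLt, [:: x; y] => x < y
  | OAdd, [:: x; y; z] => x + y = z
  | OMul, [:: x; y; z] => x * y = z
  | _, _ => False
  end.

Definition is_reduct (R : rcfType) (S : Type) (I : S -> seq R -> Prop) : Prop :=
  forall (d : nat) (X : seq R -> Prop),
    zdefinable I d X -> zdefinable (@orf_interp R) d X.

Definition lt_set (R : rcfType) : seq R -> Prop :=
  fun l => nth 0 l 0 < nth 0 l 1.
Definition add_graph (R : rcfType) : seq R -> Prop :=
  fun l => nth 0 l 0 + nth 0 l 1 = nth 0 l 2.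
Definition mul_graph (R : rcfType) : seq R -> Prop :=
  fun l => nth 0 l 0 * nth 0 l 1 = nth 0 l 2.

Definition dist (R : rcfType) (x y : seq R) : R :=
  foldr (fun q acc => Num.max `|q.1 - q.2| acc) 0 (zip x y).

Definition m_distant (R : rcfType) (m : R) (B : seq (seq R)) : Prop :=
  forall x y, x \in B -> y \in B -> x != y -> m < dist x y.

(* B1 x B2 is an n-grid in M^d1 x M^d2 (finite sets given as duplicate-free lists) *)
Definition is_grid (R : rcfType) (d1 d2 n : nat) (B1 B2 : seq (seq R)) : Prop :=
  [/\ uniq B1, uniq B2, size B1 = n, size B2 = n &
      (all (fun x => size x == d1) B1 && all (fun y => size y == d2) B2)].

Definition k_free (R : rcfType) (d1 d2 k : nat) (E : seq R -> seq R -> bool) : Prop :=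
  ~ exists B1 B2 : seq (seq R),
      is_grid d1 d2 k B1 B2 /\ (forall x y, x \in B1 -> y \in B2 -> E x y).

Definition grid_count (R : rcfType) (E : seq R -> seq R -> bool)
  (B1 B2 : seq (seq R)) : nat :=
  (\sum_(x <- B1) count (E x) B2)%N.

Definition rel_definable (R : rcfType) (S : Type) (I : S -> seq R -> Prop)
  (d1 d2 : nat) (E : seq R -> seq R -> bool) : Prop :=
  definable I (d1 + d2) (fun z => E (take d1 z) (drop d1 z)).

Definition zarankiewicz_bound (R : rcfType) (S : Type) (I : S -> seq R -> Prop)
  (beta : Reals.Rdefinitions.R) : Prop :=
  forall d1 d2 : nat, (0 < d1)%N -> (0 < d2)%N ->
  forall E : seq R -> seq R -> bool, rel_definable I d1 d2 E ->
  exists (alpha : Reals.Rdefinitions.R) (m : R),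
    Reals.Rdefinitions.Rlt Reals.Rdefinitions.R0 alpha /\ 0 <= m /\
    ((exists k : nat, k_free d1 d2 k E) ->
     forall (n : nat) (B1 B2 : seq (seq R)),
       is_grid d1 d2 n B1 B2 -> m_distant m B1 -> m_distant m B2 ->
       Reals.Rdefinitions.Rle (Reals.Raxioms.INR (grid_count E B1 B2))
         (Reals.Rdefinitions.Rmult alpha
            (Reals.Rpower.Rpower (Reals.Raxioms.INR n) beta))).

(* Main.v *)
Require Import Defs.
From Stdlib Require Reals Lra.
From HB Require Import structures.
From mathcomp Require Import all_boot all_order all_algebra.
From mathcomp Require Import boolp.
From mathcomp Require Import lra ring zify.
From mathcomp Require ordered_qelim qe_rcf polyrcf.
Set Implicit Arguments. Unset Strict Implicit. Unset Printing Implicit Defensive.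
Import Order.TTheory GRing.Theory Num.Theory.
Local Open Scope ring_scope.

(** (1) => (2).  Let [D] be the class of sets definable in the reduct.
    - If a definable [f : R -> R] is not eventually affine, then its increments
      [f (x + t) - f x] are regularly varying (two monomials of an equation
      [P(x, f x) = 0] have to balance), so that comparing ratios of increments at
      two points tending to infinity defines the multiplication.
    - Hence, without multiplication, every definable family of functions of one
      variable is affine on intervals, up to pieces of uniformly bounded length, and
      the slopes on long intervals form a finite set of definable scalars.  By
      induction on the number of variables, membership in a definable set depends, at
      points where finitely many definable linear forms are large, only on the signs
      of these forms (the remaining coordinates being bounded).
    - Let [E] be [k]-free and [V] a definable linear subspace containing both a
      horizontal direction [(u, 0)] and a vertical one [(0, v)].  A point of [E] near
      [V], generic in this sense, would span a [k]-grid in [E]; so all points of [E] near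
      [V] are near finitely many proper subspaces of [V].  Descending, [E] is contained in
      finitely many bounded neighbourhoods of subspaces lacking one of the two kinds of
      directions, and such a neighbourhood meets a sufficiently distant [n]-grid in at
      most [n] points.

    (2) => (1).  With multiplication, the point-line incidence relation is definable and
    2-free, and suitably dilated integer grids of size [4 N^3] have at least [4 N^4]
    incidences. *)

(** * Classes of definable sets *)

(** The real closed field is arbitrary, possibly non-archimedean, so suprema and limits are only
    taken of definable objects. O-minimality comes from quantifier elimination in the field and is
    inherited by every class contained in [field_class R]; arguments about such a class [D] may
    therefore use slopes, ratios and polynomials that [D] itself cannot express. Two devices recur.
    To make a bound uniform, its failure for every [s] is turned by definable choice into a
    definable curve of counterexamples indexed by [s]; along it, bounded coordinates are eventually
    constant, or a function of one variable is eventually affine, which gives a contradiction. To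
    exclude that a slope varies with a parameter, a mixed second difference is taken: if it were
    [mu * (u * v)] with [mu] nonzero, it would define the multiplication. The bound obtained in (2)
    is linear in [n], hence good for every exponent at least 1. The limit 4/3 comes from comparing
    [4 N^4] incidences with [(4 N^3)^beta], which has smaller order when [3 beta < 4]. *)

Definition scons (T : Type) (a : T) (e : nat -> T) : nat -> T :=
  fun i => if i is i'.+1 then e i' else a.
Definition tl (T : Type) (e : nat -> T) : nat -> T := fun i => e i.+1.
Definition upd (T : Type) (e : nat -> T) (k : nat) (a : T) : nat -> T :=
  fun i => if i == k then a else e i.

Arguments tl T e i /.
Arguments scons T a e i /.

Lemma scons_tl (T : Type) (e : nat -> T) : scons (e 0%N) (tl e) = e.
Proof. by apply: funext => -[]. Qed.

(* A subset of a power of [R] is encoded as a predicate on sequences [nat -> R] that only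
   depends on finitely many terms. *)
Record dclass (R : rcfType) := DClass {
  dset :> ((nat -> R) -> Prop) -> Prop;
  d_and : forall P Q, dset P -> dset Q -> dset (fun e => P e /\ Q e);
  d_not : forall P, dset P -> dset (fun e => ~ P e);
  d_ex : forall P, dset P -> dset (fun e => exists a, P (scons a e));
  d_ren : forall (rho : nat -> nat) P,
    dset P -> dset (fun e => P (fun i => e (rho i)));
  d_fin : forall P, dset P -> exists n, forall e e' : nat -> R,
    (forall i, (i < n)%N -> e i = e' i) -> P e -> P e';
  d_eq01 : dset (fun e => e 0%N = e 1%N);
  d_cst0 : forall c, dset (fun e => e 0%N = c);
  d_lt01 : dset (fun e => e 0%N < e 1%N);
  d_add012 : dset (fun e => e 0%N + e 1%N = e 2%N)
}.

Section DClassTheory.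
Variables (R : rcfType) (D : dclass R).
Implicit Types (P Q : (nat -> R) -> Prop) (t u : (nat -> R) -> R).

Definition dfun t := D (fun e => e 0%N = t (tl e)).

Lemma dset_ext P Q : (forall e, P e <-> Q e) -> D P -> D Q.
Proof.
by move=> PQ; have -> : P = Q by apply: funext => e; apply: propext.
Qed.

Lemma dset_exAt k P : D P -> D (fun e => exists a, P (upd e k a)).
Proof.
move=> /(d_ren (fun i => if i == k then 0%N else i.+1)) /d_ex.
apply: dset_ext => e; split=> -[a Pa]; exists a; move: Pa;
  congr P; apply: funext => i; rewrite /upd; by case: (i == k).
Qed.

Lemma dset_subst (s : nat -> (nat -> R) -> R) P :
  D P -> (forall i, dfun (s i)) -> D (fun e => P (fun i => s i e)).
Proof.
move=> DP Ds; have [n nP] := d_fin DP.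
(* Variables are replaced one at a time. The arguments of the functions are read from position [n]
   on, beyond everything that [P] sees, so that replacing a position [k < n] does not disturb them;
   a final renaming moves them back. *)
pose Q k e := P (fun i => if (i < k)%N then s i (fun j => e (n + j)%N) else e i).
have DQ k : (k <= n)%N -> D (Q k).
  elim: k => [_|k IHk kn]; first exact: DP.
  have D1 := d_ren (fun i => if i is i'.+1 then (n + i')%N else k) (Ds k).
  have := dset_exAt k (d_and D1 (IHk (ltnW kn))); apply: dset_ext => e.
  have Eu a : (fun j => upd e k a (n + j)%N) = (fun j => e (n + j)%N).
    by apply: funext => j; rewrite /upd; case: eqP => // E; move: kn; rewrite -E ltnNge leq_addr.
  rewrite /Q; split.
    case=> a [] /=; rewrite {1}/upd eqxx.
    have -> : tl (fun i => upd e k a (match i with 0 => k | i'.+1 => (n + i')%N end))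
        = (fun j => e (n + j)%N) by rewrite -(Eu a).
    move=> ea; congr P; apply: funext => i; rewrite ltnS Eu /upd.
    by case: (ltngtP i k) => [||->].
  move=> H; exists (s k (fun j => e (n + j)%N)); split.
    rewrite /= {1}/upd eqxx; congr (s k _).
    exact: (esym (Eu _)).
  move: H; congr P; apply: funext => i; rewrite ltnS Eu /upd.
  by case: (ltngtP i k) => [||->].
have := d_ren (fun i => if (i < n)%N then 0%N else (i - n)%N) (DQ n (leqnn n)).
apply: dset_ext => e; rewrite /Q.
have E : (fun j => e (if (n + j < n)%N then 0%N else (n + j - n)%N)) = e.
  by apply: funext => j; rewrite ltnNge leq_addr /= addKn.
by rewrite E; split; apply: nP => i lin; rewrite lin.
Qed.

Lemma dfun_var i : dfun (fun e => e i).
Proof. exact: (d_ren (fun k => if k is 0 then 0%N else i.+1) (d_eq01 D)). Qed.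

Lemma dfun_tl t : dfun t -> dfun (fun e => t (tl e)).
Proof.
by move/(d_ren (fun i => if i is i'.+1 then i'.+2 else 0%N)).
Qed.

Lemma dfun_subst (s : nat -> (nat -> R) -> R) t :
  dfun t -> (forall i, dfun (s i)) -> dfun (fun e => t (fun i => s i e)).
Proof.
move=> Dt Ds.
have Ds' i : dfun (fun e : nat -> R => if i is i'.+1 then s i' (tl e) else e 0%N).
  by case: i => [|i]; [exact: dfun_var|apply: dfun_tl].
exact: (dset_subst Dt Ds').
Qed.

Lemma dfun_ext t u : (forall e, t e = u e) -> dfun t -> dfun u.
Proof. by move=> tu; have -> : t = u by apply: funext. Qed.

Lemma dfun_cst c : dfun (fun=> c).
Proof. exact: (d_cst0 D). Qed.

Lemma dset_and P Q : D P -> D Q -> D (fun e => P e /\ Q e).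
Proof. exact: d_and. Qed.

Lemma dset_not P : D P -> D (fun e => ~ P e).
Proof. exact: d_not. Qed.

Lemma dset_or P Q : D P -> D Q -> D (fun e => P e \/ Q e).
Proof.
move=> /d_not DP /d_not DQ; apply: dset_ext (d_not (d_and DP DQ)) => e.
split=> [H|[H|H] []//].
by case: (pselect (P e)) => HP; [left|right; apply: contrapT => HQ; apply: H].
Qed.

Lemma dset_imp P Q : D P -> D Q -> D (fun e => P e -> Q e).
Proof.
move=> /d_not DP DQ; apply: dset_ext (dset_or DP DQ) => e.
by split=> [[//|//]|H]; case: (pselect (P e)) => HP; [right; apply: H|left].
Qed.

Lemma dset_ex (P : (nat -> R) -> R -> Prop) :
  D (fun e => P (tl e) (e 0%N)) -> D (fun e => exists a, P e a).
Proof. exact: d_ex. Qed.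

Lemma dset_all (P : (nat -> R) -> R -> Prop) :
  D (fun e => P (tl e) (e 0%N)) -> D (fun e => forall a, P e a).
Proof.
move=> /d_not DP; have := d_not (@dset_ex (fun e a => ~ P e a) DP).
by apply: dset_ext => e; split=> [H a|H [a]//]; apply: contrapT => nP; apply: H; exists a.
Qed.

Lemma dset_eq t u : dfun t -> dfun u -> D (fun e => t e = u e).
Proof.
move=> Dt Du; apply: (@dset_subst (fun i => if i is 0 then t else u) _ (d_eq01 D)).
by case.
Qed.

Lemma dset_lt t u : dfun t -> dfun u -> D (fun e => t e < u e).
Proof.
move=> Dt Du; apply: (@dset_subst (fun i => if i is 0 then t else u) _ (d_lt01 D)).
by case.
Qed.

Lemma dset_le t u : dfun t -> dfun u -> D (fun e => t e <= u e).
Proof.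
move=> Dt Du; apply: dset_ext (d_not (dset_lt Du Dt)) => e.
by rewrite leNgt; split=> /negP.
Qed.

Lemma dset_andb (P Q : (nat -> R) -> bool) :
  D (fun e => P e) -> D (fun e => Q e) -> D (fun e => P e && Q e).
Proof.
by move=> DP DQ; apply: dset_ext (d_and DP DQ) => e; split=> /andP.
Qed.

Lemma dset_true : D (fun=> True).
Proof.
by apply: dset_ext (dset_eq (dfun_cst 0) (dfun_cst 0)) => e.
Qed.

Lemma dset_cst (P : Prop) : D (fun=> P).
Proof.
case: (pselect P) => HP; first by apply: dset_ext dset_true => e; split.
by apply: dset_ext (d_not dset_true) => e; split=> // H; case: H.
Qed.

Lemma dset_bool (b : bool) : D (fun=> b).
Proof. exact: dset_cst. Qed.

Lemma dfun_add t u : dfun t -> dfun u -> dfun (fun e => t e + u e).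
Proof.
move=> /dfun_tl Dt /dfun_tl Du.
have := @dset_subst (fun i => match i with 0 => fun e => t (tl e)
   | 1 => fun e => u (tl e) | _ => fun e => e 0%N end) _ (d_add012 D).
move=> H; apply: dset_ext (H _) => [e|[|[|i]]] //=; last exact: dfun_var.
by split=> ->.
Qed.

Lemma dfun_opp t : dfun t -> dfun (fun e => - t e).
Proof.
move=> /dfun_tl Dt.
apply: dset_ext (dset_eq (dfun_add (dfun_var 0) Dt) (dfun_cst 0)) => e.
by split=> [/eqP|->]; [rewrite addr_eq0 => /eqP|rewrite addNr].
Qed.

Lemma dfun_sub t u : dfun t -> dfun u -> dfun (fun e => t e - u e).
Proof. by move=> Dt /dfun_opp; apply: dfun_add. Qed.

Lemma dfun_half t : dfun t -> dfun (fun e => t e / 2).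
Proof.
move=> /dfun_tl Dt.
apply: dset_ext (dset_eq (dfun_add (dfun_var 0) (dfun_var 0)) Dt) => e; split; lra.
Qed.

Lemma dfun_if P t u : D P -> dfun t -> dfun u ->
  dfun (fun e => if `[< P e >] then t e else u e).
Proof.
move=> DP Dt Du.
have DP' : D (fun e => P (tl e)) by apply: (d_ren succn DP).
apply: dset_ext (dset_or (dset_and DP' Dt) (dset_and (dset_not DP') Du)) => e.
case: asboolP => HP; split; try by case=> -[].
  by move=> H; left.
by move=> H; right.
Qed.

Lemma dfun_norm t : dfun t -> dfun (fun e => `|t e|).
Proof.
move=> Dt; have D0 := dset_le (dfun_cst 0) Dt.
apply: dfun_ext (dfun_if D0 Dt (dfun_opp Dt)) => e.
case: asboolP => H; first by rewrite ger0_norm.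
by rewrite ltr0_norm // ltNge; apply/negP.
Qed.

(* In families, the first term of the sequence is the variable and the others are the
   parameters. *)
Definition dfun1 (f : R -> R) := dfun (fun e => f (e 0%N)).
Definition dfam (f : (nat -> R) -> R -> R) := dfun (fun e => f (tl e) (e 0%N)).
Definition dfun2 (f : R -> R -> R) := dfun (fun e => f (e 0%N) (e 1%N)).
Definition dset1 (A : R -> Prop) := D (fun e => A (e 0%N)).
Definition dfamP (A : (nat -> R) -> R -> Prop) := D (fun e => A (tl e) (e 0%N)).

Lemma dfun1_app f t : dfun1 f -> dfun t -> dfun (fun e => f (t e)).
Proof. by move=> Df Dt; apply: (@dfun_subst (fun=> t) _ Df). Qed.

Lemma dfun2_app f t u : dfun2 f -> dfun t -> dfun u -> dfun (fun e => f (t e) (u e)).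
Proof.
move=> Df Dt Du.
by apply: (@dfun_subst (fun i => if i is 0 then t else u) _ Df) => -[].
Qed.

Lemma dset1_app A t : dset1 A -> dfun t -> D (fun e => A (t e)).
Proof. by move=> Df Dt; apply: (@dset_subst (fun=> t) _ Df). Qed.

Lemma dfam_app f (s : (nat -> R) -> nat -> R) t : dfam f ->
  (forall i, dfun (fun e => s e i)) -> dfun t -> dfun (fun e => f (s e) (t e)).
Proof.
move=> Df Ds Dt.
by apply: (@dfun_subst (fun i => if i is i'.+1 then (fun e => s e i') else t) _ Df) => -[].
Qed.

Lemma dfamP_app A (s : (nat -> R) -> nat -> R) t : dfamP A ->
  (forall i, dfun (fun e => s e i)) -> dfun t -> D (fun e => A (s e) (t e)).
Proof.
move=> Df Ds Dt.
by apply: (@dset_subst (fun i => if i is i'.+1 then (fun e => s e i') else t) _ Df) => -[].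
Qed.

Lemma dfun_app t (s : (nat -> R) -> nat -> R) : dfun t ->
  (forall i, dfun (fun e => s e i)) -> dfun (fun e => t (s e)).
Proof. by move=> Dt Ds; apply: (@dfun_subst (fun i e => s e i) _ Dt). Qed.

Lemma dset_app P (s : (nat -> R) -> nat -> R) : D P ->
  (forall i, dfun (fun e => s e i)) -> D (fun e => P (s e)).
Proof. by move=> Dt Ds; apply: (@dset_subst (fun i e => s e i) _ Dt). Qed.

Lemma dfun_comp_upd (s : (nat -> R) -> nat -> R) k t :
  (forall i, dfun (fun e => s e i)) -> dfun t ->
  forall i, dfun (fun e => upd (s e) k (t e) i).
Proof. by move=> Ds Dt i; rewrite /upd; case: (i == k). Qed.

Lemma dfun_comp_scons (s : (nat -> R) -> nat -> R) t :
  (forall i, dfun (fun e => s e i)) -> dfun t ->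
  forall i, dfun (fun e => scons (t e) (s e) i).
Proof. by move=> Ds Dt [|i]; rewrite /scons. Qed.

End DClassTheory.

Ltac dstep := cbn [scons tl];
  first
  [ assumption
  | lazymatch goal with |- forall i : nat, dfun _ _ =>
      first [apply: dfun_comp_upd | apply: dfun_comp_scons | let i := fresh "i" in move=> i] end
  | apply: dset_bool
  | apply: dset_cst
  | lazymatch goal with |- dset _ (fun e => is_true (_ && _)) => apply: dset_andb end
  | lazymatch goal with |- dset _ (fun e => is_true (_ < _)) => apply: dset_lt end
  | lazymatch goal with |- dset _ (fun e => is_true (_ <= _)) => apply: dset_le end
  | lazymatch goal with |- dset _ (fun e => _ /\ _) => apply: dset_and end
  | lazymatch goal with |- dset _ (fun e => _ \/ _) => apply: dset_or end
  | lazymatch goal with |- dset _ (fun e => ~ _) => apply: dset_not end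
  | lazymatch goal with |- dset _ (fun e => exists a, _) => apply: dset_ex end
  | lazymatch goal with |- dset _ (fun e => _ = _) => apply: dset_eq end
  | lazymatch goal with |- dset _ (fun e => forall a, _) =>
       first [apply: dset_imp | apply: dset_all] end
  | match goal with
    | H : dset1 _ ?A |- dset _ (fun e => ?A _) => apply: (dset1_app H)
    | H : dfamP _ ?A |- dset _ (fun e => ?A _ _) => apply: (dfamP_app H)
    | H : dset _ ?A |- dset _ (fun e => ?A _) => apply: (dset_app H)
    end
  | lazymatch goal with |- dfun _ (fun e => e ?n) => apply: dfun_var end
  | lazymatch goal with |- dfun _ (fun e => _ + _) => apply: dfun_add end
  | lazymatch goal with |- dfun _ (fun e => - _) => apply: dfun_opp end
  | lazymatch goal with |- dfun _ (fun e => _ / 2) => apply: dfun_half end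
  | lazymatch goal with |- dfun _ (fun e => `| _ |) => apply: dfun_norm end
  | lazymatch goal with |- dfun _ (fun e => if `[< _ >] then _ else _) => apply: dfun_if end
  | lazymatch goal with |- dfun _ (fun e => _) => apply: dfun_cst end
  | match goal with
    | H : dfun1 _ ?f |- dfun _ (fun e => ?f _) => apply: (dfun1_app H)
    | H : dfun2 _ ?f |- dfun _ (fun e => ?f _ _) => apply: (dfun2_app H)
    | H : dfam _ ?f |- dfun _ (fun e => ?f _ _) => apply: (dfam_app H)
    | H : dfun _ ?f |- dfun _ (fun e => ?f _) => apply: (dfun_app H)
    end
  ].
Ltac dtac := repeat dstep.

(** * The class of a structure *)

Fixpoint vbound (S : Type) (f : formula S) : nat :=
  match f with
  | FRel _ vs => foldr (fun i n => maxn i.+1 n) 0%N vs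
  | FEq i j => maxn i.+1 j.+1
  | FNot g => vbound g
  | FAnd g h => maxn (vbound g) (vbound h)
  | FEx x g => maxn x.+1 (vbound g)
  end.

Section Formulas.
Variables (S T : Type) (I : S -> seq T -> Prop).

Lemma sat_vbound (f : formula S) (e e' : nat -> T) :
  (forall i, (i < vbound f)%N -> e i = e' i) -> sat I e f <-> sat I e' f.
Proof.
elim: f e e' => [s vs|i j|g IHg|g IHg h IHh|x g IHg] e e' /= H.
- suff -> : map e vs = map e' vs by [].
  elim: vs H => //= i vs IH H; rewrite H ?leq_max ?leqnn //; congr (_ :: _).
  by apply: IH => j Hj; apply: H; rewrite leq_max Hj orbT.
- by rewrite !H // leq_max leqnn ?orbT.
- by split=> Hn /(IHg _ _ H).
- have Hg : sat I e g <-> sat I e' g.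
    by apply: IHg => i Hi; apply: H; rewrite leq_max Hi.
  have Hh : sat I e h <-> sat I e' h.
    by apply: IHh => i Hi; apply: H; rewrite leq_max Hi orbT.
  by rewrite Hg Hh.
- have E a : sat I (fun j => if j == x then a else e j) g <->
             sat I (fun j => if j == x then a else e' j) g.
    by apply: IHg => i Hi; case: ifP => // _; rewrite H // leq_max Hi orbT.
  by split=> -[a /E Ha]; exists a.
Qed.

Lemma sat_eq (f : formula S) (e e' : nat -> T) :
  (forall i, e i = e' i) -> sat I e f <-> sat I e' f.
Proof. by move=> H; apply: sat_vbound. Qed.

(* The bound variable is renamed to one that rho does not reach. *)
Lemma sat_rename (f : formula S) (rho : nat -> nat) : exists g : formula S,
  forall e : nat -> T, sat I e g <-> sat I (fun i => e (rho i)) f.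
Proof.
elim: f rho => [s vs|i j|g IHg|g IHg h IHh|x g IHg] rho.
- by exists (FRel s (map rho vs)) => e /=; rewrite -map_comp.
- by exists (FEq (rho i) (rho j)).
- have [g' Hg] := IHg rho; exists (FNot g') => e /=; split=> H H'; apply: H; exact/Hg.
- have [g' Hg] := IHg rho; have [h' Hh] := IHh rho; exists (FAnd g' h') => e /=.
  by rewrite Hg Hh.
- pose z := (\max_(i < vbound g) (rho i).+1)%N.
  have [g' Hg] := IHg (upd rho x z); exists (FEx z g') => e /=.
  have E a : sat I (fun j => if j == z then a else e j) g' <->
      sat I (fun j => if j == x then a else e (rho j)) g.
    rewrite Hg; apply: sat_vbound => i Hi; rewrite /upd.
    case: (i == x); first by rewrite eqxx.
    have /ltn_eqF -> // : (rho i < z)%N.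
    exact: (@leq_bigmax _ (fun i : 'I__ => (rho i).+1) (Ordinal Hi)).
  by split=> -[a /E Ha]; exists a.
Qed.

End Formulas.

Fixpoint fmap (S S' : Type) (h : S -> S') (f : formula S) : formula S' :=
  match f with
  | FRel s vs => FRel (h s) vs
  | FEq i j => FEq i j
  | FNot g => FNot (fmap h g)
  | FAnd g1 g2 => FAnd (fmap h g1) (fmap h g2)
  | FEx x g => FEx x (fmap h g)
  end.

Section WithConstants.
Variables (R : rcfType) (S : Type) (I : S -> seq R -> Prop).

(** A unary predicate is added for each element of the field, so that formulas carry their
    parameters and no assignments of parameters have to be merged when definable sets are
    combined. *)
Definition cinterp (s : S + R) (l : seq R) : Prop :=
  match s with inl s' => I s' l | inr c => l = [:: c] end.

Definition pdefinable (P : (nat -> R) -> Prop) : Prop :=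
  exists f : formula (S + R), forall e, P e <-> sat cinterp e f.

Lemma sat_fmap_inl (f : formula S) (e : nat -> R) :
  sat cinterp e (fmap inl f) <-> sat I e f.
Proof.
elim: f e => [s vs|i j|g IHg|g IHg h IHh|x g IHg] e //=.
- by rewrite IHg.
- by rewrite IHg IHh.
- by split=> -[a /IHg Ha]; exists a.
Qed.

Lemma pdef_and P Q : pdefinable P -> pdefinable Q -> pdefinable (fun e => P e /\ Q e).
Proof. by move=> [f Hf] [g Hg]; exists (FAnd f g) => e /=; rewrite Hf Hg. Qed.

Lemma pdef_not P : pdefinable P -> pdefinable (fun e => ~ P e).
Proof. by move=> [f Hf]; exists (FNot f) => e /=; rewrite Hf. Qed.

Lemma pdef_ren (rho : nat -> nat) P :
  pdefinable P -> pdefinable (fun e => P (fun i => e (rho i))).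
Proof.
move=> [f Hf]; have [g Hg] := sat_rename cinterp f rho.
by exists g => e; rewrite Hg Hf.
Qed.

Lemma pdef_ex P : pdefinable P -> pdefinable (fun e => exists a, P (scons a e)).
Proof.
move=> [f Hf].
pose z := vbound f.
have [g Hg] := sat_rename cinterp f (fun i => if i is i'.+1 then i' else z).
exists (FEx z g) => e /=.
have E a : P (scons a e) <-> sat cinterp (fun j => if j == z then a else e j) g.
  rewrite Hf Hg; apply: sat_vbound => -[|i] Hi /=; first by rewrite eqxx.
  by rewrite ltn_eqF // ltnW.
by split=> -[a /E Ha]; exists a.
Qed.

Lemma pdef_fin P : pdefinable P -> exists n, forall e e' : nat -> R,
  (forall i, (i < n)%N -> e i = e' i) -> P e -> P e'.
Proof.
move=> [f Hf]; exists (vbound f) => e e' H; rewrite !Hf.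
by have [] := sat_vbound cinterp H.
Qed.

Lemma pdef_eq01 : pdefinable (fun e => e 0%N = e 1%N).
Proof. by exists (FEq 0 1). Qed.

Lemma pdef_cst0 c : pdefinable (fun e => e 0%N = c).
Proof. by exists (FRel (inr c) [:: 0%N]) => e /=; split=> [->|[]]. Qed.

Lemma env_self (x : seq R) (e : nat -> R) : x = mkseq e (size x) -> env x e = e.
Proof.
move=> Ex; apply: funext => i; rewrite /env; case: ifP => // Hi.
by rewrite Ex nth_mkseq.
Qed.

Lemma pdef_zdefinable d (X : seq R -> Prop) :
  zdefinable I d X -> pdefinable (fun e => X (mkseq e d)).
Proof.
move=> [f Hf]; exists (fmap inl f) => e; rewrite sat_fmap_inl (Hf _ e) ?size_mkseq //.
by rewrite env_self // size_mkseq.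
Qed.

Hypothesis zlt : zdefinable I 2 (@lt_set R).
Hypothesis zadd : zdefinable I 3 (@add_graph R).

Definition structure_class : dclass R :=
  DClass pdef_and pdef_not pdef_ex pdef_ren pdef_fin pdef_eq01 pdef_cst0
    (pdef_zdefinable zlt) (pdef_zdefinable zadd).

Lemma definable_class d (X : seq R -> Prop) :
  definable I d X -> structure_class (fun e => X (mkseq e d)).
Proof.
move=> [f [p Hf]].
have Df : structure_class (fun e => sat I e f).
  by exists (fmap inl f) => e; rewrite sat_fmap_inl.
have := @dset_app _ _ _ (fun e i => if (i < d)%N then e i else p i) Df.
move=> H; apply: dset_ext (H _).
  move=> e; rewrite Hf ?size_mkseq //; apply: sat_eq => i.
  by rewrite /env size_mkseq; case: ifP => // Hi; rewrite nth_mkseq.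
by move=> i; case: (i < d)%N; dtac.
Qed.

(** Each constant becomes an equation with a fresh variable, numbered from [n] on, whose intended
    values are listed in [p]. In a conjunction, the numbering of the second formula starts after the
    variables spent on the first. *)
Lemma sat_constants (f : formula (S + R)) n : (vbound f <= n)%N ->
  exists (g : formula S) (p : seq R), forall e : nat -> R,
    (forall i, (i < size p)%N -> e (n + i)%N = nth 0 p i) ->
    (sat cinterp e f <-> sat I e g).
Proof.
elim: f n => [[s|c] vs|i j|g IHg|g IHg h IHh|x g IHg] n /= Hn.
- by exists (FRel s vs), [::].
- case: vs Hn => [|v [|w vs]] Hn.
  + by exists (FNot (FEq 0 0)), [::] => e _ /=; split=> // -[].
  + exists (FEq v n), [:: c] => e /(_ 0%N isT) /=; rewrite addn0 => ->.
    by split=> [[]|->].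
  + by exists (FNot (FEq 0 0)), [::] => e _ /=; split=> // -[].
- by exists (FEq i j), [::].
- have [g' [p Hg]] := IHg n Hn; exists (FNot g'), p => e /Hg /= E; by rewrite E.
- move: Hn; rewrite geq_max => /andP[Hg Hh].
  have [g' [p Eg]] := IHg n Hg.
  have [h' [q Eh]] := IHh (n + size p)%N (leq_trans Hh (leq_addr _ _)).
  exists (FAnd g' h'), (p ++ q) => e He /=; rewrite Eg ?Eh //.
    move=> i Hi; rewrite -addnA He ?size_cat ?ltn_add2l //.
    by rewrite nth_cat ltnNge leq_addr /= addKn.
  by move=> i Hi; rewrite He ?nth_cat ?Hi // size_cat ltn_addr.
- move: Hn; rewrite geq_max => /andP[Hx Hg].
  have [g' [p Eg]] := IHg n Hg; exists (FEx x g'), p => e He /=.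
  have E a : sat cinterp (fun j => if j == x then a else e j) g <->
             sat I (fun j => if j == x then a else e j) g'.
    apply: Eg => i Hi; rewrite gtn_eqF ?He //; apply: leq_trans Hx _; exact: leq_addr.
  by split=> -[a /E Ha]; exists a.
Qed.

Lemma class_definable d (X : seq R -> Prop) :
  structure_class (fun e => X (mkseq e d)) -> definable I d X.
Proof.
move=> [f Hf]; pose n := maxn d (vbound f).
have [g [p Hg]] := sat_constants (leq_maxr d (vbound f)).
exists g, (fun i => nth 0 p (i - n)%N) => x Hx.
rewrite -Hg; last first.
  move=> i Hi; rewrite /env Hx ltnNge.
  by rewrite (leq_trans (leq_maxl d (vbound f)) (leq_addr _ _)) /= addKn.
rewrite -Hf; suff -> : mkseq (env x (fun i => nth 0 p (i - n)%N)) d = x by [].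
apply: (@eq_from_nth _ 0); rewrite size_mkseq ?Hx // => i Hi.
by rewrite nth_mkseq // /env Hx Hi; apply: set_nth_default; rewrite Hx.
Qed.

End WithConstants.

(** * The class of the field and the inclusion of a reduct *)

Section FieldClass.
Variable R : rcfType.

Lemma orf_lt : zdefinable (@orf_interp R) 2 (@lt_set R).
Proof.
by exists (FRel OLt [:: 0; 1]%N) => -[|x [|y []]] p.
Qed.

Lemma orf_add : zdefinable (@orf_interp R) 3 (@add_graph R).
Proof.
by exists (FRel OAdd [:: 0; 1; 2]%N) => -[|x [|y [|z []]]] p.
Qed.

Definition field_class : dclass R := structure_class orf_lt orf_add.

(** [is_reduct] concerns sets definable without parameters, so the constants of a formula are freed
    as variables, the resulting set is transported, and the constants are substituted back through
    [s]. *)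
Lemma reduct_class (S : Type) (I : S -> seq R -> Prop)
  (zlt : zdefinable I 2 (@lt_set R)) (zadd : zdefinable I 3 (@add_graph R)) P :
  is_reduct I -> structure_class zlt zadd P -> field_class P.
Proof.
move=> Ired [f Hf]; pose n := vbound f.
have [g [p Hg]] := sat_constants I (leqnn n).
(* Large enough for the freed constants and for all variables of [g], so that the filler 0 in [env]
   is never read by [g]. *)
pose d := maxn (n + size p) (vbound g).
have /Ired [h Hh] : zdefinable I d (fun x => sat I (env x (fun=> 0)) g).
  exists g => x q Hx; apply: sat_vbound => i Hi; rewrite /env Hx.
  have -> : (i < d)%N by rewrite leq_max Hi orbT.
  by apply: set_nth_default; rewrite Hx leq_max Hi orbT.
pose s e i : R := if (i < n)%N then e i else nth 0 p (i - n)%N.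
have Ds : field_class (fun e => sat (@orf_interp R) (s e) h).
  have Dh : field_class (fun e => sat (@orf_interp R) e h).
    by exists (fmap inl h) => e; rewrite sat_fmap_inl.
  apply: (@dset_app _ _ _ s Dh) => i; rewrite /s; case: (i < n)%N; dtac.
apply: dset_ext Ds => e.
have -> : P e <-> sat (cinterp I) (s e) f.
  by rewrite Hf; apply: sat_vbound => i Hi; rewrite /s Hi.
rewrite Hg; last by move=> i Hi; rewrite /s ltnNge leq_addr /= addKn.
have -> : sat I (s e) g <-> sat I (env (mkseq (s e) d) (fun=> 0)) g.
  apply: sat_vbound => i Hi; rewrite /env size_mkseq.
  have Hd : (i < d)%N by rewrite leq_max Hi orbT.
  by rewrite Hd nth_mkseq.
rewrite (Hh _ (s e)) ?size_mkseq //; rewrite env_self ?size_mkseq //.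
Qed.

Lemma field_mul : dfun field_class (fun e => e 0%N * e 1%N).
Proof.
have H : field_class (fun e => e 0%N * e 1%N = e 2%N).
  by exists (FRel (inl OMul) [:: 0; 1; 2]%N).
have := d_ren (fun i => match i with 0 => 1 | 1 => 2 | _ => 0 end)%N H.
by apply: dset_ext => e /=; split=> ->.
Qed.

Lemma ofun_mul (t u : (nat -> R) -> R) : dfun field_class t -> dfun field_class u ->
  dfun field_class (fun e => t e * u e).
Proof.
move=> Dt Du.
have := @dfun_app _ field_class _ (fun e i => if i is 0 then t e else u e) field_mul.
by apply=> -[].
Qed.

Lemma ofun_inv (t : (nat -> R) -> R) : dfun field_class t ->
  dfun field_class (fun e => (t e)^-1).
Proof.
move=> Dt; have Dt' := dfun_tl Dt; rewrite /dfun.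
have D1 : dfun field_class (fun e => e 0%N * t (tl e)) by apply: ofun_mul => //; dtac.
apply: (@dset_ext _ _ (fun e => (t (tl e) = 0 /\ e 0%N = 0) \/
   (~ (t (tl e) = 0) /\ e 0%N * t (tl e) = 1))); last by dtac.
move=> e; split=> [[[-> ->]|[/eqP t0 H]]|->]; first by rewrite invr0.
  by rewrite -(mulfK t0 (e 0%N)) H mul1r.
case: (eqVneq (t (tl e)) 0) => [->|t0]; first by left; rewrite invr0.
by right; split; [apply/eqP|rewrite mulVf].
Qed.

Lemma ofun_exp (t : (nat -> R) -> R) n : dfun field_class t ->
  dfun field_class (fun e => t e ^+ n).
Proof.
move=> Dt; elim: n => [|n IHn].
  by apply: (@dfun_ext _ _ (fun=> 1)) => [e|]; [rewrite expr0|apply: dfun_cst].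
apply: (@dfun_ext _ _ (fun e => t e * t e ^+ n)) => [e|]; first by rewrite exprS.
exact: ofun_mul.
Qed.

End FieldClass.

Ltac ostep := first
  [ dstep | cbn [scons tl];
    lazymatch goal with
    | |- dfun (field_class _) (fun e => _ ^+ _) => apply: ofun_exp
    | |- dfun (field_class _) (fun e => _ * _) => apply: ofun_mul
    | |- dfun (field_class _) (fun e => _ ^-1) => apply: ofun_inv end].
Ltac otac := repeat ostep.

(** * Quantifier elimination and o-minimality *)

Module Ord := ordered_qelim.ord.
Import (canonicals) ordered_qelim.ord.

(** Terms are also evaluated in [{poly R}] or [{poly {poly R}}], where they become polynomials in
    some of their variables. Inverses get the dummy value 0: the terms left by the elimination are
    [rterm]s, which contain none. *)
Fixpoint teval (R A : nzRingType) (c : R -> A) (v : nat -> A) (t : GRing.term R) : A :=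
  match t with
  | GRing.Var i => v i
  | GRing.Const x => c x
  | GRing.NatConst n => n%:R
  | GRing.Add t1 t2 => teval c v t1 + teval c v t2
  | GRing.Opp t1 => - teval c v t1
  | GRing.NatMul t1 n => teval c v t1 *+ n
  | GRing.Mul t1 t2 => teval c v t1 * teval c v t2
  | GRing.Inv _ => 0
  | GRing.Exp t1 n => teval c v t1 ^+ n
  end.

Lemma teval_morph (R A B : nzRingType) (c : R -> A) (v : nat -> A)
    (h : {rmorphism A -> B}) t :
  h (teval c v t) = teval (h \o c) (h \o v) t.
Proof.
elim: t => //= [n|t1 IH1 t2 IH2|t IH|t IH n|t1 IH1 t2 IH2|t IH|t IH n].
- by rewrite rmorph_nat.
- by rewrite rmorphD IH1 IH2.
- by rewrite rmorphN IH.
- by rewrite rmorphMn /= IH.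
- by rewrite rmorphM IH1 IH2.
- by rewrite rmorph0.
- by rewrite rmorphXn /= IH.
Qed.

Lemma eq_teval (R A : nzRingType) (c c' : R -> A) (v v' : nat -> A) t :
  c =1 c' -> v =1 v' -> teval c v t = teval c' v' t.
Proof. by move=> /funext -> /funext ->. Qed.

Lemma teval_eval (R : unitRingType) (s : seq R) t : GRing.rterm t ->
  teval id (nth 0 s) t = GRing.eval s t.
Proof.
by elim: t => //= [t1 IH1 t2 IH2 /andP[/IH1-> /IH2->]|t IH /IH->|t IH n /IH->|
   t1 IH1 t2 IH2 /andP[/IH1-> /IH2->]|t IH n /IH->].
Qed.

Lemma poly_root_list (F : fieldType) (p : {poly F}) : p != 0 ->
  exists s : seq F, (size s <= size p)%N /\ forall x, root p x -> x \in s.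
Proof.
move=> p0; have [n] := ubnP (size p); elim: n p p0 => // n IHn p p0 Hn.
case: (pselect (exists a, root p a)) => [[a pa]|noroot]; last first.
  by exists [::]; split=> // x px; case: noroot; exists x.
have /factor_theorem[q Eq] := pa.
have q0 : q != 0 by apply: contraNneq p0 => q0; rewrite Eq q0 mul0r.
have Esz : size p = (size q).+1 by rewrite Eq size_Mmonic ?monicXsubC // size_XsubC addn2.
have [|s [Hs Hr]] := IHn q q0; first by rewrite -ltnS -Esz.
exists (a :: s); split; first by rewrite Esz.
move=> x; rewrite Eq rootM root_XsubC in_cons orbC => /orP[->//|/Hr ->].
by rewrite orbT.
Qed.

Section QuantifierElimination.
Variable R : rcfType.

Definition interval_free (s : seq R) (p q : R) := forall c, c \in s -> ~ (p < c < q).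

Fixpoint to_ord (f : formula (orf_sym + R)) : Ord.formula R :=
  match f with
  | FRel (inl OLt) [:: x; y] => Ord.Lt (GRing.Var _ x) (GRing.Var _ y)
  | FRel (inl OAdd) [:: x; y; z] =>
      Ord.Equal (GRing.Add (GRing.Var _ x) (GRing.Var _ y)) (GRing.Var _ z)
  | FRel (inl OMul) [:: x; y; z] =>
      Ord.Equal (GRing.Mul (GRing.Var _ x) (GRing.Var _ y)) (GRing.Var _ z)
  | FRel (inr c) [:: x] => Ord.Equal (GRing.Var _ x) (GRing.Const c)
  | FRel _ _ => Ord.Bool false
  | FEq i j => Ord.Equal (GRing.Var _ i) (GRing.Var _ j)
  | FNot g => Ord.Not (to_ord g)
  | FAnd g h => Ord.And (to_ord g) (to_ord h)
  | FEx x g => Ord.Exists x (to_ord g)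
  end.

Lemma holds_to_ord (f : formula (orf_sym + R)) (e : nat -> R) (s : seq R) :
  (forall i, (i < vbound f)%N -> nth 0 s i = e i) ->
  sat (cinterp (@orf_interp R)) e f <-> Ord.holds s (to_ord f).
Proof.
elim: f e s => [r vs|i j|g IHg|g IHg h IHh|x g IHg] e s /= H.
- move: H; case: r => [[]|c]; case: vs => [|x [|y [|z [|w vs]]]] //= H;
    rewrite ?H ?leq_max ?leqnn ?orbT //.
  by split=> [[]|->].
- by rewrite !H // leq_max leqnn ?orbT.
- by rewrite (IHg e s).
- rewrite (IHg e s) ?(IHh e s) // => i Hi; apply: H; rewrite leq_max Hi ?orbT //.
- have E a : sat (cinterp (@orf_interp R)) (fun j => if j == x then a else e j) g <->
     Ord.holds (set_nth 0 s x a) (to_ord g).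
    apply: IHg => i Hi; rewrite nth_set_nth /=; case: eqP => // _.
    by rewrite H // leq_max Hi orbT.
  by split=> -[a /E Ha]; exists a.
Qed.

(** Each atom compares two terms, hence is decided by the sign of their difference. *)
Lemma qf_signs (f : Ord.formula R) : Ord.qf_form f -> Ord.rformula f ->
  exists ts : seq (GRing.term R), all (@GRing.rterm R) ts /\
   forall s s', (forall t, t \in ts -> Num.sg (GRing.eval s t) = Num.sg (GRing.eval s' t)) ->
   Ord.qf_eval s f = Ord.qf_eval s' f.
Proof.
have bin (f1 f2 : Ord.formula R) (op : bool -> bool -> bool) :
    (exists ts : seq (GRing.term R), all (@GRing.rterm R) ts /\
     forall s s', (forall t, t \in ts -> Num.sg (GRing.eval s t) = Num.sg (GRing.eval s' t)) ->
     Ord.qf_eval s f1 = Ord.qf_eval s' f1) ->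
    (exists ts : seq (GRing.term R), all (@GRing.rterm R) ts /\
     forall s s', (forall t, t \in ts -> Num.sg (GRing.eval s t) = Num.sg (GRing.eval s' t)) ->
     Ord.qf_eval s f2 = Ord.qf_eval s' f2) ->
    (exists ts : seq (GRing.term R), all (@GRing.rterm R) ts /\
     forall s s', (forall t, t \in ts -> Num.sg (GRing.eval s t) = Num.sg (GRing.eval s' t)) ->
     op (Ord.qf_eval s f1) (Ord.qf_eval s f2) =
     op (Ord.qf_eval s' f1) (Ord.qf_eval s' f2)).
  move=> [ts1 [r1 H1]] [ts2 [r2 H2]]; exists (ts1 ++ ts2); rewrite all_cat r1 r2; split=> //.
  move=> s s' H; rewrite (H1 s s') ?(H2 s s') // => t Ht; apply: H.
    by rewrite mem_cat Ht orbT.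
  by rewrite mem_cat Ht.
elim: f => //= [b|t1 t2|t1 t2|t1 t2|f1 IH1 f2 IH2|f1 IH1 f2 IH2|f1 IH1 f2 IH2|f IH] Hq.
- by exists [::].
- move=> /andP[r1 r2]; exists [:: GRing.Add t1 (GRing.Opp t2)]; rewrite /= r1 r2.
  split=> // s s' /(_ _ (mem_head _ _)) /= E.
  by rewrite -[LHS]subr_eq0 -[RHS]subr_eq0 -sgr_eq0 E sgr_eq0.
- move=> /andP[r1 r2]; exists [:: GRing.Add t2 (GRing.Opp t1)]; rewrite /= r1 r2.
  split=> // s s' /(_ _ (mem_head _ _)) /= E.
  by rewrite -[LHS]subr_gt0 -[RHS]subr_gt0 -sgr_gt0 E sgr_gt0.
- move=> /andP[r1 r2]; exists [:: GRing.Add t2 (GRing.Opp t1)]; rewrite /= r1 r2.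
  split=> // s s' /(_ _ (mem_head _ _)) /= E.
  by rewrite -[LHS]subr_ge0 -[RHS]subr_ge0 -sgr_ge0 E sgr_ge0.
- move=> /andP[r1 r2]; case/andP: Hq => q1 q2.
  exact: (bin f1 f2 andb (IH1 q1 r1) (IH2 q2 r2)).
- move=> /andP[r1 r2]; case/andP: Hq => q1 q2.
  exact: (bin f1 f2 orb (IH1 q1 r1) (IH2 q2 r2)).
- move=> /andP[r1 r2]; case/andP: Hq => q1 q2.
  exact: (bin f1 f2 implb (IH1 q1 r1) (IH2 q2 r2)).
- move=> r; have [ts [rt H]] := IH Hq r; exists ts; split=> // s s' /H ->//.
Qed.

Lemma qf_eval_signs (f : Ord.formula R) :
  exists ts : seq (GRing.term R), all (@GRing.rterm R) ts /\
   forall s s', (forall t, t \in ts -> Num.sg (GRing.eval s t) = Num.sg (GRing.eval s' t)) ->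
   Ord.holds s f <-> Ord.holds s' f.
Proof.
have rf := Ord.to_rform_rformula f.
have /andP[qf rq] := Ord.quantifier_elim_wf (@qe_rcf.wf_QE_wproj R) rf.
have [ts [rt H]] := qf_signs qf rq; exists ts; split=> // s s' /H E.
have P u := qe_rcf.rcf_satP u f.
by split=> /P Hs; apply/P; move: Hs; rewrite /qe_rcf.rcf_sat /Ord.proj_sat E.
Qed.

Lemma class_signs (P : (nat -> R) -> Prop) : field_class R P ->
  exists ts : seq (GRing.term R), forall e e' : nat -> R,
   (forall t, t \in ts -> Num.sg (teval id e t) = Num.sg (teval id e' t)) ->
   P e -> P e'.
Proof.
move=> [f Hf]; have [ts [rt H]] := qf_eval_signs (to_ord f).
pose tbound := fix tb (t : GRing.term R) : nat := match t with
  | GRing.Var i => i.+1 | GRing.Const _ => 0%N | GRing.NatConst _ => 0%N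
  | GRing.Add a b => maxn (tb a) (tb b) | GRing.Opp a => tb a
  | GRing.NatMul a _ => tb a | GRing.Mul a b => maxn (tb a) (tb b)
  | GRing.Inv a => tb a | GRing.Exp a _ => tb a end.
have tvE t (e e' : nat -> R) : (forall i, (i < tbound t)%N -> e i = e' i) ->
    teval id e t = teval id e' t.
  elim: t => //= [i|t1 IH1 t2 IH2|t IH|t IH n|t1 IH1 t2 IH2|t IH n] E.
  - exact: E.
  - by rewrite IH1 ?IH2 // => i Hi; apply: E; rewrite leq_max Hi ?orbT.
  - by rewrite IH.
  - by rewrite IH.
  - by rewrite IH1 ?IH2 // => i Hi; apply: E; rewrite leq_max Hi ?orbT.
  - by rewrite IH.
exists ts => e e' E.
pose n := maxn (vbound f) (\max_(t <- ts) tbound t).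
have E1 (u : nat -> R) : P u <-> Ord.holds (mkseq u n) (to_ord f).
  rewrite Hf; apply: holds_to_ord => i Hi; rewrite nth_mkseq //.
  by rewrite leq_max Hi.
have E2 (u : nat -> R) t : t \in ts -> GRing.eval (mkseq u n) t = teval id u t.
  move=> Ht; rewrite -teval_eval; last exact: (allP rt).
  have Ht' : (tbound t <= \max_(t <- ts) tbound t)%N by rewrite (big_rem t) //= leq_maxl.
  by apply: tvE => i Hi; rewrite nth_mkseq // leq_max (leq_trans Hi Ht') orbT.
by rewrite !E1 (H _ (mkseq e' n)) // => t Ht; rewrite !E2 // E.
Qed.

Definition tpoly (e : nat -> R) (t : GRing.term R) : {poly R} :=
  teval polyC (scons 'X (fun i => (e i)%:P)) t.

Lemma tpolyE (e : nat -> R) t x : (tpoly e t).[x] = teval id (scons x e) t.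
Proof.
rewrite /tpoly -[LHS]/(horner_eval x _) teval_morph; apply: eq_teval => [c|[|i]] /=;
  by rewrite /horner_eval ?hornerX ?hornerC.
Qed.

Lemma size_tpoly t : exists n, forall e, (size (tpoly e t) <= n)%N.
Proof.
rewrite /tpoly; elim: t => /= [i|c|n|t1 [n1 H1] t2 [n2 H2]|t [n H]|t [n H] m|
  t1 [n1 H1] t2 [n2 H2]|t _|t [n H] m].
- by exists 2%N => e; case: i => [|i] /=; rewrite ?size_polyX // (leq_trans (size_polyC_leq1 _)).
- by exists 1%N => e; apply: size_polyC_leq1.
- by exists 1%N => e; rewrite -polyC_natr; apply: size_polyC_leq1.
- exists (maxn n1 n2) => e; apply: leq_trans (size_polyD _ _) _.
  by rewrite geq_max !leq_max H1 H2 orbT.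
- by exists n => e; rewrite size_polyN.
- exists n => e; apply: leq_trans (H e); rewrite -scaler_nat; exact: size_scale_leq.
- exists (n1 + n2)%N => e; apply: leq_trans (size_polyMleq _ _) _.
  by apply: leq_trans (leq_pred _) _; apply: leq_add.
- by exists 0%N => e; rewrite size_poly0.
- exists ((n * m).+1)%N => e; apply: leq_trans (size_poly_exp_leq _ _) _.
  by rewrite ltnS leq_mul2r (leq_trans (leq_pred _)) ?orbT.
Qed.

Lemma class_tpoly (T : (nat -> R) -> R -> Prop) : dfamP (field_class R) T ->
  exists ts : seq (GRing.term R), forall e p q,
    (forall t c, t \in ts -> tpoly e t != 0 -> root (tpoly e t) c -> ~ (p < c < q)) ->
    forall x y, p < x < q -> p < y < q -> T e x -> T e y.
Proof.
move=> /class_signs[ts H]; exists ts => e p q nor x y Hx Hy.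
move=> Tx; apply: (H (scons x e) (scons y e)) => //.
move=> t Ht; rewrite -!tpolyE.
case: (eqVneq (tpoly e t) 0) => [->|p0]; first by rewrite !horner0.
apply: (@polyrcf.polyrN0_itv _ `]p, q[ (tpoly e t)); rewrite ?in_itv //=.
by move=> c; rewrite in_itv /= => Hc; apply/negP => rc; apply: (nor t c).
Qed.

Lemma tpoly_roots (ts : seq (GRing.term R)) :
  exists N : nat, forall e, exists s : seq R, (size s <= N)%N /\
    forall t c, t \in ts -> tpoly e t != 0 -> root (tpoly e t) c -> c \in s.
Proof.
elim: ts => [|t ts [N HN]]; first by exists 0%N => e; exists [::].
have [n Hn] := size_tpoly t; exists (n + N)%N => e.
have [s [Hs Hr]] := HN e.
case: (eqVneq (tpoly e t) 0) => [t0|t0].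
  exists s; split; first exact: leq_trans Hs (leq_addl _ _).
  move=> t' c; rewrite in_cons => /orP[/eqP->|]; first by rewrite t0 eqxx.
  exact: Hr.
have [s' [Hs' Hr']] := poly_root_list t0; exists (s' ++ s).
split; first by rewrite size_cat leq_add // (leq_trans Hs').
move=> t' c; rewrite in_cons mem_cat => /orP[/eqP->|Ht'] t'0 rc; first by rewrite Hr'.
by rewrite (Hr _ _ Ht') ?orbT.
Qed.

Theorem field_omin (T : (nat -> R) -> R -> Prop) : dfamP (field_class R) T ->
  exists N : nat, forall e, exists s : seq R, (size s <= N)%N /\
    forall p q, interval_free s p q ->
    forall x y, p < x < q -> p < y < q -> T e x -> T e y.
Proof.
move=> /class_tpoly[ts H]; have [N HN] := tpoly_roots ts.
exists N => e; have [s [Hs Hr]] := HN e; exists s; split=> // p q free.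
by apply: H => t c Ht t0 rc; apply: free; apply: Hr rc.
Qed.

Lemma point_interval_free (s : seq R) x : x \notin s ->
  exists2 d, 0 < d & interval_free s (x - d) (x + d).
Proof.
elim: s => [|a s IHs]; first by exists 1.
rewrite in_cons negb_or => /andP[xa /IHs[d d0 Hd]].
have ax : 0 < `|x - a| by rewrite normr_gt0 subr_eq0.
exists (Num.min d `|x - a|); first by rewrite lt_min d0.
move=> c; rewrite in_cons => /orP[/eqP->|cs] /andP[].
  move=> H1 H2; have : `|x - a| < Num.min d `|x - a| by rewrite ltr_norml; apply/andP; split; lra.
  by rewrite lt_min ltxx andbF.
move=> H1 H2; apply: (Hd c cs); apply/andP; split.
  by apply: le_lt_trans H1; rewrite lerD2l lerN2 ge_min lexx.
by apply: lt_le_trans H2 _; rewrite lerD2l ge_min lexx.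
Qed.

(** Away from the roots of the polynomials that decide [y = g x], the truth of this equation is
    locally constant in [y]. It holds at a single point, so [g x] is always such a root; the product
    of the polynomials that are nonzero in two variables serves for all [x]. *)
Theorem field_algebraic (g : R -> R) : dfun1 (field_class R) g ->
  exists2 P : {poly {poly R}}, P != 0 & forall x, (P.[(g x)%:P]).[x] = 0.
Proof.
move=> Dg.
have DT : dfamP (field_class R) (fun e y => y = g (e 0%N)) by rewrite /dfamP; dtac.
have [ts H] := class_tpoly DT.
pose bp (t : GRing.term R) : {poly {poly R}} :=
  teval (polyC \o polyC) (fun i => match i with 0 => 'X | 1 => 'X%:P | _ => 0 end) t.
pose ex x : nat -> R := fun i => if i is 0 then x else 0.
have bpE t x : map_poly (horner_eval x) (bp t) = tpoly (ex x) t.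
  rewrite /bp teval_morph /tpoly; apply: eq_teval => [c|[|[|i]]] /=.
  - by rewrite map_polyC /= /horner_eval hornerC.
  - by rewrite map_polyX.
  - by rewrite map_polyC /= /horner_eval hornerX.
  - by rewrite map_polyC /= /horner_eval horner0.
have bpE' t x y : ((bp t).[y%:P]).[x] = (tpoly (ex x) t).[y].
  rewrite -bpE -[LHS]/(horner_eval x _) -horner_map /= /horner_eval hornerC //.
exists (\prod_(t <- ts | bp t != 0) bp t).
  by rewrite prodf_seq_neq0; apply/allP => t _; apply/implyP.
move=> x; apply/eqP.
have [//|/negP Hn] := boolP (_ == 0).
have Hroot t : t \in ts -> tpoly (ex x) t != 0 -> ~~ root (tpoly (ex x) t) (g x).
  move=> Ht t0; apply/negP => rt; apply: Hn.
  have b0 : bp t != 0 by apply: contraNneq t0 => b0; rewrite -bpE b0 rmorph0.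
  rewrite -[X in X == 0]/(horner_eval x _) horner_prod rmorph_prod /=.
  rewrite prodf_seq_eq0; apply/hasP; exists t => //; rewrite b0 /= /horner_eval bpE'.
  exact: rt.
have [N /(_ (ex x))[s [_ Hs]]] := tpoly_roots ts.
have [|d d0 Hd] := @point_interval_free [seq c <- s | c != g x] (g x).
  by rewrite mem_filter eqxx.
have Hfree : forall t c, t \in ts -> tpoly (ex x) t != 0 -> root (tpoly (ex x) t) c ->
    ~ (g x - d < c < g x + d).
  move=> t c Ht t0 rc; apply: Hd; rewrite mem_filter (Hs t) // andbT.
  by apply: contraTneq rc => ->; apply: Hroot.
have /= E := H (ex x) (g x - d) (g x + d) Hfree (g x) (g x + d / 2).
suff : g x + d / 2 = g x by lra.
by apply: E => //; lra.
Qed.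

End QuantifierElimination.

(** * O-minimal calculus *)

Section Germs.
Variable R : rcfType.
Implicit Types (A B : R -> Prop) (f g : R -> R) (l m : R).

Definition ev A := exists X : R, forall x, X < x -> A x.

Lemma ev_all A : (forall x, A x) -> ev A.
Proof. by move=> H; exists 0. Qed.

Lemma ev_gt X : ev (fun x => X < x).
Proof. by exists X. Qed.

Lemma ev_and A B : ev A -> ev B -> ev (fun x => A x /\ B x).
Proof.
move=> [X HX] [Y HY]; exists (Num.max X Y) => x.
by rewrite gt_max => /andP[/HX Ax /HY Bx].
Qed.

Lemma ev_mono A B : (forall x, A x -> B x) -> ev A -> ev B.
Proof. by move=> AB [X HX]; exists X => x /HX /AB. Qed.

Lemma ev_ex A : ev A -> exists x, A x.
Proof. by move=> [X HX]; exists (X + 1); apply: HX; rewrite ltrDl. Qed.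

Lemma ev_shift A a : ev A -> ev (fun x => A (x + a)).
Proof. by move=> [X HX]; exists (X - a) => x Hx; apply: HX; rewrite -ltrBlDr. Qed.

Definition limat f l := forall d : R, 0 < d -> ev (fun x => `|f x - l| < d).
Definition limoo f := forall M : R, ev (fun x => M < f x).

Lemma limat_ev f g l : ev (fun x => f x = g x) -> limat f l -> limat g l.
Proof.
by move=> E L d d0; apply: ev_mono (ev_and E (L d d0)) => x [<-].
Qed.

Lemma limat_cst c : limat (fun=> c) c.
Proof. by move=> d d0; apply: ev_all => x; rewrite subrr normr0. Qed.

Lemma limat_add f g l m : limat f l -> limat g m -> limat (fun x => f x + g x) (l + m).
Proof.
move=> Lf Lg d d0; have d2 : 0 < d / 2 by lra.
apply: ev_mono (ev_and (Lf _ d2) (Lg _ d2)) => x [H1 H2].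
rewrite opprD addrACA; apply: le_lt_trans (ler_normD _ _) _; lra.
Qed.

Lemma limat_opp f l : limat f l -> limat (fun x => - f x) (- l).
Proof.
by move=> L d d0; apply: ev_mono (L d d0) => x; rewrite -opprD normrN.
Qed.

Lemma limat_mul f g l m : limat f l -> limat g m -> limat (fun x => f x * g x) (l * m).
Proof.
move=> Lf Lg d d0.
pose K := `|l| + `|m| + 1; have K0 : 0 < K by rewrite /K; have := normr_ge0 l; have := normr_ge0 m; lra.
pose dd := Num.min 1 (d / K / 2).
have dd0 : 0 < dd by rewrite lt_min ltr01 !divr_gt0.
have Hdd : dd * K < d.
  have : dd <= d / K / 2 by rewrite ge_min lexx orbT.
  rewrite -(ler_pM2r K0) => /le_lt_trans; apply.
  have -> : d / K / 2 * K = d / 2 by field; rewrite gt_eqF.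
  lra.
apply: ev_mono (ev_and (Lf _ dd0) (Lg _ dd0)) => x [H1 H2].
have -> : f x * g x - l * m = (f x - l) * (g x - m) + ((f x - l) * m + l * (g x - m)) by ring.
apply: le_lt_trans (ler_normD _ _) _.
have : `|(f x - l) * m + l * (g x - m)| <= dd * `|m| + `|l| * dd.
  apply: le_trans (ler_normD _ _) _; rewrite !normrM lerD //.
    by rewrite ler_wpM2r // ltW.
  by rewrite ler_wpM2l // ltW.
have : `|(f x - l) * (g x - m)| <= dd * 1.
  rewrite normrM ler_pM ?normr_ge0 // ltW //.
  by apply: lt_le_trans H2 _; rewrite ge_min lexx.
move: Hdd; rewrite /K; lra.
Qed.

Lemma limat_inv f l : l != 0 -> limat f l -> limat (fun x => (f x)^-1) l^-1.
Proof.
move=> l0 Lf d d0; have nl0 : 0 < `|l| by rewrite normr_gt0.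
have d1 : 0 < `|l| / 2 by lra.
have d2 : 0 < d * `|l| * (`|l| / 2) by rewrite mulr_gt0 // mulr_gt0.
apply: ev_mono (ev_and (Lf _ d1) (Lf _ d2)) => x [H1 H2].
have Hf : `|l| / 2 < `|f x|.
  have : `|l| <= `|l - f x| + `|f x| by rewrite -{1}(subrK (f x) l) ler_normD.
  rewrite distrC; lra.
have f0 : f x != 0 by rewrite -normr_gt0; lra.
have -> : (f x)^-1 - l^-1 = (l - f x) / (f x * l) by field; rewrite f0 l0.
rewrite normrM normfV normrM ltr_pdivrMr ?mulr_gt0 //; last by lra.
rewrite distrC; apply: lt_trans H2 _.
by rewrite [ltRHS](_ : _ = d * `|l| * `|f x|) ?ltr_pM2l ?mulr_gt0 //; ring.
Qed.

Lemma limat_uniq f l m : limat f l -> limat f m -> l = m.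
Proof.
move=> Ll Lm; apply/eqP; apply: contrapT => /negP lm.
have d0 : 0 < `|l - m| / 2 by rewrite divr_gt0 // normr_gt0 subr_eq0.
have [x [H1 H2]] := ev_ex (ev_and (Ll _ d0) (Lm _ d0)).
have : `|l - m| <= `|l - f x| + `|f x - m| by apply: le_trans (ler_normD _ _); rewrite addrA subrK.
by rewrite [`|l - f x|]distrC; lra.
Qed.

Lemma limat_shift f l a : limat f l -> limat (fun x => f (x + a)) l.
Proof. by move=> L d d0; apply: (ev_shift a (L d d0)). Qed.

Lemma limat_gt f l c : limat f l -> c < l -> ev (fun x => c < f x).
Proof.
move=> L cl; have d0 : 0 < l - c by rewrite subr_gt0.
apply: ev_mono (L _ d0) => x; rewrite ltr_norml => /andP[]; lra.
Qed.

Lemma limat_exp f l n : limat f l -> limat (fun x => f x ^+ n) (l ^+ n).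
Proof.
move=> L; elim: n => [|n IHn]; first exact: limat_cst.
rewrite exprS; apply: (@limat_ev (fun x => f x * f x ^+ n)).
  by apply: ev_all => x; rewrite exprS.
exact: limat_mul.
Qed.

Definition is_lub A l := (forall a, A a -> a <= l) /\ forall m, m < l -> exists2 a, A a & m < a.
Definition is_glb A l := (forall a, A a -> l <= a) /\ forall m, l < m -> exists2 a, A a & a < m.

Lemma glb_uniq A l m : is_glb A l -> is_glb A m -> l = m.
Proof.
move=> [l1 l2] [m1 m2]; apply/eqP; rewrite eq_le !leNgt; apply/andP; split; apply/negP.
  by move=> /m2[a /l1]; rewrite leNgt => /negP.
by move=> /l2[a /m1]; rewrite leNgt => /negP.
Qed.

End Germs.

(** * Definable completeness, limits and definable choice *)

Section Ominimal.
Variables (R : rcfType) (D : dclass R).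
Hypothesis DO : forall P, D P -> field_class R P.
Implicit Types (A B : R -> Prop) (f g : R -> R) (T : (nat -> R) -> R -> Prop).

Lemma dfam_fix T e : dfamP D T -> dset1 D (T e).
Proof. by move=> DT; rewrite /dset1; dtac. Qed.

Lemma dfunfam_fix (f : (nat -> R) -> R -> R) e : dfam D f -> dfun1 D (f e).
Proof. by move=> DT; rewrite /dfun1; dtac. Qed.

Lemma omin1 A : dset1 D A -> exists s : seq R, forall p q, interval_free s p q ->
    forall x y, p < x < q -> p < y < q -> A x -> A y.
Proof.
move=> DA; have DT : dfamP D (fun _ => A) by rewrite /dfamP; dtac.
have [N /(_ (fun=> 0))[s [_ Hs]]] := field_omin (DO DT).
by exists s.
Qed.

Lemma ev_dec A : dset1 D A -> ev A \/ ev (fun x => ~ A x).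
Proof.
move=> DA; have [s Hs] := omin1 DA.
have [X HX] : exists X : R, forall c, c \in s -> c <= X.
  elim: s {Hs} => [|c s [X HX]]; first by exists 0.
  exists (Num.max c X) => c'; rewrite in_cons le_max => /orP[/eqP->|/HX ->].
    by rewrite lexx.
  by rewrite orbT.
have const x y : X < x -> X < y -> A x -> A y.
  move=> Xx Xy; apply: (Hs X (Num.max x y + 1)).
  - by move=> c /HX; rewrite leNgt => /negP H /andP[].
  - by rewrite Xx (@le_lt_trans _ _ (Num.max x y)) ?le_max ?lexx ?ltrDl.
  - by rewrite Xy (@le_lt_trans _ _ (Num.max x y)) ?le_max ?lexx ?orbT ?ltrDl.
case: (pselect (A (X + 1))) => HA; [left|right]; exists X => x Xx.
  by apply: const HA; rewrite ?ltrDl.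
by move=> Ax; apply: HA; apply: const Ax; rewrite ?ltrDl.
Qed.

(** Each break point that falls into the gap replaces [lo] or [hi] according to its membership in
    [A]. *)
Lemma cut_gap A (s : seq R) x b : (forall u v, u <= v -> A v -> A u) -> A x -> ~ A b ->
  exists lo hi, [/\ A lo, ~ A hi, lo < hi & interval_free s lo hi].
Proof.
move=> dn Ax Ab; elim: s => [|c s [lo [hi [Alo Ahi lt Hs]]]].
  by exists x, b; split=> //; rewrite ltNge; apply/negP => /dn /(_ Ax).
case: (boolP (lo < c < hi)) => [/andP[c1 c2]|c3]; last first.
  exists lo, hi; split=> // u; rewrite in_cons => /orP[/eqP->|/Hs//]; exact/negP.
case: (pselect (A c)) => Ac; [exists c, hi|exists lo, c]; split=> // u;
  rewrite in_cons => /orP[/eqP->|us] /andP[u1 u2]; try by move: u1 u2; rewrite ltxx.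
- by apply: (Hs u us); rewrite u2 (lt_trans c1 u1).
- by apply: (Hs u us); rewrite u1 (lt_trans u2 c2).
Qed.

(** The downward closure [L] is constant inside a gap of its break points that contains the cut, so
    the supremum is one of the two ends of the gap. *)
Lemma lub_ex A : dset1 D A -> (exists a, A a) -> (exists b, forall a, A a -> a <= b) ->
  exists l, is_lub A l.
Proof.
move=> DA [a Aa] [b Hb]; pose L x := exists y, A y /\ x <= y.
have DL : dset1 D L by rewrite /dset1 /L; dtac.
have [s Hs] := omin1 DL.
have dn u v : u <= v -> L v -> L u by move=> uv [y [Ay vy]]; exists y; rewrite (le_trans uv).
have La : L a by exists a.
have Lb : ~ L (b + 1) by move=> [y [/Hb y1 y2]]; lra.
have [lo [hi [[y [Ay loy]] Lhi lohi free]]] := cut_gap s dn La Lb.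
have Hc := Hs _ _ free.
case: (pselect (L ((lo + hi) / 2))) => Lm.
  exists hi; split=> [u Au|m mhi].
    by rewrite leNgt; apply/negP => hu; apply: Lhi; exists u; rewrite ltW.
  pose m' := Num.max m ((lo + hi) / 2).
  have Hm' : lo < (m' + hi) / 2 < hi.
    have : (lo + hi) / 2 <= m' by rewrite le_max lexx orbT.
    have : m' < hi by rewrite gt_max mhi; lra.
    by move=> *; apply/andP; split; lra.
  have [z [Az mz]] : L ((m' + hi) / 2).
    by apply: Hc Lm => //; apply/andP; split; lra.
  exists z => //; have : m <= m' by rewrite le_max lexx.
  by move/andP: Hm'; lra.
exists lo; split=> [u Au|m mlo]; last by exists y => //; apply: lt_le_trans loy.
rewrite leNgt; apply/negP => lou.
have uhi : u < hi.
  by rewrite ltNge; apply/negP => hu; apply: Lhi; exists u.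
by apply: Lm; apply: (Hc u); [apply/andP|apply/andP; split; lra|exists u].
Qed.

Lemma glb_ex A : dset1 D A -> (exists a, A a) -> (exists b, forall a, A a -> b <= a) ->
  exists l, is_glb A l.
Proof.
move=> DA [a Aa] [b Hb].
have DA' : dset1 D (fun x => A (- x)) by rewrite /dset1; dtac.
have [||l [l1 l2]] := lub_ex DA'.
- by exists (- a); rewrite opprK.
- by exists (- b) => x /Hb; lra.
exists (- l); split=> [x Ax|m Hm]; first by have := l1 (- x); rewrite opprK => /(_ Ax); lra.
by have [|x Ax Hx] := l2 (- m); [lra|exists (- x) => //; lra].
Qed.

(** The limit is the supremum of the eventual lower bounds: by [ev_dec], every level that is not an
    eventual strict lower bound is an eventual upper bound. *)
Lemma lim_ex f : dfun1 D f ->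
  [\/ exists l, limat f l, limoo f | limoo (fun x => - f x)].
Proof.
move=> Df; pose A c := ev (fun x => c < f x).
have DA : dset1 D A by rewrite /dset1 /A /ev; dtac.
have nA c : ~ A c -> ev (fun x => f x <= c).
  move=> Ac; have [//|H] : ev (fun x => c < f x) \/ ev (fun x => ~ c < f x).
    by apply: ev_dec; rewrite /dset1; dtac.
  by apply: ev_mono H => x /negP; rewrite -leNgt.
case: (pselect (exists a, A a)) => [neA|eA]; last first.
  apply: Or33 => M; have : ~ A (- M - 1) by move=> H; apply: eA; exists (- M - 1).
  by move/nA; apply: ev_mono => x; lra.
case: (pselect (exists b, forall a, A a -> a <= b)) => [bA|ubA]; last first.
  apply: Or32 => M; apply: contrapT => HM; apply: ubA; exists M => a Aa.
  by rewrite leNgt; apply/negP => Ma; apply: HM; apply: ev_mono Aa => x; apply: lt_trans.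
have [l [l1 l2]] := lub_ex DA neA bA; apply: Or31; exists l => d d0.
have [|a Aa Ha] := l2 (l - d); first lra.
have /nA H : ~ A (l + d / 2) by move=> /l1; lra.
apply: ev_mono (ev_and Aa H) => x [H1 H2]; rewrite ltr_norml; apply/andP; split; lra.
Qed.

Lemma dfun_desc T : dfamP D T -> (forall e x y, T e x -> T e y -> x = y) ->
  exists2 h, dfun D h & forall e, (exists x, T e x) -> T e (h e).
Proof.
move=> DT uT.
exists (fun e => if pselect (exists x, T e x) is left H then projT1 (cid H) else 0); last first.
  by move=> e He; case: pselect => // H; case: cid.
apply: (@dset_ext _ _ (fun e => T (tl e) (e 0%N) \/ ~ (exists x, T (tl e) x) /\ e 0%N = 0));
  last by dtac.
move=> e; case: pselect => H.
  case: cid => x Tx /=; split=> [[Te|[]//]|->]; [exact: uT Te Tx|by left].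
by split=> [[Te|[]//]|->]; [case: H; exists (e 0%N)|right].
Qed.

(** The infimum [a] is chosen if it is attained. Otherwise, by o-minimality, the set contains an
    interval to the right of [a]; the choice is the midpoint of [a] and [b], where [b] is the
    infimum of the missing points above [a], or [a + 1] if none is missing. *)
Lemma choice_pos T : dfamP D T -> (forall e x, T e x -> 0 < x) ->
  exists2 h, dfun D h & forall e, (exists x, T e x) -> T e (h e).
Proof.
move=> DT Tpos.
have Dg U : dfamP D U -> dfamP D (fun e x => is_glb (U e) x).
  move=> DU; rewrite /dfamP; apply: (@dset_ext _ _ (fun e => (forall a, U (tl e) a -> e 0%N <= a) /\
     forall m, e 0%N < m -> exists a, U (tl e) a /\ a < m)); last by dtac.
  move=> e; split=> -[H1 H2]; split=> // m /H2.
    by case=> a []; exists a.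
  by case=> a H3 H4; exists a.
have [a Da Ha] := dfun_desc (Dg _ DT) (fun e x y => @glb_uniq R _ x y).
pose U e x := a e < x /\ ~ T e x.
have DU : dfamP D U by rewrite /dfamP /U; dtac.
have [b Db Hb] := dfun_desc (Dg _ DU) (fun e x y => @glb_uniq R _ x y).
exists (fun e => if `[< T e (a e) >] then a e else
   if `[< exists x, U e x >] then (a e + b e) / 2 else a e + 1); first by dtac.
move=> e Te.
have {}Ha : is_glb (T e) (a e).
  apply: Ha; apply: glb_ex (dfam_fix e DT) Te _.
  by exists 0 => x /Tpos /ltW.
case: asboolP => // Ta.
have [s Hs] := omin1 (dfam_fix e DT).
have [d d0 Hd] : exists2 d, 0 < d & interval_free s (a e) (a e + d).
  have [|d d0 Hd] := @point_interval_free _ [seq c <- s | c != a e] (a e).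
    by rewrite mem_filter eqxx.
  exists d => // c cs /andP[c1 c2]; apply: (Hd c); last by apply/andP; split; lra.
  by rewrite mem_filter cs gt_eqF.
have Tr x : a e < x < a e + d -> T e x.
  have [y Ty /= Hy] := Ha.2 (a e + d) ltac:(lra).
  have ay : a e < y.
    by rewrite lt_neqAle Ha.1 // andbT; apply: contra_notN Ta => /eqP->.
  by move=> Hx; apply: (Hs _ _ Hd y) => //; rewrite ay.
case: asboolP => Ue; last first.
  by apply: contrapT => H; apply: Ue; exists (a e + 1); split=> //; lra.
have {}Hb : is_glb (U e) (b e).
  apply: Hb; apply: glb_ex (dfam_fix e DU) Ue _.
  by exists (a e) => x [/ltW].
have adb : a e + d <= b e.
  rewrite leNgt; apply/negP => /Hb.2[x [ax Tx] xd].
  by apply: Tx; apply: Tr; rewrite ax.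
apply: contrapT => H.
have ab : a e < (a e + b e) / 2 by lra.
by have := Hb.1 ((a e + b e) / 2) (conj ab H); lra.
Qed.

Lemma definable_choice T : dfamP D T ->
  exists2 h, dfun D h & forall e, (exists x, T e x) -> T e (h e).
Proof.
move=> DT.
have [|h1 D1 H1] := @choice_pos (fun e x => 0 < x /\ T e x) _ (fun e x => @proj1 _ _).
  by rewrite /dfamP; dtac.
have [|h2 D2 H2] := @choice_pos (fun e x => 0 < x /\ T e (- x)) _ (fun e x => @proj1 _ _).
  by rewrite /dfamP; dtac.
exists (fun e => if `[< T e 0 >] then 0 else if `[< T e (h1 e) >] then h1 e else - h2 e).
  by dtac.
move=> e [x Tx]; case: asboolP => // T0; case: asboolP => // T1.
have [x0|x0|x0] := ltgtP 0 x; last by case: T0; rewrite x0.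
  by case: T1; apply: (H1 e _).2; exists x.
by apply: (H2 e _).2; exists (- x); rewrite opprK; split=> //; lra.
Qed.

Lemma choice_env k P : D P -> exists2 c : (nat -> R) -> nat -> R,
  (forall i, dfun D (fun a => c a i)) &
  forall a, (exists e, (forall i, e (k + i)%N = a i) /\ P e) ->
     (forall i, c a (k + i)%N = a i) /\ P (c a).
Proof.
elim: k P => [|k IHk] P DP.
  exists (fun a => a) => [i|a [e [He Pe]]]; first by dtac.
  by split=> //; have <- : e = a by apply: funext.
have DT : dfamP D (fun e x => P (scons x e)) by rewrite /dfamP; dtac; case: i => [|i]; dtac.
have [h Dh Hh] := definable_choice DT.
have [|c Dc Hc] := IHk (fun e => exists x, P (scons x e)); first by dtac.
exists (fun a => scons (h (c a)) (c a)).
  by apply: dfun_comp_scons => //; dtac.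
move=> a [e [He Pe]]; have [|c1 c2] := Hc a.
  exists (tl e); split=> [i|]; first exact: He.
  by exists (e 0%N); rewrite scons_tl.
by split=> [i|]; [apply: c1|apply: Hh].
Qed.

(** This provides the curves of counterexamples. Only the finitely many coordinates that [W] depends
    on are chosen; the others are set to 0. *)
Lemma choice_curve (W : (nat -> R) -> R -> Prop) : dfamP D W ->
  exists2 c : R -> nat -> R, (forall i, dfun1 D (fun s => c s i)) &
  forall s, (exists e, W e s) -> W (c s) s.
Proof.
move=> DW; have [n Hn] := d_fin DW.
pose P e := W (fun i => if (i < n)%N then e i else 0) (e n).
have DP : D P.
  apply: (dfamP_app DW); last by dtac.
  by move=> i; case: (i < n)%N; dtac.
have [c Dc Hc] := choice_env n DP.
exists (fun s i => if (i < n)%N then c (fun=> s) i else 0).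
  move=> i; rewrite /dfun1; case: (i < n)%N; last by dtac.
  by apply: (dfun_app (Dc i)) => j; dtac.
move=> s [e We]; have [|c1 c2] := Hc (fun=> s); last by move: c2; rewrite /P -(addn0 n) c1 addn0.
exists (fun i => if (i < n)%N then e i else s); split.
  by move=> i; rewrite ltnNge leq_addr.
rewrite /P ltnn; apply: (Hn (scons s e)
  (scons s (fun i => if (i < n)%N then if (i < n)%N then e i else s else 0))) We.
by case=> [|i] //= Hi; rewrite !(ltnW Hi).
Qed.

(** Some natural number is not a break point, so [A] contains a neighbourhood of it and, by
    subtraction, one of 0; a supremum argument then stands in for the archimedean property. Applied
    to sets of increments [t], it extends a fact about [t = 1] to all [t]. *)
Lemma subgroup_total A : dset1 D A -> A 1 -> (forall x y, A x -> A y -> A (x - y)) ->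
  forall x, A x.
Proof.
move=> DA A1 Asub.
have A0 : A 0 by rewrite -(subrr 1); apply: Asub.
have Aopp x : A x -> A (- x) by move=> Ax; rewrite -sub0r; apply: Asub.
have Aadd x y : A x -> A y -> A (x + y) by move=> Ax /Aopp Ay; rewrite -(opprK y); apply: Asub.
have An n : A n%:R by elim: n => // n An; rewrite -addn1 natrD; apply: Aadd.
have [s Hs] := omin1 DA.
have [n ns] : exists n : nat, n%:R \notin s.
  apply: contrapT => H.
  have : (size [seq i%:R : R | i <- iota 0 (size s).+1] <= size s)%N.
    apply: uniq_leq_size.
      by rewrite map_inj_uniq ?iota_uniq // => i j /eqP; rewrite eqr_nat => /eqP.
    move=> x /mapP[i _ ->]; apply: contrapT => /negP Hi; apply: H; by exists i.
  by rewrite size_map size_iota ltnn.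
have [d d0 Hd] := point_interval_free ns.
have Asmall x : - d < x < d -> A x.
  move=> /andP[x1 x2]; have -> : x = (n%:R + x) - n%:R by ring.
  by apply: Asub => //; apply: (Hs _ _ Hd n%:R) => //; apply/andP; split; lra.
suff Apos x : 0 <= x -> A x.
  by move=> x; have [/Apos//|x0] := lerP 0 x; rewrite -(opprK x); apply/Aopp/Apos; lra.
move=> x0; apply: contrapT => nAx.
pose L u := forall y, 0 <= y -> y <= u -> A y.
have DL : dset1 D L by rewrite /dset1 /L; dtac.
have [||l [l1 l2]] := lub_ex DL.
- by exists 0 => y y1 y2; have -> : y = 0 by lra.
- by exists x => a La; rewrite leNgt; apply/negP => xa; apply: nAx; apply: La => //; apply: ltW.
have [|a La Ha] := l2 (l - d / 2); first lra.
have /l1 : L (l + d / 4); last lra.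
move=> y y0 Hy; have [ya|ay] := lerP y a; first exact: La.
have [a0|a0] := lerP 0 a.
  have -> : y = a + (y - a) by ring.
  by apply: Aadd; [apply: La|apply: Asmall; apply/andP; split; lra].
have := l1 0; case: (pselect (L 0)) => [L0 /(_ L0) ll|[]]; last first.
  by move=> z z1 z2; have -> : z = 0 by lra.
by apply: Asmall; apply/andP; split; lra.
Qed.

End Ominimal.

(** * Regular variation *)

Section RegularVariation.
Variable R : rcfType.
Implicit Types (f g : R -> R).
Notation O := (field_class R).

Lemma field_class_id (P : (nat -> R) -> Prop) : O P -> O P. Proof. by []. Qed.

Lemma limat_Vx : limat (fun x : R => x^-1) 0.
Proof.
move=> d d0; apply: ev_mono (ev_and (ev_gt 0) (ev_gt d^-1)) => x [x0 dx].
by rewrite subr0 gtr0_norm ?invr_gt0 // -(invrK d) ltf_pV2 // posrE invr_gt0.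
Qed.

Lemma limat_shift_ratio (a : R) : limat (fun x => (x + a) / x) 1.
Proof.
have L : limat (fun x : R => 1 + a * x^-1) (1 + a * 0).
  by apply: limat_add (limat_cst _) (limat_mul (limat_cst _) limat_Vx).
rewrite mulr0 addr0 in L; apply: limat_ev L; apply: ev_mono (ev_gt 0) => x x0.
by rewrite mulrDl divff // gt_eqF.
Qed.

Lemma dominant (T : eqType) (s : seq T) (m : T -> R -> R) i0 : i0 \in s ->
  (forall i, dfun1 O (m i)) ->
  exists2 k, k \in s & forall i, i \in s -> ev (fun x => `|m i x| <= `|m k x|).
Proof.
move=> i0s Dm; elim: s i0 i0s => // j s IH i0 _.
case: s IH => [|j' s] IH.
  by exists j; rewrite ?mem_head // => i; rewrite inE => /eqP ->; apply: ev_all.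
have [k ks Hk] := IH j' (mem_head _ _).
have [H|H] : ev (fun x => `|m j x| <= `|m k x|) \/ ev (fun x => ~ `|m j x| <= `|m k x|).
- by apply: (@ev_dec _ O field_class_id); have Dj := Dm j; have Dk := Dm k; rewrite /dset1; dtac.
- exists k; first by rewrite in_cons ks orbT.
  by move=> i; rewrite in_cons => /orP[/eqP->|/Hk].
exists j; first exact: mem_head.
move=> i; rewrite in_cons => /orP[/eqP->|/Hk Hi]; first by apply: ev_all.
apply: ev_mono (ev_and H Hi) => x [/negP]; rewrite -ltNge => /ltW H1 H2.
exact: le_trans H2 H1.
Qed.

Lemma horner2E (P : {poly {poly R}}) x y :
  (P.[y%:P]).[x] = \sum_(j < size P) \sum_(i < size (P`_j)%R) P`_j`_i * x ^+ i * y ^+ j.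
Proof.
rewrite (horner_coef P) horner_sum; apply: eq_bigr => j _.
rewrite hornerM -polyC_exp hornerC horner_coef mulr_suml //.
Qed.

(* Two monomials of an equation P(x, g x) = 0 have to balance asymptotically. *)
Lemma balanced_monomials g : dfun1 O g -> ev (fun x => g x != 0) ->
  exists i j k l : nat, j != l /\ exists c c' : R, [/\ 0 < c, 0 < c' &
    ev (fun x => c * `|x ^+ k * g x ^+ l| <= `|x ^+ i * g x ^+ j| /\
                 `|x ^+ i * g x ^+ j| <= c' * `|x ^+ k * g x ^+ l|)].
Proof.
move=> Dg g0; have [P P0 HP] := field_algebraic Dg.
pose n := maxn (size P) (\max_(j < size P) size (P`_j)%R).
pose s := [seq m <- [seq (j, i) | j <- iota 0 n, i <- iota 0 n] | P`_m.1`_m.2 != 0].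
pose mon (m : nat * nat) x := P`_m.1`_m.2 * x ^+ m.2 * g x ^+ m.1.
have us : uniq s.
  apply: filter_uniq; apply: allpairs_uniq; rewrite ?iota_uniq //.
  by move=> [a b] [a' b'] _ _ /= [-> ->].
have Hsum x : \sum_(m <- s) mon m x = 0.
  rewrite -[RHS](HP x) horner2E big_filter.
  have -> : \sum_(m <- [seq (j, i) | j <- iota 0 n, i <- iota 0 n] | P`_m.1`_m.2 != 0) mon m x
     = \sum_(m <- [seq (j, i) | j <- iota 0 n, i <- iota 0 n]) mon m x.
    rewrite big_mkcond; apply: eq_bigr => m _; case: eqP => //= E.
    by rewrite /mon E !mul0r.
  rewrite big_allpairs /=.
  have -> : iota 0 n = index_iota 0 n by rewrite /index_iota subn0.
  rewrite (big_mkord xpredT (fun j => \sum_(i <- index_iota 0 n) mon (j, i) x)).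
  have Hn : (size P <= n)%N by rewrite leq_maxl.
  rewrite (big_ord_widen_cond n xpredT (fun j => \sum_(i < size (P`_j)%R) P`_j`_i * x ^+ i * g x ^+ j)) //.
  rewrite [RHS]big_mkcond /=; apply: eq_bigr => j _; case: ifP => Hj.
    rewrite (big_mkord xpredT (fun i => mon (nat_of_ord j, i) x)).
    have Hn' : (size (P`_j)%R <= n)%N.
      rewrite leq_max; apply/orP; right.
      exact: (@leq_bigmax _ (fun j : 'I_(size P) => size (P`_j)%R) (Ordinal Hj)).
    rewrite [RHS](big_ord_widen_cond n xpredT (fun i => P`_j`_i * x ^+ i * g x ^+ j)) //.
    rewrite [RHS]big_mkcond /=; apply: eq_bigr => i _; case: ifP => Hi //.
    by rewrite /mon /= (nth_default _ (s := P`_j)) ?mul0r ?mul0r // leqNgt Hi.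
  rewrite big1 // => i _; rewrite /mon /= [P`_j]nth_default ?coef0 ?mul0r ?mul0r //.
  by rewrite leqNgt Hj.
have cs m : m \in s -> P`_m.1`_m.2 != 0 by rewrite mem_filter => /andP[].
have Dmon m : dfun1 O (mon m) by rewrite /dfun1 /mon; otac.
have mon0 m : m \in s -> ev (fun x => mon m x != 0).
  move=> /cs c0; apply: ev_mono (ev_and g0 (ev_gt 0)) => x [gx x0].
  by rewrite /mon !mulf_neq0 // expf_neq0 // gt_eqF.
have [m0 m0s] : exists m, m \in s.
  pose j := (size P).-1; pose i := (size (P`_j)%R).-1.
  have jP : P`_j != 0 by rewrite -lead_coefE lead_coef_eq0.
  have iP : P`_j`_i != 0 by rewrite -lead_coefE lead_coef_eq0.
  have Hj : (j < size P)%N by rewrite /j prednK // size_poly_gt0.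
  have Hi : (i < size (P`_j)%R)%N by rewrite /i prednK // size_poly_gt0.
  exists (j, i); rewrite mem_filter /= iP; apply/allpairsP; exists (j, i) => /=.
  rewrite !mem_iota /= !add0n; split=> //.
    by rewrite leq_max Hj.
  rewrite leq_max; apply/orP; right; apply: leq_trans Hi _.
  exact: (@leq_bigmax _ (fun j : 'I_(size P) => size (P`_j)%R) (Ordinal Hj)).
have [k ks Hk] := dominant m0s Dmon.
pose N : R := (size s)%:R.
have N0 : 0 < N by rewrite ltr0n; case: (s) m0s.
(* The monomials sum to 0. If all the others were smaller than the dominant one by the factor [N],
   the number of monomials, they could not cancel it. *)
have [m [ms mk Hm]] : exists m, [/\ m \in s, m != k & ev (fun x => `|mon k x| <= N * `|mon m x|)].
  apply: contrapT => Hno.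
  have H m : m \in s -> m != k -> ev (fun x => N * `|mon m x| < `|mon k x|).
    move=> ms mk; have [H|H] : ev (fun x => `|mon k x| <= N * `|mon m x|) \/
       ev (fun x => ~ `|mon k x| <= N * `|mon m x|).
    - by apply: (@ev_dec _ O field_class_id); have D1 := Dmon m; have D2 := Dmon k; rewrite /dset1; otac.
    - by case: Hno; exists m.
    - by apply: ev_mono H => x /negP; rewrite -ltNge.
  have {}H : ev (fun x => forall m, m \in s -> m != k -> N * `|mon m x| < `|mon k x|).
    elim: (s) H => [|m s' IH] H; first by apply: ev_all.
    have /IH H' : forall m', m' \in s' -> m' != k -> ev (fun x => N * `|mon m' x| < `|mon k x|).
      by move=> m' Hm'; apply: H; rewrite in_cons Hm' orbT.
    case: (eqVneq m k) => [Emk|mk].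
      apply: ev_mono H' => x Hx m'; rewrite in_cons => /orP[/eqP->|/Hx//].
      by rewrite Emk eqxx.
    apply: ev_mono (ev_and H' (H m (mem_head _ _) mk)) => x [Hx H1] m'.
    by rewrite in_cons => /orP[/eqP->|/Hx].
  have [x [Hx x0]] := ev_ex (ev_and H (mon0 k ks)).
  have kx0 : 0 < `|mon k x| by rewrite normr_gt0.
  have : N * `|mon k x| <= \sum_(m <- rem k s) `|mon k x|.
    have E : `|mon k x| = `|\sum_(m <- rem k s) mon m x|.
      have := Hsum x; rewrite (big_rem k) //= => /eqP; rewrite addr_eq0 => /eqP->.
      by rewrite normrN.
    rewrite {1}E; apply: (@le_trans _ _ (N * \sum_(m <- rem k s) `|mon m x|)).
      by rewrite ler_pM2l //; apply: ler_norm_sum.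
    rewrite mulr_sumr big_seq [leRHS]big_seq; apply: ler_sum => m.
    by rewrite mem_rem_uniq // inE => /andP[mk ms]; apply/ltW/Hx.
  rewrite big_const_seq count_predT iter_addr_0 size_rem // -[_ *+ _]mulr_natl.
  rewrite ler_pM2r // /N ler_nat; have : (0 < size s)%N by case: (s) m0s.
  by case: (size s) => [|q] //= _; rewrite ltnn.
exists m.2, m.1, k.2, k.1.
have c1 := cs _ ms; have c2 := cs _ ks; pose a := `|P`_m.1`_m.2|; pose b := `|P`_k.1`_k.2|.
have a0 : 0 < a by rewrite normr_gt0.
have b0 : 0 < b by rewrite normr_gt0.
have Hb : exists c c' : R, [/\ 0 < c, 0 < c' &
    ev (fun x => c * `|x ^+ k.2 * g x ^+ k.1| <= `|x ^+ m.2 * g x ^+ m.1| /\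
                 `|x ^+ m.2 * g x ^+ m.1| <= c' * `|x ^+ k.2 * g x ^+ k.1|)].
  exists (b / (N * a)), (b / a); split; rewrite ?divr_gt0 ?mulr_gt0 //.
  apply: ev_mono (ev_and Hm (Hk m ms)) => x; rewrite /mon -!mulrA.
  rewrite !(normrM (P`__`__)) -/a -/b.
  set u := `|x ^+ m.2 * _|; set v := `|x ^+ k.2 * _| => -[H1 H2]; split.
    by rewrite mulrA mulrAC ler_pdivrMr ?mulr_gt0 // [u * _]mulrC -mulrA.
  by rewrite mulrA mulrAC ler_pdivlMr // mulrC.
(* If the exponents of [g] agreed, the powers of [g] would cancel, and two different powers of [x]
   would be comparable at infinity. *)
split=> //; apply: contra_neqN mk => /eqP E2.
have [c [c' [c0 c'0 Hcc]]] := Hb.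
suff E : m.2 = k.2 by rewrite (surjective_pairing m) (surjective_pairing k) E2 E.
apply: contrapT => /eqP E1.
have {Hcc} Hcc : ev (fun x => c * x ^+ k.2 <= x ^+ m.2 /\ x ^+ m.2 <= c' * x ^+ k.2).
  apply: ev_mono (ev_and (ev_and Hcc (ev_gt 0)) g0) => x [[[]]].
  rewrite E2 !normrM => H1 H2 x0 gx; have gn : 0 < `|g x ^+ k.1| by rewrite normr_gt0 expf_neq0.
  move: H1 H2; rewrite !mulrA !ler_pM2r // !normrX gtr0_norm //.
have up (p q : nat) (K : R) : (p < q)%N -> 0 < K -> ev (fun x => x ^+ q <= K * x ^+ p) -> False.
  move=> pq K0 H; have [x [[Hx x1] xK]] := ev_ex (ev_and (ev_and H (ev_gt 1)) (ev_gt K)).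
  have x0 : 0 < x by apply: lt_trans x1.
  move: Hx; rewrite -(subnKC pq) addSnnS exprD mulrC.
  rewrite ler_pM2r ?exprn_gt0 // leNgt => /negP; apply.
  apply: lt_le_trans xK _; rewrite exprS ler_peMr //; first exact: ltW.
  by rewrite exprn_ege1 // ltW.
have /orP[lt|lt] : (k.2 < m.2)%N || (m.2 < k.2)%N by rewrite -neq_ltn eq_sym.
  by apply: (up _ _ c' lt c'0); apply: ev_mono Hcc => x [].
apply: (up _ _ c^-1 lt); rewrite ?invr_gt0 //; apply: ev_mono Hcc => x [H1 _].
by rewrite mulrC ler_pdivlMr // mulrC.
Qed.

End RegularVariation.

(** * Increments of definable functions at infinity *)

Section RegularFunctions.
Variable R : rcfType.
Implicit Types (f g : R -> R).
Notation O := (field_class R).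

(** For positive [f x], the cofactor of [f x - 1] in [f x ^+ n - 1] is a sum of powers of [f x]
    starting with 1, hence at least 1. *)
Lemma limat_root f n : (0 < n)%N -> ev (fun x => 0 < f x) ->
  limat (fun x => f x ^+ n) 1 -> limat f 1.
Proof.
move=> n0 f0 L d d0; apply: ev_mono (ev_and f0 (L d d0)) => x [fx].
apply: le_lt_trans; rewrite subrX1 normrM ler_peMr //.
case: n n0 {L} => // n _; rewrite big_ord_recl expr0 ger0_norm; last first.
  by rewrite addr_ge0 // sumr_ge0 // => i _; rewrite exprn_ge0 // ltW.
by rewrite lerDl sumr_ge0 // => i _; rewrite exprn_ge0 // ltW.
Qed.

(** The quotient [q] of two balanced monomials stays between positive constants in absolute value,
    so it has a nonzero limit and [q (x + a) / q x] tends to 1. The powers of [x] contribute factors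
    tending to 1, which leaves a nontrivial power of [g (x + a) / g x]. *)
Lemma regular_variation g a : dfun1 O g -> ev (fun x => g x != 0) ->
  limat (fun x => g (x + a) / g x) 1.
Proof.
move=> Dg g0; have [i [j [k [l [jl [c [c' [c0 c'0 Hq]]]]]]]] := balanced_monomials Dg g0.
pose q x := (x ^+ i * g x ^+ j) / (x ^+ k * g x ^+ l).
have Dq : dfun1 O q by rewrite /dfun1 /q; otac.
have Bq : ev (fun x => c <= `|q x| <= c').
  apply: ev_mono (ev_and Hq (ev_and g0 (ev_gt 0))) => x [[H1 H2] [gx x0]].
  have n0 : 0 < `|x ^+ k * g x ^+ l| by rewrite normr_gt0 mulf_neq0 // expf_neq0 // gt_eqF.
  by rewrite /q normrM normfV ler_pdivlMr // ler_pdivrMr // H1.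
have [L Lq] : exists L, limat q L.
  have [//|H|H] := lim_ex (@field_class_id R) Dq.
    have [x [Hx /andP[_]]] := ev_ex (ev_and (H c') Bq).
    by rewrite leNgt (lt_le_trans Hx) // ler_norm.
  have [x [Hx /andP[_]]] := ev_ex (ev_and (H c') Bq).
  by rewrite leNgt (lt_le_trans Hx) // -normrN ler_norm.
have L0 : L != 0.
  apply/eqP => E; rewrite E in Lq.
  have [x [/andP[H1 _]]] := ev_ex (ev_and Bq (Lq c c0)).
  by rewrite subr0 ltNge H1.
have Lr := limat_mul (limat_shift a Lq) (limat_inv L0 Lq).
rewrite divff // in Lr.
pose w x := (x + a) / x; have Lw : limat w 1 := limat_shift_ratio a.
have Lwn n : limat (fun x => w x ^+ n) 1 by have := limat_exp n Lw; rewrite expr1n.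
have Lwk := limat_mul Lr (limat_mul (Lwn k) (limat_inv (oner_neq0 R) (Lwn i))).
rewrite invr1 !mulr1 in Lwk.
pose r x := g (x + a) / g x.
have ga0 := ev_shift a g0; have xa0 := ev_shift a (ev_gt (0 : R)).
have Lrr : limat (fun x => r x ^+ j / r x ^+ l) 1.
  apply: limat_ev Lwk.
  apply: ev_mono (ev_and (ev_and g0 ga0) (ev_and (ev_gt 0) xa0)) => x [[gx gax] [x0 ax0]].
  have x0' : x != 0 by rewrite gt_eqF.
  have ax0' : x + a != 0 by rewrite gt_eqF.
  rewrite /q /w /r !expr_div_n; field.
  by rewrite !expf_neq0.
have r0 : ev (fun x => 0 < r x).
  have [H|H] : ev (fun x => 0 < g x) \/ ev (fun x => ~ 0 < g x).
  - by apply: (ev_dec (@field_class_id R)); rewrite /dset1; dtac.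
  - by apply: ev_mono (ev_and H (ev_shift a H)) => x [H1 H2]; rewrite divr_gt0.
  apply: ev_mono (ev_and (ev_and H g0) (ev_and (ev_shift a H) ga0)) => x [[H1 H2] [H3 H4]].
  rewrite /r -mulrNN -invrN divr_gt0 // oppr_gt0 lt_neqAle ?H2 ?H4 leNgt; exact/negP.
have /orP[lt|lt] : (l < j)%N || (j < l)%N by rewrite -neq_ltn eq_sym.
  apply: (@limat_root _ (j - l)); rewrite ?subn_gt0 //; apply: limat_ev Lrr.
  apply: ev_mono r0 => x /gt_eqF/negbT rx.
  by rewrite -{1}(subnK (ltnW lt)) exprD mulfK // expf_neq0.
apply: (@limat_root _ (l - j)); rewrite ?subn_gt0 //.
rewrite -(invr1 R); apply: limat_ev (limat_inv (oner_neq0 R) Lrr).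
apply: ev_mono r0 => x /gt_eqF/negbT rx.
by rewrite invf_div -{1}(subnK (ltnW lt)) exprD mulfK // expf_neq0.
Qed.

(** The set of such [t] is a definable subgroup containing 1: the increment by [s - t] at [x] is a
    difference of two increments at [x - t], and moving the denominator from [x - t] to [x] costs a
    factor tending to 1. *)
Lemma increment_ratio f t : dfun1 O f -> ev (fun x => f (x + 1) - f x != 0) ->
  limat (fun x => (f (x + t) - f x) / (f (x + 1) - f x)) t.
Proof.
move=> Df f0; move: t; apply: (subgroup_total (@field_class_id R)).
- by rewrite /dset1 /limat /ev; otac.
- by apply: limat_ev (limat_cst 1); apply: ev_mono f0 => x H; rewrite divff.
move=> s t Ls Lt.
have Dd : dfun1 O (fun x => f (x + 1) - f x) by rewrite /dfun1; dtac.
have Lr := regular_variation (- t) Dd f0.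
have L := limat_mul (limat_add (limat_shift (- t) Ls) (limat_opp (limat_shift (- t) Lt))) Lr.
rewrite mulr1 in L; apply: limat_ev L.
apply: ev_mono (ev_and f0 (ev_shift (- t) f0)) => x [H1 H2].
have -> : x + (s - t) = x - t + s by ring.
by rewrite subrK; field; rewrite H1 H2.
Qed.

(** Regular variation replaces continuity: one unit after a point close to the last one with
    [d >= q * v], the value is below [q * v], but it has dropped by a factor close to 1 only, so it
    is still above [p * v]. *)
Lemma last_crossing (d : R -> R) (X p q : R) : dfun1 O d -> ev (fun x => 0 < d x) -> limat d 0 ->
  limat (fun x => d (x + 1) / d x) 1 -> 0 < p -> p < q ->
  exists2 v0, 0 < v0 & forall v, 0 < v -> v < v0 -> exists2 x, X < x & p * v < d x < q * v.
Proof.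
move=> Dd d0 Ld Lr p0 pq; have q0 : 0 < q by apply: lt_trans pq.
have pq1 : p / q < 1 by rewrite ltr_pdivrMr // mul1r.
have [X1 HX1] : ev (fun x => [/\ 0 < d x, p / q < d (x + 1) / d x & X < x]).
  by apply: ev_mono (ev_and d0 (ev_and (limat_gt Lr pq1) (ev_gt X))) => x [? [? ?]].
have X1X : X1 < X1 + 1 by rewrite ltrDl.
have [dX1 _ _] := HX1 _ X1X.
exists (d (X1 + 1) / q); first by rewrite divr_gt0.
move=> v v0; rewrite ltr_pdivlMr // => Hv.
have [||| l [l1 l2]] := @lub_ex _ O (@field_class_id R) (fun x => X1 < x /\ v * q <= d x).
- by rewrite /dset1; otac.
- by exists (X1 + 1); split=> //; apply: ltW.
- have [Y HY] := Ld _ (mulr_gt0 v0 q0); exists Y => a [aX Ha].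
  rewrite leNgt; apply/negP => /HY; rewrite subr0 => /(le_lt_trans (ler_norm _)).
  by rewrite ltNge Ha.
have [|z [zX Hz] lz] := l2 (l - 1); first by rewrite gtrBl.
have [dz Hr Xz] := HX1 _ zX.
exists (z + 1); first by apply: lt_trans Xz _; rewrite ltrDl.
have lz1 : l < z + 1 by rewrite -ltrBlDr.
have zX1 : X1 < z + 1 by apply: lt_trans zX _; rewrite ltrDl.
apply/andP; split; last first.
  rewrite ltNge mulrC; apply/negP => H; have := l1 (z + 1) (conj zX1 H).
  by rewrite leNgt lz1.
move: Hr; rewrite ltr_pdivlMr //; apply: le_lt_trans.
have -> : p * v = p / q * (v * q) by field; rewrite gt_eqF.
by rewrite ler_pM2l // divr_gt0.
Qed.

Lemma ratio_hit (d : R -> R) (X p q : R) : dfun1 O d -> ev (fun x => 0 < d x) ->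
  limat d 0 \/ limoo d ->
  limat (fun x => d (x + 1) / d x) 1 -> 0 < p -> p < q ->
  exists x y, [/\ X < x, X < y, 0 < d x, 0 < d y & p * d y < d x < q * d y].
Proof.
have base (h : R -> R) : dfun1 O h -> ev (fun x => 0 < h x) -> limat h 0 ->
    limat (fun x => h (x + 1) / h x) 1 -> 0 < p -> p < q ->
    exists x y, [/\ X < x, X < y, 0 < h x, 0 < h y & p * h y < h x < q * h y].
  move=> Dh h0 Lh Lr p0 pq.
  (* Both values are measured in units of a small [v]: [h y] is placed between [v] and
     [(p + q) / 2 / p * v], and [h x] between [(p + q) / 2 * v] and [q * v]. *)
  have c0 : 1 < (p + q) / 2 / p by rewrite ltr_pdivlMr //; lra.
  have c1 : 0 < (p + q) / 2 by lra.
  have c2 : (p + q) / 2 < q by lra.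
  have [v1 v10 H1] := last_crossing X Dh h0 Lh Lr ltr01 c0.
  have [v2 v20 H2] := last_crossing X Dh h0 Lh Lr c1 c2.
  pose v := Num.min v1 v2 / 2.
  have mv : 0 < Num.min v1 v2 by rewrite lt_min v10.
  have v0 : 0 < v by rewrite /v; lra.
  have vm : v < Num.min v1 v2 by rewrite /v; lra.
  have /andP[vv1 vv2] : (v < v1) && (v < v2) by rewrite -lt_min.
  have [y Xy /andP[y1 y2]] := H1 v v0 vv1.
  have [x Xx /andP[x1 x2]] := H2 v v0 vv2.
  have hy : 0 < h y by lra.
  have hx : 0 < h x by apply: lt_trans x1; rewrite mulr_gt0.
  exists x, y; split=> //; apply/andP; split.
    apply: lt_trans x1; move: y2; rewrite -(ltr_pM2l p0); congr (_ < _).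
    by field; rewrite gt_eqF.
  by apply: lt_trans x2 _; rewrite ltr_pM2l; lra.
move=> Dd d0 [Ld|Ld] Lr p0 pq; first exact: base.
(* If [d] tends to infinity, the first case is applied to its inverse, which exchanges [x] and
   [y]. *)
have [||||||x [y [Xx Xy hx hy /andP[]]]] := base (fun x => (d x)^-1).
- by rewrite /dfun1; otac.
- by apply: ev_mono d0 => x; rewrite invr_gt0.
- move=> e e0; apply: ev_mono (ev_and d0 (Ld e^-1)) => x [H1 H2].
  by rewrite subr0 gtr0_norm ?invr_gt0 // -(invrK e) ltf_pV2 // posrE invr_gt0.
- have := limat_inv (oner_neq0 R) Lr; rewrite invr1; apply: limat_ev.
  by apply: ev_all => x; rewrite invf_div invrK mulrC.
- by [].
- by [].
rewrite !invr_gt0 in hx hy.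
rewrite !(mulrC _ (d y)^-1) ltr_pdivrMl // ltr_pdivlMl // => H1 H2.
exists y, x; split=> //; apply/andP; split.
  by move: H1; rewrite ltr_pdivlMr.
by move: H2; rewrite ltr_pdivrMr.
Qed.

End RegularFunctions.

(** * Defining the multiplication *)

Section Multiplication.
Variables (R : rcfType) (D : dclass R).
Hypothesis DO : forall P, D P -> field_class R P.
Implicit Types (f g : R -> R).

Definition has_mul := dfun D (fun e => e 0%N * e 1%N).

Lemma has_mul_pos : D (fun e => 0 < e 0%N /\ 0 < e 1%N /\ e 0%N * e 1%N = e 2%N) -> has_mul.
Proof.
move=> DP; pose P a b c : Prop := 0 < a /\ 0 < b /\ a * b = c :> R.
have DP' (t u v : (nat -> R) -> R) : dfun D t -> dfun D u -> dfun D v ->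
    D (fun e => P (t e) (u e) (v e)).
  move=> Dt Du Dv.
  have := @dset_app _ D _ (fun e i => match i with 0 => t e | 1 => u e | _ => v e end) DP.
  by apply=> -[|[|i]].
rewrite /has_mul /dfun /=.
apply: (@dset_ext _ _ (fun e => ((e 1%N = 0 \/ e 2%N = 0) /\ e 0%N = 0) \/
  (P (e 1%N) (e 2%N) (e 0%N) \/ (P (- e 1%N) (- e 2%N) (e 0%N) \/
  (P (- e 1%N) (e 2%N) (- e 0%N) \/ P (e 1%N) (- e 2%N) (- e 0%N)))))); last first.
  by repeat (apply: dset_or); try apply: DP'; dtac.
move=> e; rewrite /P; set a := e 1%N; set b := e 2%N; set c := e 0%N; split.
  move=> [[[->|->] ->]|[[_ [_ <-]]|[[_ [_ <-]]|[[_ [_]]|[_ [_]]]]]].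
  - by rewrite mul0r.
  - by rewrite mulr0.
  - by [].
  - by rewrite mulrNN.
  - by rewrite mulNr => /oppr_inj.
  - by rewrite mulrN => /oppr_inj.
move=> ->; case: (ltgtP a 0) => a0; case: (ltgtP b 0) => b0.
- by right; right; left; rewrite mulrNN !oppr_gt0.
- by right; right; right; left; rewrite mulNr !oppr_gt0.
- by left; rewrite b0 mulr0; split=> //; right.
- by right; right; right; right; rewrite mulrN !oppr_gt0.
- by right; left.
- by left; rewrite b0 mulr0; split=> //; right.
- by left; rewrite a0 mul0r; split=> //; left.
- by left; rewrite a0 mul0r; split=> //; left.
- by left; rewrite a0 mul0r; split=> //; left.
Qed.

(** The unknown factor cancels: [c] is the product of [a] and [b] when the scaled products of [a, b]
    and of [c, 1] agree. *)
Lemma has_mul_scaled (mu : R) : mu != 0 ->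
  D (fun e => 0 < e 0%N /\ 0 < e 1%N /\ mu * (e 0%N * e 1%N) = e 2%N) -> has_mul.
Proof.
move=> mu0 DK; apply: has_mul_pos.
pose K a b c : Prop := 0 < a /\ 0 < b /\ mu * (a * b) = c :> R.
have DK' (t u v : (nat -> R) -> R) : dfun D t -> dfun D u -> dfun D v ->
    D (fun e => K (t e) (u e) (v e)).
  move=> Dt Du Dv.
  have := @dset_app _ D _ (fun e i => match i with 0 => t e | 1 => u e | _ => v e end) DK.
  by apply=> -[|[|i]].
apply: (@dset_ext _ _ (fun e => exists k, K (e 0%N) (e 1%N) k /\ K (e 2%N) 1 k)); last first.
  by apply: dset_ex; apply: dset_and; apply: DK'; dtac.
move=> e; rewrite /K; split.
  move=> [k [[a0 [b0 <-]] [c0 [_]]]]; rewrite mulr1 => /(mulfI mu0) ->.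
  by [].
move=> [a0 [b0 Eab]]; exists (mu * e 2%N); rewrite -Eab mulr1.
by do !split=> //; rewrite ?mulr_gt0.
Qed.

Lemma has_mul_strip (d : R) : 0 < d ->
  D (fun e => (0 < e 0%N /\ e 0%N < d) /\ 0 < e 1%N /\ e 0%N * e 1%N = e 2%N) -> has_mul.
Proof.
move=> d0 DB; apply: has_mul_pos.
pose B a b c : Prop := (0 < a /\ a < d) /\ 0 < b /\ a * b = c :> R.
have DB' (t u v : (nat -> R) -> R) : dfun D t -> dfun D u -> dfun D v ->
    D (fun e => B (t e) (u e) (v e)).
  move=> Dt Du Dv.
  have := @dset_app _ D _ (fun e i => match i with 0 => t e | 1 => u e | _ => v e end) DB.
  by apply=> -[|[|i]].
(* [k < d] puts [k] itself into the strip, and [k < d ^+ 2] puts [k / b] there for every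
   [b >= d]. *)
pose k := Num.min d (d ^+ 2) / 2.
have mk : 0 < Num.min d (d ^+ 2) by rewrite lt_min d0 exprn_gt0.
have k0 : 0 < k by rewrite /k; lra.
have kd : k < d by have : Num.min d (d ^+ 2) <= d; [rewrite ge_min lexx|rewrite /k; lra].
have kd2 : k < d ^+ 2.
  by have : Num.min d (d ^+ 2) <= d ^+ 2; [rewrite ge_min lexx orbT|rewrite /k; lra].
clearbody k.
(* For [b >= d], use the inverse [h = k / b], which lies in the strip. *)
apply: (@dset_ext _ _ (fun e => (e 1%N < d /\ B (e 1%N) (e 0%N) (e 2%N)) \/
   (d <= e 1%N /\ exists h, B h (e 1%N) k /\ exists z, B k (e 0%N) z /\ B h (e 2%N) z)));
  last first.
  by repeat first [apply: DB' | dstep].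
move=> e; rewrite /B; set a := e 0%N; set b := e 1%N; set c := e 2%N; split.
  move=> [[bd [[b0 _] [a0 <-]]]|[bd [h [[[h0 hd] [b0 Ek]] [z [[_ [a0 Ez]] [_ [c0 Ec]]]]]]]].
    by rewrite mulrC.
  have hn : h != 0 by rewrite gt_eqF.
  do 2 split=> //; apply: (mulfI hn).
  by rewrite Ec -Ez -Ek; ring.
move=> [a0 [b0 Eab]]; have [bd|db] := ltrP b d.
  by left; rewrite mulrC.
right; split=> //; have b0' : b != 0 by rewrite gt_eqF.
have hd : k / b < d.
  rewrite ltr_pdivrMr //; apply: lt_le_trans kd2 _.
  by rewrite expr2 ler_pM2l.
have h0 : 0 < k / b by rewrite divr_gt0.
have c0 : 0 < c by rewrite -Eab mulr_gt0.
exists (k / b); rewrite divfK //; split=> //.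
exists (k * a); split=> //; do 2 split=> //.
by rewrite -Eab; field.
Qed.

Lemma has_mul_increments f : dfun1 D f -> ev (fun x => 0 < f (x + 1) - f x) ->
  limat (fun x => f (x + 1) - f x) 0 \/ limoo (fun x => f (x + 1) - f x) -> has_mul.
Proof.
move=> Df f0 Lf; have Of : dfun1 (field_class R) f by apply: DO.
pose d x := f (x + 1) - f x.
have Od : dfun1 (field_class R) d by rewrite /dfun1 /d; dtac.
have d1 : ev (fun x => d x != 0) by apply: ev_mono f0 => x /gt_eqF/negbT.
have Lr t := increment_ratio t Of d1.
have Ld := regular_variation 1 Od d1.
(* Since [f (x + t) - f x] is asymptotically [t * d x], this says roughly that
   [t / t' < d y / d x < s / s'] for arbitrarily far [x] and [y]. Such ratios enter every interval
   of positive numbers, so up to equality [LT] means [t * s' < t' * s]. *)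
pose LT t s t' s' : Prop := forall X, exists x y, X < x /\ X < y /\
   f (x + t) - f x < f (y + t') - f y /\ f (y + s') - f y < f (x + s) - f x.
have bnd t h : 0 < h -> ev (fun x => 0 < d x /\
    ((t - h) * d x < f (x + t) - f x /\ f (x + t) - f x < (t + h) * d x)).
  move=> h0; apply: ev_mono (ev_and f0 (Lr t h h0)) => x.
  rewrite -!/(d x) ltr_norml => -[dx /andP[H1 H2]].
  by split=> //; split; [rewrite -ltr_pdivlMr //|rewrite -ltr_pdivrMr //]; lra.
have eps (u v : R) S : 0 < S -> u < v -> exists2 h, 0 < h & h * S < v - u.
  move=> S0 uv; exists ((v - u) / S / 2); first by rewrite !divr_gt0 // subr_gt0.
  have -> : (v - u) / S / 2 * S = (v - u) / 2 by field; rewrite gt_eqF.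
  lra.
have L1 t s t' s' : 0 < t -> 0 < s -> 0 < t' -> 0 < s' -> t * s' < t' * s -> LT t s t' s'.
  move=> t0 s0 t'0 s'0 H X.
  have S0 : 0 < t + s + t' + s' by lra.
  have [h h0 Hh] := eps _ _ _ S0 H.
  have hs : h < s by nra.
  have ht' : h < t' by nra.
  have [Y HY] := ev_and (ev_and (bnd t h h0) (bnd s h h0)) (ev_and (bnd t' h h0) (bnd s' h h0)).
  pose p := (s' + h) / (s - h); pose q := (t' - h) / (t + h).
  have sh : 0 < s - h by lra.
  have th : 0 < t + h by lra.
  have p0 : 0 < p by rewrite divr_gt0 //; lra.
  have pq : p < q by rewrite /p /q ltr_pdivrMr // mulrAC ltr_pdivlMr //; nra.
  have [x [y [Xx Xy dx dy /andP[H1 H2]]]] := ratio_hit (Num.max X Y) Od f0 Lf Ld p0 pq.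
  move: Xx Xy; rewrite !gt_max => /andP[Xx /HY[[[_ [_ xt]] [_ [xs _]]] _]].
  move=> /andP[Xy /HY[_ [[_ [yt _]] [_ [_ ys]]]]].
  exists x, y; do 3 split=> //.
    apply: lt_trans xt _; apply: lt_trans yt; move: H2.
    by rewrite /q mulrAC ltr_pdivlMr // mulrC.
  apply: lt_trans ys _; apply: lt_trans xs; move: H1.
  by rewrite /p mulrAC ltr_pdivrMr // [d x * _]mulrC.
have L2 t s t' s' : 0 < t -> 0 < s -> 0 < t' -> 0 < s' -> LT t s t' s' -> t * s' <= t' * s.
  move=> t0 s0 t'0 s'0 HL; rewrite leNgt; apply/negP => H.
  have S0 : 0 < t + s + t' + s' by lra.
  have [h h0 Hh] := eps _ _ _ S0 H.
  have hs : h < s' by nra.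
  have ht' : h < t by nra.
  have [Y HY] := ev_and (ev_and (bnd t h h0) (bnd s h h0)) (ev_and (bnd t' h h0) (bnd s' h h0)).
  have [x [y [/HY[[[dx [xt _]] [_ [_ xs]]] _] [/HY[_ [[dy [_ yt]] [_ [ys _]]]] [H1 H2]]]]] := HL Y.
  have E1 : (t - h) * d x < (t' + h) * d y by apply: lt_trans xt _; apply: lt_trans H1 _.
  have E2 : (s' - h) * d y < (s + h) * d x by apply: lt_trans ys _; apply: lt_trans H2 _.
  have : (t - h) * d x * ((s' - h) * d y) < (t' + h) * d y * ((s + h) * d x).
    by apply: ltr_pM => //; rewrite mulr_ge0 //; lra.
  have -> : (t - h) * d x * ((s' - h) * d y) = (t - h) * (s' - h) * (d x * d y) by ring.
  have -> : (t' + h) * d y * ((s + h) * d x) = (t' + h) * (s + h) * (d x * d y) by ring.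
  rewrite ltr_pM2r ?mulr_gt0 //; nra.
(* The product is defined as a cut: [LT t a' b' 1], with [a'] and [b'] the two factors, holds for
   [t] below it and fails for [t] above it. *)
apply: has_mul_pos.
apply: (@dset_ext _ _ (fun e => (0 < e 0%N /\ (0 < e 1%N /\ 0 < e 2%N)) /\ forall t, 0 < t ->
   (t < e 2%N -> LT t (e 1%N) (e 0%N) 1) /\ (e 2%N < t -> ~ LT t (e 1%N) (e 0%N) 1))); last first.
  by rewrite /LT; dtac.
move=> e; set a := e 0%N; set b := e 1%N; set c := e 2%N; split.
  move=> [[a0 [b0 c0]] H]; do 2 split=> //; have ab0 : 0 < a * b by rewrite mulr_gt0.
  have [ltc|ltc|//] := ltgtP (a * b) c.
    have t0 : 0 < (a * b + c) / 2 by lra.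
    have [H1 _] := H _ t0; have := L2 _ _ _ _ t0 b0 a0 ltr01 (H1 ltac:(lra)); lra.
  have t0 : 0 < (a * b + c) / 2 by lra.
  have [_ H1] := H _ t0; case: (H1 ltac:(lra)); apply: L1 => //; lra.
move=> [a0 [b0 Eab]]; have c0 : 0 < c by rewrite -Eab mulr_gt0.
split=> // t t0; split=> H; first by apply: L1 => //; rewrite mulr1 Eab.
by move=> /(L2 _ _ _ _ t0 b0 a0 ltr01); rewrite mulr1 Eab leNgt H.
Qed.

(** The elements by which scaling is definable. They form a subfield, which supplies the
    coefficients of all definable linear forms below. *)
Definition dscalar (l : R) := dfun1 D (fun x => l * x).

Lemma dscalarD l m : dscalar l -> dscalar m -> dscalar (l + m).
Proof.
move=> Dl Dm; apply: dfun_ext (dfun_add Dl Dm) => e; by rewrite mulrDl.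
Qed.

Lemma dscalarN l : dscalar l -> dscalar (- l).
Proof. by move=> Dl; apply: dfun_ext (dfun_opp Dl) => e; rewrite mulNr. Qed.

Lemma dscalarM l m : dscalar l -> dscalar m -> dscalar (l * m).
Proof.
by move=> Dl Dm; apply: dfun_ext (dfun1_app Dl Dm) => e; rewrite mulrA.
Qed.

Lemma dscalar0 : dscalar 0.
Proof. by apply: dfun_ext (dfun_cst D 0) => e; rewrite mul0r. Qed.

Lemma dscalar1 : dscalar 1.
Proof. by apply: dfun_ext (dfun_var D 0) => e; rewrite mul1r. Qed.

Lemma dscalarV l : dscalar l -> dscalar l^-1.
Proof.
case: (eqVneq l 0) => [->|l0 Dl]; first by rewrite invr0.
have D1 : dfun D (fun e => l * e 0%N) by apply: (dfun1_app Dl); dtac.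
apply: dset_ext (dset_eq D1 (dfun_var D 1)) => e /=.
by split=> [<-|->]; [rewrite mulKf|rewrite mulVKf].
Qed.

Theorem eventually_affine f : ~ has_mul -> dfun1 D f ->
  exists l c, dscalar l /\ ev (fun x => f x = l * x + c).
Proof.
move=> nomul Df; pose d x := f (x + 1) - f x.
have Dd : dfun1 D d by rewrite /dfun1 /d; dtac.
have [[l Ll]|Ld|Ld] := lim_ex DO Dd; last 2 first.
- case: nomul; apply: (@has_mul_increments f) => //; by right.
- case: nomul; apply: (@has_mul_increments (fun x => - f x)); first by rewrite /dfun1; dtac.
    by apply: ev_mono (Ld 0) => x; rewrite /d; lra.
  by right=> M; apply: ev_mono (Ld M) => x; rewrite /d; lra.
have Lt t : limat (fun x => f (x + t) - f x) (l * t).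
  move: t; apply: (subgroup_total (@field_class_id R)).
  - have Of : dfun1 (field_class R) f by apply: DO.
    by rewrite /dset1 /limat /ev; otac.
  - by rewrite mulr1.
  move=> s t Ls Lt; rewrite mulrBr.
  apply: limat_ev (limat_add (limat_shift (- t) Ls) (limat_opp (limat_shift (- t) Lt))).
  apply: ev_all => x; rewrite subrK; have -> : x + (s - t) = x - t + s by ring.
  by ring.
(* Scaling by [l] is defined through the limit of the increments by [t]. *)
have Dl : dscalar l.
  apply: (@dset_ext _ _ (fun e => limat (fun x => f (x + e 1%N) - f x) (e 0%N))); last first.
    by rewrite /limat /ev; dtac.
  by move=> e; split=> [/limat_uniq/(_ (Lt _))|/= ->].
(* Without its linear part, [f] has increments tending to 0; unless these vanish eventually, [g] or
   its opposite would define the multiplication. *)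
exists l; pose g x := f x - l * x.
have Dg : dfun1 D g by rewrite /dfun1 /g; have := dfun1_app Dl (dfun_var D 0) => D1; dtac.
have Eg x : g (x + 1) - g x = d x - l by rewrite /g /d; ring.
have Lg : limat (fun x => g (x + 1) - g x) 0.
  rewrite -(subrr l); apply: limat_ev (limat_add Ll (limat_cst (- l))).
  by apply: ev_all => x; rewrite Eg.
have Dg1 : dfun1 D (fun x => g (x + 1) - g x) by rewrite /dfun1; dtac.
have D1 : dset1 D (fun x => 0 < g (x + 1) - g x) by rewrite /dset1; dtac.
have D2 : dset1 D (fun x => g (x + 1) - g x < 0) by rewrite /dset1; dtac.
have [H1|H1] := ev_dec DO D1.
  by case: nomul; apply: (@has_mul_increments g) => //; left.
have [H2|H2] := ev_dec DO D2.
  case: nomul; apply: (@has_mul_increments (fun x => - g x)); first by rewrite /dfun1; dtac.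
    by apply: ev_mono H2 => x; lra.
  left; rewrite -oppr0; apply: limat_ev (limat_opp Lg); apply: ev_all => x; lra.
have [X HX] : ev (fun x => g (x + 1) = g x).
  apply: ev_mono (ev_and H1 H2) => x [/negP H3 /negP H4]; move: H3 H4; rewrite -!leNgt; lra.
pose H t := forall x, X < x -> X < x + t -> g (x + t) = g x.
have {}HX t : H t.
  move: t; apply: (subgroup_total DO); first by rewrite /dset1 /H; dtac.
    by move=> x /HX.
  (* At least one of the intermediate points [x - t] and [x + s] lies beyond [X], and the comparison
     passes through it. *)
  move=> s t Hs Ht x Xx Xst; have [zX|zX] := ltrP X (x - t).
    have -> : x + (s - t) = x - t + s by ring.
    rewrite Hs // -?(Ht (x - t)) ?subrK //.
    by have -> : x - t + s = x + (s - t) by ring.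
  have Xs : X < x + s by lra.
  rewrite -(Hs x Xx Xs); have -> : x + s = x + (s - t) + t by ring.
  by rewrite Ht //; lra.
exists (g (X + 1)); split=> //; exists X => x Xx.
have := HX (x - (X + 1)) (X + 1); rewrite addrCA subrr addr0 => <- //; last by rewrite ltrDl.
by rewrite /g; ring.
Qed.

End Multiplication.

(** * Affine functions on intervals *)

Section FiniteQuantifiers.
Variables (R : rcfType) (D : dclass R).

Lemma dset_all_lt n (P : nat -> (nat -> R) -> Prop) :
  (forall i, D (P i)) -> D (fun e => forall i, (i < n)%N -> P i e).
Proof.
move=> DP; elim: n => [|n IHn]; first by apply: dset_ext (dset_true D) => e.
apply: dset_ext (dset_and IHn (DP n)) => e; split=> [[H1 H2] i|H].
  by rewrite ltnS leq_eqVlt => /orP[/eqP->//|/H1].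
by split=> [i Hi|]; apply: H => //; apply: ltnW.
Qed.

(** The quantifier formally ranges over all coordinates from [m] on, but beyond the support of [P]
    they may be kept fixed, so finitely many quantifiers are enough. *)
Lemma dset_ex_env m P : D P ->
  D (fun e => exists e' : nat -> R, (forall i, (i < m)%N -> e' i = e i) /\ P e').
Proof.
move=> DP; have [n Hn] := d_fin DP.
have H j : D (fun e => exists e' : nat -> R,
    (forall i, (i < m)%N || (m + j <= i)%N -> e' i = e i) /\ P e').
  elim: j => [|j IHj].
    apply: dset_ext DP => e; split=> [Pe|[e' [He Pe]]]; first by exists e.
    by have <- : e' = e by apply: funext => i; apply: He; rewrite addn0; case: ltnP.
  apply: dset_ext (dset_exAt (m + j) IHj) => e; split.
    move=> [a [e' [He Pe]]]; exists e'; split=> // i Hi; rewrite He.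
      by rewrite /upd; case: eqP => // E; move: Hi; rewrite E addnS ltnn orbF ltnNge leq_addr.
    by case/orP: Hi => [->//|]; rewrite addnS => /ltnW ->; rewrite orbT.
  move=> [e' [He Pe]]; exists (e' (m + j)%N), e'; split=> // i Hi.
  rewrite /upd; case: eqP => [->//|/eqP ij]; apply: He.
  case/orP: Hi => [->//|Hi]; rewrite addnS; apply/orP; right.
  by rewrite ltn_neqAle Hi eq_sym ij.
apply: dset_ext (H n) => e; split=> -[e' [He Pe]].
  by exists e'; split=> // i Hi; apply: He; rewrite Hi.
exists (fun i => if (i < m + n)%N then e' i else e i); split.
  by move=> i; case: (ltnP i (m + n)) => // Hi; rewrite orbF => /He.
by apply: Hn Pe => i Hi; rewrite ltn_addl.
Qed.

End FiniteQuantifiers.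

Section Intervals.
Variables (R : rcfType).
Implicit Types (g : R -> R) (A : R -> Prop).
Notation O := (field_class R).

Lemma interval_connected A (p q : R) : dset1 O A ->
  (forall t, p < t < q -> exists2 d, 0 < d & forall x y, t - d < x < t + d ->
     t - d < y < t + d -> A x -> A y) ->
  forall x y, p < x < q -> p < y < q -> A x -> A y.
Proof.
have main B x y : dset1 O B -> (forall t, p < t < q -> exists2 d, 0 < d &
     forall x y, t - d < x < t + d -> t - d < y < t + d -> B x -> B y) ->
     p < x -> y < q -> x < y -> B x -> B y.
  move=> DB loc px yq xy Bx; apply: contrapT => By.
  pose S z := forall w, x <= w -> w <= z -> B w.
  have DS : dset1 O S by rewrite /dset1 /S; dtac.
  have Sx : S x by move=> w w1 w2; have -> : w = x by lra.
  have [||s [s1 s2]] := lub_ex (@field_class_id R) DS; first by exists x.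
    by exists y => z Sz; rewrite leNgt; apply/negP => yz; apply: By; apply: Sz; apply: ltW.
  have xs := s1 x Sx.
  have sy : s <= y.
    by rewrite leNgt; apply/negP => /s2[a Sa ya]; apply: By; apply: Sa; apply: ltW.
  have [|d d0 Hd] := loc s; first by apply/andP; split; lra.
  have [|a Sa Ha] := s2 (s - d); first lra.
  have as1 := s1 a Sa.
  have [b [xb bs Bb]] : exists b, [/\ s - d < b, b <= s & B b].
    have [xa|ax] := lerP x a; first by exists a; split=> //; apply: Sa.
    by exists x; split=> //; lra.
  have /s1 : S (s + d / 2); last lra.
  move=> w xw ws; have [wa|aw] := lerP w a; first exact: Sa.
  by apply: Hd Bb; apply/andP; split; lra.
move=> DA loc x y /andP[px xq] /andP[py yq] Ax.
have [xy|yx|<-//] := ltgtP x y; first exact: main DA loc px yq xy Ax.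
apply: contrapT => Ay; apply: (main (fun z => ~ A z) y x _ _ py xq yx) => //.
  by rewrite /dset1; dtac.
move=> t /loc[d d0 Hd]; exists d => // u v Hu Hv nAu Av; exact: nAu (Hd v u Hv Hu Av).
Qed.

(** Affineness is expressed by equal increments, which the reduct can state, whereas it cannot
    multiply by a variable slope. *)
Definition affine_on g (p q : R) := forall x y h, p < x -> x < q -> p < y -> y < q ->
  p < x + h -> x + h < q -> p < y + h -> y + h < q -> g (x + h) - g x = g (y + h) - g y.

Definition affine_at g (t : R) := exists d, 0 < d /\ affine_on g (t - d) (t + d).

Lemma affine_on_sub g p q p' q' : p <= p' -> q' <= q -> affine_on g p q -> affine_on g p' q'.
Proof.
by move=> pp qq H x y h *; apply: H;
  first [apply: le_lt_trans pp _ | apply: lt_le_trans qq].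
Qed.

(** Dyadic multiples of [L] need not be dense. Instead, [f] vanishes at all [L / 2 ^+ k.+1], and one
    of these points is not a break point of the zero set, so [f] vanishes near it and, by
    additivity, near 0. Hence [f] is locally constant. *)
Lemma local_additive (f : R -> R) L : dfun1 O f -> 0 < L ->
  (forall h k, - L < h < L -> - L < k < L -> - L < h + k < L -> f (h + k) = f h + f k) ->
  f (L / 2) = 0 -> forall h, - L < h < L -> f h = 0.
Proof.
move=> Df L0 fD fL.
have f0 : f 0 = 0.
  have := fD 0 0; rewrite addr0 => H.
  have /H : - L < 0 < L by apply/andP; split; lra.
  have Hz : - L < 0 < L by apply/andP; split; lra.
  by move=> /(_ Hz Hz); lra.
pose A x := f x = 0; have DA : dset1 O A by rewrite /dset1 /A; dtac.
have [s Hs] := omin1 (@field_class_id R) DA.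
have pow k : 0 < L / 2 ^+ k.+1 < L.
  have k0 : 0 < 2 ^+ k.+1 :> R by rewrite exprn_gt0.
  rewrite divr_gt0 //= ltr_pdivrMr // ltr_pMr // exprn_egt1 //; lra.
have fpow k : f (L / 2 ^+ k.+1) = 0.
  elim: k => [|k IHk]; first by rewrite expr1.
  have E : L / 2 ^+ k.+1 = L / 2 ^+ k.+2 + L / 2 ^+ k.+2.
    by rewrite [2 ^+ k.+2]exprSr invfM [X in X + X]mulrA; lra.
  have /andP[p1 p2] := pow k.+1; have /andP[p3 p4] := pow k.
  have := fD (L / 2 ^+ k.+2) (L / 2 ^+ k.+2); rewrite -E IHk.
  set z := L / _ in p1 p2 *; set z' := L / _ in p3 p4 *.
  have Hz : - L < z < L by apply/andP; split; lra.
  have Hz' : - L < z' < L by apply/andP; split; lra.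
  by move=> /(_ Hz Hz Hz'); lra.
have [k ks] : exists k : nat, L / 2 ^+ k.+1 \notin s.
  apply: contrapT => H.
  have : (size [seq L / 2 ^+ i.+1 | i <- iota 0 (size s).+1] <= size s)%N.
    apply: uniq_leq_size.
      rewrite map_inj_uniq ?iota_uniq // => i j.
      have n1 : (2 : R) != 1 by rewrite gt_eqF //; lra.
      have n0 : (0 : R) < 2 by lra.
      by move=> /(mulfI (lt0r_neq0 L0)) /invr_inj /(ieexprIn n0 n1) [].
    move=> x /mapP[i _ ->]; apply: contrapT => /negP Hi; apply: H; by exists i.
  by rewrite size_map size_iota ltnn.
have [d' d'0 Hd'] := point_interval_free ks.
set x0 := L / _ in ks Hd'; have /andP[x00 x0L] := pow k; rewrite -/x0 in x00 x0L.
pose d := Num.min d' (Num.min x0 (L - x0)).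
have d0 : 0 < d by rewrite !lt_min d'0 x00 subr_gt0.
have /and3P[dd' dx0 dLx] : [&& d <= d', d <= x0 & d <= L - x0] by rewrite -!le_min.
clearbody d.
have fsmall x : - d < x < d -> f x = 0.
  move=> /andP[x1 x2].
  have E : f (x0 + x) = 0.
    by apply: (Hs _ _ Hd' x0); [apply/andP; split; lra|apply/andP; split; lra|exact: fpow].
  have := fD x0 x; rewrite E (fpow k : f x0 = 0).
  have H1 : - L < x0 < L by apply/andP; split; lra.
  have H2 : - L < x < L by apply/andP; split; lra.
  have H3 : - L < x0 + x < L by apply/andP; split; lra.
  by move=> /(_ H1 H2 H3); lra.
move=> h Hh; apply: (@interval_connected A (- L) L DA _ 0 h) => //; last by apply/andP; split; lra.
move=> t /andP[t1 t2]; pose d1 := Num.min d (Num.min (L - t) (t + L)).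
have d10 : 0 < d1 by rewrite !lt_min d0; apply/andP; split; lra.
have /and3P[q1 q2 q3] : [&& d1 <= d, d1 <= L - t & d1 <= t + L] by rewrite -!le_min.
have E x : t - d1 < x < t + d1 -> f x = f t.
  move=> /andP[x1 x2]; have -> : x = t + (x - t) by ring.
  rewrite fD; [|apply/andP; split; lra..].
  by rewrite (fsmall (x - t)) ?addr0 //; apply/andP; split; lra.
by exists d1 => // x y /E Ex /E Ey; rewrite /A Ex Ey.
Qed.

Lemma affine_on_linear g p q : dfun1 O g -> p < q -> affine_on g p q ->
  exists l c, forall x, p < x < q -> g x = l * x + c.
Proof.
move=> Dg pq Hg; pose m := (p + q) / 2; pose L := (q - p) / 2.
have L0 : 0 < L by rewrite /L; lra.
pose l := (g (m + L / 2) - g m) / (L / 2).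
pose f h := g (m + h) - g m - l * h.
have Df : dfun1 O f by rewrite /dfun1 /f; otac.
have f0 h : - L < h < L -> f h = 0.
  apply: (local_additive Df L0); last by rewrite /f /l; field; rewrite gt_eqF.
  move=> h1 h2 /andP[a1 a2] /andP[b1 b2] /andP[c1 c2].
  have := Hg m (m + h2) h1; rewrite /f -addrA [h2 + h1]addrC.
  rewrite /m /L in a1 a2 b1 b2 c1 c2 * => H.
  have := H ltac:(lra) ltac:(lra) ltac:(lra) ltac:(lra) ltac:(lra) ltac:(lra) ltac:(lra) ltac:(lra).
  lra.
exists l, (g m - l * m) => x /andP[px xq].
have : f (x - m) = 0 by apply: f0; rewrite /m /L; apply/andP; split; lra.
rewrite /f (_ : m + (x - m) = x); [lra|ring].
Qed.

Lemma affine_at_linear g p q : dfun1 O g -> p < q -> (forall t, p < t < q -> affine_at g t) ->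
  exists l c, forall x, p < x < q -> g x = l * x + c.
Proof.
move=> Dg pq Hg.
have lin t : p < t < q -> exists2 d, 0 < d &
    exists l c, forall x, t - d < x < t + d -> g x = l * x + c.
  by move=> /Hg[d [d0 Hd]]; exists d => //; apply: affine_on_linear Hd => //; lra.
have [|d d0 [l [c Hl]]] := lin ((p + q) / 2); first by apply/andP; split; lra.
exists l, c.
pose A t := exists d, 0 < d /\ forall x, t - d < x -> x < t + d -> g x = l * x + c.
have DA : dset1 O A by rewrite /dset1 /A; otac.
suff HA t : p < t < q -> A t.
  by move=> x /HA[d' [d'0]]; apply; lra.
move=> Ht; apply: (@interval_connected A p q DA _ ((p + q) / 2)) => //; last first.
- by exists d; split=> // x *; apply: Hl; apply/andP.
- by apply/andP; split; lra.
move=> u /lin[d' d'0 [l' [c' Hl']]]; exists d' => // x y /andP[x1 x2] /andP[y1 y2] [r [r0 Hr]].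
have [El Ec] : l' = l /\ c' = c.
  pose r' := Num.min r (Num.min (u + d' - x) (x - (u - d'))).
  have r'0 : 0 < r' by rewrite !lt_min r0; apply/andP; split; lra.
  have /and3P[q1 q2 q3] : [&& r' <= r, r' <= u + d' - x & r' <= x - (u - d')] by rewrite -!le_min.
  have E1 : l * x + c = l' * x + c'.
    by rewrite -Hl' -?Hr //; [lra|lra|apply/andP; split; lra].
  have E2 : l * (x + r' / 2) + c = l' * (x + r' / 2) + c'.
    by rewrite -Hl' -?Hr //; [lra|lra|apply/andP; split; lra].
  have E3 : (l' - l) * (r' / 2) = 0 by rewrite mulrBl; lra.
  have El : l' = l.
    move/eqP: E3; rewrite mulf_eq0 subr_eq0 => /orP[/eqP//|]; lra.
  by split=> //; rewrite El in E1; lra.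
pose r' := Num.min (u + d' - y) (y - (u - d')).
have r'0 : 0 < r' by rewrite !lt_min; apply/andP; split; lra.
have /andP[q2 q3] : (r' <= u + d' - y) && (r' <= y - (u - d')) by rewrite -!le_min.
exists r'; split=> // z z1 z2; rewrite -El -Ec; apply: Hl'; apply/andP; split; lra.
Qed.

End Intervals.

(** * Families of functions in reducts without multiplication *)

Section Semibounded.
Variables (R : rcfType) (D : dclass R).
Hypothesis DO : forall P, D P -> field_class R P.
Hypothesis nomul : ~ has_mul D.
Implicit Types (f g : R -> R).

Lemma affine_bounded_cst (l c K : R) : ev (fun x => `|l * x + c| <= K) -> l = 0.
Proof.
move=> H; apply/eqP; apply: contrapT => /negP l0.
have nl : 0 < `|l| by rewrite normr_gt0.
have [x [[Hx x0] Kx]] := ev_ex (ev_and (ev_and H (ev_gt 0)) (ev_gt ((K + `|c|) / `|l|))).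
move: Kx; rewrite ltr_pdivrMr // => Kx.
have : `|l * x| <= `|l * x + c| + `|c|.
  by rewrite -{1}(addrK c (l * x)); apply: le_trans (ler_normB _ _) _.
rewrite normrM (gtr0_norm x0); lra.
Qed.

Lemma bounded_const f K : dfun1 D f -> ev (fun x => `|f x| <= K) -> exists c, ev (fun x => f x = c).
Proof.
move=> Df HK; have [l [c [_ Hl]]] := eventually_affine DO nomul Df.
exists c; suff l0 : l = 0 by apply: ev_mono Hl => x ->; rewrite l0 mul0r add0r.
by apply: (@affine_bounded_cst l c K); apply: ev_mono (ev_and HK Hl) => x [+ <-].
Qed.

(** A curve in the box along which the absolute value of [f] exceeds [s] would have eventually
    constant coordinates, and one value of [f] would exceed every [s]. With multiplication,
    inversion would be a counterexample. *)
Lemma bounded_on_box (f : (nat -> R) -> R) r : dfun D f ->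
  exists K, forall e, (forall i, `|e i| <= r) -> `|f e| <= K.
Proof.
move=> Df; apply: contrapT => Hno.
have [n Hn] := d_fin Df.
have fE e e' : (forall i, (i < n)%N -> e i = e' i) -> f e = f e'.
  move=> E; apply: (Hn (scons (f e) e) (scons (f e) e')) => // -[|i] //= Hi.
  by apply: E; apply: ltnW.
pose W e s := (forall i, (i < n)%N -> `|e i| <= r) /\ s < `|f e|.
have DW : dfamP D W.
  rewrite /dfamP /W; apply: dset_and; last by dtac.
  by apply: (@dset_all_lt _ _ _ (fun i e => `|tl e i| <= r)) => i; dtac.
have [c Dc Hc] := choice_curve DO DW.
have {}Hc s : W (c s) s.
  apply: Hc; apply: contrapT => HW; apply: Hno; exists s => e He.
  by rewrite leNgt; apply/negP => Hs; apply: HW; exists e; split.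
have [k Hk] : exists k : nat -> R, ev (fun s => forall i, (i < n)%N -> c s i = k i).
  have Hi i : exists ki, (i < n)%N -> ev (fun s => c s i = ki).
    case: (boolP (i < n)%N) => Hi; last by exists 0.
    have [ki Hki] : exists ki, ev (fun s => c s i = ki).
      by apply: bounded_const (Dc i) _; apply: ev_all => s; case: (Hc s) => + _; apply.
    by exists ki.
  have [k Hk] := boolp.choice Hi; exists k.
  elim: (n) Hk => [|m IH] Hk; first by apply: ev_all.
  have /IH H' : forall i, (i < m)%N -> ev (fun s => c s i = k i).
    by move=> i Hm; apply: Hk; apply: ltnW.
  apply: ev_mono (ev_and H' (Hk m (ltnSn m))) => s [H1 H2] i.
  by rewrite ltnS leq_eqVlt => /orP[/eqP->|/H1].
have [s [Hs]] := ev_ex (ev_and Hk (ev_gt `|f k|)).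
have [_] := Hc s; rewrite (fE _ k Hs) => H1 H2; lra.
Qed.

(** For fixed [u], [G a u] is eventually [m u * a + c]. The function [m] is definable, hence
    eventually affine, and a nonzero slope of it would appear in mixed differences of [G]. So [m] is
    eventually constant, and [G a u - G a u1] tends to a function of [u] alone, itself eventually
    affine. *)
Lemma asymptotic_increments (G : R -> R -> R) : dfun2 D G -> exists2 b, 0 <= b &
  forall x y h, b < x -> b < x + h -> b < y -> b < y + h ->
    ev (fun a => G a (x + h) - G a x = G a (y + h) - G a y).
Proof.
move=> DG.
have Hm u : exists m, exists c, ev (fun a => G a u = m * a + c).
  have DGu : dfun1 D (fun a => G a u) by rewrite /dfun1; dtac.
  by have [m [c [_ H]]] := eventually_affine DO nomul DGu; exists m, c.
have [m {}Hm] := boolp.choice Hm.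
have Hinc u v : ev (fun a => G (a + v) u - G a u = m u * v).
  have [c Hc] := Hm u; apply: ev_mono (ev_and Hc (ev_shift v Hc)) => a [-> ->].
  by ring.
have Dm : dfun1 D m.
  apply: (@dset_ext _ _ (fun e => ev (fun a => G (a + 1) (e 1%N) - G a (e 1%N) = e 0%N))).
    move=> e /=; have H := Hinc (e 1%N) 1; rewrite mulr1 in H; split=> [H'|->//].
    by have [a [<- <-]] := ev_ex (ev_and H H').
  by rewrite /ev; dtac.
have [m1 [m0 [_ Hm1]]] := eventually_affine DO nomul Dm.
have m10 : m1 = 0.
  apply/eqP; apply: contrapT => /negP m10; apply: nomul; apply: (has_mul_scaled m10).
  apply: (@dset_ext _ _ (fun e => 0 < e 0%N /\ 0 < e 1%N /\ ev (fun u => ev (fun a =>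
    (G (a + e 1%N) (u + e 0%N) - G a (u + e 0%N)) - (G (a + e 1%N) u - G a u) = e 2%N)))).
    move=> e; set w := e 0%N; set v := e 1%N.
    have H : ev (fun u => ev (fun a =>
       (G (a + v) (u + w) - G a (u + w)) - (G (a + v) u - G a u) = m1 * (w * v))).
      apply: ev_mono (ev_and Hm1 (ev_shift w Hm1)) => u [E1 E2].
      apply: ev_mono (ev_and (Hinc u v) (Hinc (u + w) v)) => a [-> ->].
      by rewrite E1 E2; ring.
    split=> -[w0 [v0 H']]; do 2 split=> //; last by rewrite -H'.
    by have [u [/ev_and E /E /ev_ex[a [<- <-]]]] := ev_ex (ev_and H H').
  by rewrite /ev; dtac.
have [U HU] : ev (fun u => m u = m0) by apply: ev_mono Hm1 => u ->; rewrite m10 mul0r add0r.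
pose u1 := U + 1.
have Hc u : exists c, (U < u -> ev (fun a => G a u - G a u1 = c)) /\ (u <= U -> c = 0).
  have [Uu|Uu] := ltrP U u; last by exists 0.
  have [c Hc] := Hm u; have [c1 Hc1] := Hm u1; exists (c - c1); split=> // _.
  apply: ev_mono (ev_and Hc Hc1) => a [-> ->].
  by rewrite !HU ?/u1 ?ltrDl //; ring.
have [c {}Hc] := boolp.choice Hc.
have Dc : dfun1 D c.
  apply: (@dset_ext _ _ (fun e => (U < e 1%N /\ ev (fun a => G a (e 1%N) - G a u1 = e 0%N)) \/
     (e 1%N <= U /\ e 0%N = 0))); last by rewrite /ev; dtac.
  move=> e /=; have [H1 H2] := Hc (e 1%N); split.
    move=> [[Uu H]|[Uu ->]]; last by rewrite H2.
    by have [a [<- <-]] := ev_ex (ev_and (H1 Uu) H).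
  by move=> ->; have [Uu|Uu] := ltrP U (e 1%N); [left; split=> //; apply: H1|right; rewrite H2].
have [l [k [_ [V HV]]]] := eventually_affine DO nomul Dc.
exists (Num.max 0 (Num.max U V)); first by rewrite le_max lexx.
move=> x y h; rewrite !gt_max => /and3P[_ Ux Vx] /and3P[_ Uxh Vxh] /and3P[_ Uy Vy] /and3P[_ Uyh Vyh].
apply: ev_mono (ev_and (ev_and ((Hc x).1 Ux) ((Hc _).1 Uxh))
  (ev_and ((Hc y).1 Uy) ((Hc _).1 Uyh))) => a [[E1 E2] [E3 E4]].
by move: E1 E2 E3 E4; rewrite !HV // !mulrDr; lra.
Qed.

(** Uniformity in [x], [y] and [h]: a curve of violations would be bounded, hence eventually
    constant, against [asymptotic_increments]. *)
Lemma asymptotically_affine (G : R -> R -> R) : dfun2 D G -> exists2 b, 0 <= b &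
  ev (fun a => affine_on (G a) b (b + 2)).
Proof.
move=> DG; have [b b0 Hb] := asymptotic_increments DG; exists b => //.
have DA : dset1 D (fun a => affine_on (G a) b (b + 2)) by rewrite /dset1 /affine_on; dtac.
have [//|Hn] := ev_dec DO DA.
pose I x := (b < x) && (x < b + 2).
pose W (e : nat -> R) a := ((I (e 0%N) /\ I (e 0%N + e 2%N)) /\ (I (e 1%N) /\ I (e 1%N + e 2%N))) /\
  ~ (G a (e 0%N + e 2%N) - G a (e 0%N) = G a (e 1%N + e 2%N) - G a (e 1%N)).
have DW : dfamP D W by rewrite /dfamP /W /I; dtac.
have [c Dc Hc] := choice_curve DO DW.
have {}Hc : ev (fun a => W (c a) a).
  apply: ev_mono Hn => a Ha; apply: Hc; apply: contrapT => HW; apply: Ha.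
  move=> x y h x1 x2 y1 y2 xh1 xh2 yh1 yh2; apply: contrapT => Hne; apply: HW.
  exists (fun i => match i with 0 => x | 1 => y | _ => h end).
  by rewrite /W /I /= x1 x2 y1 y2 xh1 xh2 yh1 yh2.
have K0 : 0 <= b + 2 by lra.
have const i : (i < 3)%N -> exists k, ev (fun a => c a i = k).
  move=> Hi; apply: (bounded_const (K := b + 2) (Dc i)); apply: ev_mono Hc => a.
  rewrite /W /I => -[[[/andP[H1 H2] /andP[H3 H4]] [/andP[H5 H6] /andP[H7 H8]]] _].
  by case: i Hi => [|[|[|]]] // _; rewrite ler_norml; apply/andP; split; lra.
have [x Hx] := const 0%N isT; have [y Hy] := const 1%N isT; have [h Hh] := const 2%N isT.
have Hxyh := ev_and (ev_and Hx Hy) (ev_and Hh Hc).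
have [H1 [H2 [H3 H4]]] : b < x /\ b < x + h /\ b < y /\ b < y + h.
  have [a [[E1 E2] [E3]]] := ev_ex Hxyh.
  by rewrite /W /I E1 E2 E3 => -[[[/andP[-> _] /andP[-> _]] [/andP[-> _] /andP[-> _]]] _].
have [a [[[E1 E2] [E3 [_ Hne]]] He]] := ev_ex (ev_and Hxyh (Hb x y h H1 H2 H3 H4)).
by case: Hne; rewrite E1 E2 E3.
Qed.

(** Otherwise there are ever longer intervals without affine points; translated so as to start at 0,
    they form a family [G] that contradicts [asymptotically_affine]. *)
Lemma affine_points_syndetic (f : (nat -> R) -> R -> R) : dfam D f ->
  exists2 r, 0 < r & forall e p, exists2 t, p < t < p + r & affine_at (f e) t.
Proof.
move=> Df; apply: contrapT => Hno.
pose W (e : nat -> R) s := forall t, e 0%N < t -> t < e 0%N + s -> ~ affine_at (f (tl e)) t.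
have DW : dfamP D W by rewrite /dfamP /W /affine_at /affine_on; dtac.
have [c Dc Hc] := choice_curve DO DW.
have {}Hc : ev (fun s => W (c s) s).
  exists 0 => s s0; apply: Hc; apply: contrapT => HW; apply: Hno; exists s => // e p.
  apply: contrapT => Ht; apply: HW; exists (scons p e) => t /= t1 t2 Ha.
  by apply: Ht; exists t; rewrite ?t1.
pose G a u := f (tl (c a)) (c a 0%N + u).
have DG : dfun2 D G.
  rewrite /dfun2 /G; apply: (dfam_app Df); last first.
    by have D0 := dfun1_app (Dc 0%N) (dfun_var D 0); dtac.
  by move=> i; apply: (dfun1_app (Dc i.+1)); dtac.
have [b b0 Hb] := asymptotically_affine DG.
have [a [[Wa Ha] ab]] := ev_ex (ev_and (ev_and Hc Hb) (ev_gt (b + 1))).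
apply: (Wa (c a 0%N + (b + 1))); [lra|lra|].
exists 1; split=> // x y h x1 x2 y1 y2 h1 h2 h3 h4.
have E z : f (tl (c a)) z = G a (z - c a 0%N) by rewrite /G addrC subrK.
rewrite !E ![_ + h - _]addrAC; apply: Ha; lra.
Qed.

End Semibounded.

(** * Finitely many long slopes and uniform piecewise affineness *)

Section PiecewiseAffine.
Variables (R : rcfType) (D : dclass R).
Hypothesis DO : forall P, D P -> field_class R P.
Hypothesis nomul : ~ has_mul D.

Lemma dset_mem (s : seq R) (t : (nat -> R) -> R) : dfun D t -> D (fun e => t e \in s).
Proof.
move=> Dt; elim: s => [|a s IHs]; first exact: (dset_bool D false).
apply: (@dset_ext _ _ (fun e => t e = a \/ t e \in s)); last by dtac.
by move=> e; rewrite in_cons; split=> [[->|->]|/orP[/eqP->|->]]; rewrite ?eqxx ?orbT; auto.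
Qed.

Lemma affine_on_slope (g : R -> R) p s : dfun1 (field_class R) g -> 2 < s ->
  affine_on g p (p + s) ->
  exists c, forall x, p < x < p + s -> g x = (g (p + 2) - g (p + 1)) * x + c.
Proof.
move=> Dg s2 Hg; have [|l [c H]] := affine_on_linear Dg _ Hg; first lra.
exists c => x Hx; rewrite (H x) // (H (p + 2)) ?(H (p + 1)); first ring.
all: by apply/andP; split; lra.
Qed.

Lemma linear_affine_on (g : R -> R) p q l c : (forall x, p < x < q -> g x = l * x + c) ->
  affine_on g p q.
Proof.
move=> H x y h x1 x2 y1 y2 x3 x4 y3 y4.
by rewrite !H ?x1 ?x2 ?y1 ?y2 ?x3 ?x4 ?y3 ?y4 //; ring.
Qed.

Lemma long_slopes (f : (nat -> R) -> R -> R) : dfam D f -> exists Ls : seq R,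
  (forall l, l \in Ls -> dscalar D l) /\ exists2 r, 2 < r &
  forall e p l c, (forall x, p < x < p + r -> f e x = l * x + c) -> l \in Ls.
Proof.
move=> Df; have Of e : dfun1 (field_class R) (f e) by apply/DO/dfunfam_fix.
pose Q l s := exists e p, affine_on (f e) p (p + s) /\ f e (p + 2) - f e (p + 1) = l.
have DQ : D (fun e => Q (e 0%N) (e 1%N)).
  pose sh (e : nat -> R) : nat -> R := fun i => e i.+3.
  have DP : D (fun e => affine_on (f (sh e)) (e 2%N) (e 2%N + e 1%N) /\
     f (sh e) (e 2%N + 2) - f (sh e) (e 2%N + 1) = e 0%N).
    by rewrite /sh /affine_on; dtac.
  apply: dset_ext (dset_ex_env 2 DP) => e; split.
    by move=> [e' [He [H1 H2]]]; exists (sh e'), (e' 2%N); rewrite -!He.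
  move=> [e' [p [H1 H2]]]; exists (scons (e 0%N) (scons (e 1%N) (scons p e'))).
  by split=> // -[|[|]].
(* The slopes that occur on arbitrarily long intervals. *)
pose pers l := forall s, 2 < s -> Q l s.
have Dpers : dset1 D pers.
  rewrite /dset1 /pers; apply: dset_all; apply: dset_imp; first by dtac.
  by apply: (@dset_app _ D _ (fun e i => match i with 0 => e 1%N | _ => e 0%N end) DQ) => -[|i]; dtac.
have [s0 Hs0] := omin1 DO Dpers.
(* Otherwise [pers] contains an interval around [l]. Reading off increments on long affine pieces
   then defines [z * u] for [z] in this interval and all [u > 0], that is, the multiplication on a
   strip. *)
have pers_s0 l : pers l -> l \in s0.
  move=> Pl; apply: contrapT => /negP ls; apply: nomul.
  have [d d0 Hd] := point_interval_free ls.
  have {}Pl z : l - d < z < l + d -> pers z.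
    by move=> Hz; apply: (Hs0 _ _ Hd l) => //; apply/andP; split; lra.
  pose M z u w := exists e p, affine_on (f e) p (p + (u + 3)) /\
    f e (p + 2) - f e (p + 1) = z /\ f e (p + 1 + u) - f e (p + 1) = w.
  have DM : D (fun e => M (e 0%N) (e 1%N) (e 2%N)).
    pose sh (e : nat -> R) : nat -> R := fun i => e i.+4.
    have DP : D (fun e => affine_on (f (sh e)) (e 3%N) (e 3%N + (e 1%N + 3)) /\
       f (sh e) (e 3%N + 2) - f (sh e) (e 3%N + 1) = e 0%N /\
       f (sh e) (e 3%N + 1 + e 1%N) - f (sh e) (e 3%N + 1) = e 2%N).
      by rewrite /sh /affine_on; dtac.
    apply: dset_ext (dset_ex_env 3 DP) => e; split.
      by move=> [e' [He [H1 H2]]]; exists (sh e'), (e' 3%N); rewrite -!He.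
    move=> [e' [p [H1 H2]]]; exists (scons (e 0%N) (scons (e 1%N) (scons (e 2%N) (scons p e')))).
    by split=> // -[|[|[|]]].
  have ME z u w : pers z -> 0 < u -> M z u w <-> w = z * u.
    move=> Pz u0.
    have lin e p : affine_on (f e) p (p + (u + 3)) -> f e (p + 2) - f e (p + 1) = z ->
        f e (p + 1 + u) - f e (p + 1) = z * u.
      move=> Ha Ez; have [|c Hc] := affine_on_slope (Of e) _ Ha; first lra.
      have E1 := Hc (p + 1); have E2 := Hc (p + 1 + u); rewrite Ez in E1 E2.
      rewrite E1 ?E2; [ring|apply/andP; split; lra..].
    split=> [[e [p [H1 [H2 <-]]]]|->]; first exact: lin.
    have [|e [p [H1 H2]]] := Pz (u + 3); first lra.
    by exists e, p; do 2 split=> //; apply: lin.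
  apply: (has_mul_strip d0).
  apply: (@dset_ext _ _ (fun e => (0 < e 0%N /\ e 0%N < d) /\ 0 < e 1%N /\
     exists w1 w2, M (l + e 0%N) (e 1%N) w1 /\ M l (e 1%N) w2 /\ w1 - w2 = e 2%N)).
    move=> e; set v := e 0%N; set u := e 1%N; set w := e 2%N.
    have Pl0 : pers l by apply: Pl; apply/andP; split; lra.
    have Pv : 0 < v -> v < d -> pers (l + v) by move=> *; apply: Pl; apply/andP; split; lra.
    split.
      move=> [[v0 vd] [u0 [w1 [w2 [H1 [H2 <-]]]]]]; do 2 split=> //.
      rewrite ((ME _ _ _ (Pv v0 vd) u0).1 H1) ((ME _ _ _ Pl0 u0).1 H2); ring.
    move=> [[v0 vd] [u0 <-]]; do 2 split=> //; exists ((l + v) * u), (l * u).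
    split; first by apply/(ME _ _ _ (Pv v0 vd) u0).
    by split; [apply/(ME _ _ _ Pl0 u0)|ring].
  have DM' (t u v : (nat -> R) -> R) : dfun D t -> dfun D u -> dfun D v ->
      D (fun e => M (t e) (u e) (v e)).
    move=> Dt Du Dv.
    have := @dset_app _ D _ (fun e i => match i with 0 => t e | 1 => u e | _ => v e end) DM.
    by apply=> -[|[|i]].
  apply: dset_and; first by dtac.
  apply: dset_and; first by dtac.
  apply: dset_ex; apply: dset_ex; apply: dset_and; first by apply: DM'; dtac.
  by apply: dset_and; [apply: DM'; dtac|dtac].
pose Ls := [seq l <- s0 | `[< dscalar D l >]].
exists Ls; split=> [l|]; first by rewrite mem_filter => /andP[/asboolP].
(* If no length is sufficient, there is a curve of intervals of length [s] whose slopes [lam s]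
   avoid [Ls]. But [lam] is eventually a constant [k], which is a definable scalar and occurs on
   arbitrarily long intervals, so it belongs to [Ls]. *)
apply: contrapT => Hno.
pose W (e : nat -> R) s := affine_on (f (tl e)) (e 0%N) (e 0%N + s) /\
  ~ (f (tl e) (e 0%N + 2) - f (tl e) (e 0%N + 1) \in Ls).
have DW : dfamP D W.
  rewrite /dfamP /W; apply: dset_and; first by rewrite /affine_on; dtac.
  by apply: dset_not; apply: dset_mem; dtac.
have [c Dc Hc] := choice_curve DO DW.
have {}Hc s : 2 < s -> W (c s) s.
  move=> s2; apply: Hc; apply: contrapT => HW; apply: Hno; exists s => // e p l k Hl.
  apply: contrapT => lLs; apply: HW; exists (scons p e); split=> /=.
    exact: linear_affine_on Hl.
  rewrite !Hl; [|by apply/andP; split; lra..].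
  by have -> : l * (p + 2) + k - (l * (p + 1) + k) = l by ring.
pose G s u := f (tl (c s)) (c s 0%N + 1 + u) - f (tl (c s)) (c s 0%N + 1).
have DG : dfun2 D G.
  have Dc0 := Dc 0%N; rewrite /dfun2 /G.
  have D0 : dfun D (fun e => c (e 0%N) 0%N) by apply: (dfun1_app Dc0); dtac.
  have Dtl i : dfun D (fun e => tl (c (e 0%N)) i) by apply: (dfun1_app (Dc i.+1)); dtac.
  by apply: dfun_sub; apply: (dfam_app Df Dtl); dtac.
pose lam s := G s 1.
have GE s u : 2 < s -> 0 <= u -> u < s - 1 -> G s u = lam s * u.
  move=> s2 u0 us; have [Ha _] := Hc s s2.
  have [k Hk] := affine_on_slope (Of _) s2 Ha.
  have E0 : c s 0%N + 1 + 1 = c s 0%N + 2 by ring.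
  have E1 := Hk (c s 0%N + 1); have E2 := Hk (c s 0%N + 1 + u).
  rewrite /lam /G E0; set l := f _ (c s 0%N + 2) - _ in E1 E2 *.
  rewrite E1 ?E2; [ring|apply/andP; split; lra..].
have GEev u : 0 <= u -> ev (fun s => G s u = lam s * u).
  move=> u0; apply: ev_mono (ev_and (ev_gt 2) (ev_gt (u + 1))) => s [s2 su].
  by apply: GE => //; lra.
have Dlam : dfun1 D lam by rewrite /dfun1 /lam; dtac.
have [l [k [_ Hl]]] := eventually_affine DO nomul Dlam.
have l0 : l = 0.
  apply/eqP; apply: contrapT => /negP l0; apply: nomul; apply: (has_mul_scaled l0).
  apply: (@dset_ext _ _ (fun e => 0 < e 0%N /\ 0 < e 1%N /\
    ev (fun s => G (s + e 1%N) (e 0%N) - G s (e 0%N) = e 2%N))); last by rewrite /ev; dtac.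
  move=> e; set u := e 0%N; set v := e 1%N.
  have H : 0 < u -> ev (fun s => G (s + v) u - G s u = l * (u * v)).
    move=> u0; have Gu := GEev u (ltW u0).
    apply: ev_mono (ev_and (ev_and Hl (ev_shift v Hl)) (ev_and Gu (ev_shift v Gu))).
    by move=> s [[E1 E2] [-> ->]]; rewrite E1 E2; ring.
  split=> -[u0 [v0 H']]; do 2 split=> //; last by rewrite -H'; apply: H.
  by have [s [<- <-]] := ev_ex (ev_and (H u0) H').
have {}Hl : ev (fun s => lam s = k) by apply: ev_mono Hl => s ->; rewrite l0 mul0r add0r.
have Gk u : 0 <= u -> ev (fun s => G s u = k * u).
  by move=> u0; apply: ev_mono (ev_and Hl (GEev u u0)) => s [<- ->].
have Dk : dscalar D k.
  apply: (@dset_ext _ _ (fun e => (0 <= e 1%N /\ ev (fun s => G s (e 1%N) = e 0%N)) \/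
     (e 1%N < 0 /\ ev (fun s => G s (- e 1%N) = - e 0%N)))); last by rewrite /ev; dtac.
  move=> e /=; set u := e 1%N; set w := e 0%N; split.
    move=> [[u0 H]|[u0 H]]; first by have [s [<- <-]] := ev_ex (ev_and (Gk u u0) H).
    have u0' : 0 <= - u by lra.
    by have [s [->]] := ev_ex (ev_and (Gk _ u0') H); rewrite mulrN => /oppr_inj.
  move=> ->; have [u0|u0] := lerP 0 u; [left|right]; split=> //; first exact: Gk.
  by rewrite -mulrN; apply: Gk; lra.
have Pk : pers k.
  move=> s s2; have [z [[Ez zs] z2]] := ev_ex (ev_and (ev_and Hl (ev_gt s)) (ev_gt 2)).
  have [Ha _] := Hc z z2; exists (tl (c z)), (c z 0%N); split.
    by apply: affine_on_sub Ha => //; lra.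
  by rewrite -Ez /lam /G; congr (f _ _ - _); ring.
have [z [Ez z2]] := ev_ex (ev_and Hl (ev_gt 2)).
have [_] := Hc z z2; apply.
have -> : c z 0%N + 2 = c z 0%N + 1 + 1 by ring.
rewrite -/(G z 1) -/(lam z) Ez mem_filter pers_s0 // andbT; exact/asboolP.
Qed.

(** Definable choice picks a point of each nonempty fibre; removing it lowers the bound [N]. *)
Lemma enumerate_fibres N (B : (nat -> R) -> R -> Prop) : dfamP D B ->
  (forall e, exists s : seq R, (size s <= N)%N /\ forall t, B e t -> t \in s) ->
  exists cs : list ((nat -> R) -> R), (forall c, List.In c cs -> dfun D c) /\
    forall e t, B e t -> exists2 c, List.In c cs & t = c e.
Proof.
elim: N B => [|N IHN] B DB HB.
  exists [::]; split=> // e t Bt; have [s [Hs Ht]] := HB e.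
  by have := Ht t Bt; case: (s) Hs.
have [h Dh Hh] := definable_choice DO DB.
have DB' : dfamP D (fun e t => B e t /\ ~ (t = h e)) by rewrite /dfamP; dtac.
have [|cs [Dcs Hcs]] := IHN _ DB'.
  move=> e; have [s [Hs Ht]] := HB e.
  case: (pselect (exists t, B e t)) => [Be|nB]; last first.
    by exists [::]; split=> // t [Bt]; case: nB; exists t.
  exists (rem (h e) s); split.
    by rewrite size_rem; [rewrite -subn1 leq_subLR add1n|apply/Ht/Hh].
  move=> t [Bt th]; have ts := Ht t Bt.
  have : t \in h e :: rem (h e) s by rewrite -(perm_mem (perm_to_rem (Ht _ (Hh e Be)))).
  by rewrite in_cons => /orP[/eqP|].
exists (h :: cs); split=> [c [<-//|/Dcs//]|e t Bt].
case: (pselect (t = h e)) => [->|th]; first by exists h => //; left.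
by have [c cc ->] := Hcs e t (conj Bt th); exists c => //; right.
Qed.

Theorem piecewise_affine (f : (nat -> R) -> R -> R) : dfam D f ->
  exists (cs : list ((nat -> R) -> R)) (Ls : seq R) (r : R),
  [/\ forall c, List.In c cs -> dfun D c, forall l, l \in Ls -> dscalar D l, 0 < r &
  forall e p q, (forall c, List.In c cs -> ~ (p < c e < q)) -> r < q - p ->
    exists l b, l \in Ls /\ forall x, p < x < q -> f e x = l * x + b].
Proof.
move=> Df; pose T e t := affine_at (f e) t.
have DT : dfamP D T by rewrite /dfamP /T /affine_at /affine_on; dtac.
have [N HN] := field_omin (DO DT).
(* The points without a neighbourhood on which [T e] is constant. They are among the break points,
   hence uniformly finite in number, and unlike an arbitrary list of break points they form a
   definable family. *)
pose B e t := forall p q, p < t -> t < q -> ~ (forall x y, p < x -> x < q -> p < y -> y < q ->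
   T e x -> T e y).
have DB : dfamP D B by rewrite /dfamP /B; dtac.
have [|cs [Dcs Hcs]] := @enumerate_fibres N B DB.
  move=> e; have [s [Hs Hc]] := HN e; exists s; split=> // t Bt.
  apply: contrapT => /negP ts; have [d d0 Hd] := point_interval_free ts.
  apply: (Bt (t - d) (t + d)); [lra|lra|].
  by move=> x y x1 x2 y1 y2; apply: (Hc _ _ Hd); apply/andP.
have [r1 r10 Hr1] := affine_points_syndetic DO nomul Df.
have [Ls [HLs [r2 r22 Hr2]]] := long_slopes Df.
exists cs, Ls, (Num.max r1 r2); split=> //; first by rewrite lt_max r10.
move=> e p q free; rewrite gt_max => /andP[qp1 qp2].
have Tconst : forall x y, p < x < q -> p < y < q -> T e x -> T e y.
  apply: interval_connected; first exact/DO/dfam_fix.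
  move=> t Ht; have nB : ~ B e t by move=> /Hcs[c /free H tc]; apply: H; rewrite -tc.
  have [a [b [at1 tb H]]] : exists a b, [/\ a < t, t < b & forall x y, a < x -> x < b ->
      a < y -> y < b -> T e x -> T e y].
    apply: contrapT => Hno; apply: nB => a b at1 tb H; apply: Hno; by exists a, b.
  exists (Num.min (t - a) (b - t)); first by rewrite lt_min !subr_gt0 at1.
  set d := Num.min _ _; have /andP[d1 d2] : (d <= t - a) && (d <= b - t) by rewrite -le_min.
  by move=> x y /andP[x1 x2] /andP[y1 y2]; apply: H; lra.
have Of : dfun1 (field_class R) (f e) by apply/DO/dfunfam_fix.
(* The interval is longer than [r1], so it contains one affine point, and then all its points are
   affine. *)
have Tall t : p < t < q -> T e t.
  have [u /andP[u1 u2] Tu] := Hr1 e p; move=> Ht; apply: (Tconst u) => //.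
  by apply/andP; split; lra.
have [|l [b Hl]] := affine_at_linear Of _ Tall; first lra.
exists l, b; split=> //; apply: (Hr2 e p l b) => x /andP[x1 x2].
by apply: Hl; apply/andP; split; lra.
Qed.

End PiecewiseAffine.

(** * Definable sets at generic points *)

Lemma list_argmax (T : Type) (R : realDomainType) (s : list T) (P : T -> Prop) (v : T -> R) :
  (exists c, List.In c s /\ P c) ->
  exists c, [/\ List.In c s, P c & forall c', List.In c' s -> P c' -> v c' <= v c].
Proof.
elim: s => [|a s IH] [c [+ Pc]]; first by [].
case: (pselect (exists c, List.In c s /\ P c)) => [/IH[b [bs Pb Hb]] _|Hno].
  case: (pselect (P a /\ v b < v a)) => [[Pa ba]|Hn].
    exists a; split=> //; first by left.
    by move=> c' [<-//|/Hb H /H]; move=> /le_trans; apply; apply: ltW.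
  exists b; split=> //; first by right.
  move=> c' [<- Pa|/Hb//]; rewrite leNgt; apply/negP => ba; exact: Hn.
move=> [Ec|cs]; last by case: Hno; exists c.
exists a; split; [by left|by rewrite Ec|].
by move=> c' [<-//|c's Pc']; case: Hno; exists c'.
Qed.

Lemma list_bound (T : Type) (R : realDomainType) (s : list T) (v : T -> R) :
  exists2 B, 0 <= B & forall c, List.In c s -> v c <= B.
Proof.
elim: s => [|a s [B B0 HB]]; first by exists 0.
exists (Num.max (v a) B); first by rewrite le_max B0 orbT.
by move=> c [<-|/HB H]; rewrite le_max ?lexx ?H ?orbT.
Qed.

Lemma In_mem (T : eqType) (x : T) s : x \in s -> List.In x s.
Proof. by elim: s => //= a s IH; rewrite in_cons => /orP[/eqP->|/IH]; [left|right]. Qed.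

Section GenericLinearity.
Variables (R : rcfType) (D : dclass R).
Hypothesis DO : forall P, D P -> field_class R P.
Hypothesis nomul : ~ has_mul D.
Implicit Types (l m e : nat -> R) (F M : list (nat -> R)).

Definition lin (j : nat) l e : R := \sum_(i < j) l i * e i.

Definition scalar_form (j : nat) l := forall i, (i < j)%N -> dscalar D (l i).
Definition nonzero_form (j : nat) l := exists2 i, (i < j)%N & l i != 0.

(* In generic points, the first [j] coordinates are large and the others are bounded. *)
Definition generic j F (r r0 : R) e :=
  (forall i, (j <= i)%N -> `|e i| <= r0) /\ (forall l, List.In l F -> r < `|lin j l e|).

Definition same_region j F e e' :=
  (forall i, (j <= i)%N -> e i = e' i) /\
  (forall l, List.In l F -> (0 < lin j l e) = (0 < lin j l e')).

(** The linear part comes from a finite list, while the constant term is only bounded: it may vary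
    with the bounded coordinates of [e]. *)
Definition linear_on_regions j F M (r r0 : R) (f : (nat -> R) -> R) :=
  forall e, generic j F r r0 e -> exists l c, [/\ List.In l M, `|c| <= r &
    forall e', generic j F r r0 e' -> same_region j F e e' -> f e' = lin j l e' + c].

Lemma lin_recr j l e : lin j.+1 l e = lin j l e + l j * e j.
Proof. by rewrite /lin big_ord_recr. Qed.

Lemma eq_lin j l l' e e' : (forall i, (i < j)%N -> l i = l' i) ->
  (forall i, (i < j)%N -> e i = e' i) -> lin j l e = lin j l' e'.
Proof. by move=> El Ee; apply: eq_bigr => i _; rewrite El ?Ee. Qed.

Lemma lin_sub j l m e : lin j (fun i => l i - m i) e = lin j l e - lin j m e.
Proof. by rewrite /lin -sumrB; apply: eq_bigr => i _; rewrite mulrBl. Qed.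

Lemma lin_scale j (a : R) l e : lin j (fun i => a * l i) e = a * lin j l e.
Proof. by rewrite /lin mulr_sumr; apply: eq_bigr => i _; rewrite mulrA. Qed.

Lemma lin_zero_form j l e : ~ nonzero_form j l -> lin j l e = 0.
Proof.
move=> H; rewrite /lin big1 // => i _; case: (eqVneq (l i) 0) => [->|l0]; first by rewrite mul0r.
by case: H; exists i.
Qed.

Lemma linear_on_regions_sub j F F' M M' r r' r0 f :
  (forall l, List.In l F -> List.In l F') -> (forall l, List.In l M -> List.In l M') ->
  r <= r' -> linear_on_regions j F M r r0 f -> linear_on_regions j F' M' r' r0 f.
Proof.
move=> FF MM rr H e.
have gF e' : generic j F' r' r0 e' -> generic j F r r0 e'.
  by move=> [g1 g2]; split=> // l /FF /g2; apply: le_lt_trans.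
move=> ge; have [l [c [lM cr Hl]]] := H e (gF _ ge).
exists l, c; split; [exact: MM|exact: le_trans rr|].
move=> e' /gF ge' [s1 s2]; apply: Hl => //; split=> // l' /FF; exact: s2.
Qed.

Definition regions_thm j := forall f r0, dfun D f -> exists F M r, [/\
  forall l, List.In l F -> scalar_form j l /\ nonzero_form j l,
  forall l, List.In l M -> scalar_form j l, 0 <= r & linear_on_regions j F M r r0 f].

Lemma regions_list j : regions_thm j -> forall (fs : list ((nat -> R) -> R)) r0,
  (forall f, List.In f fs -> dfun D f) -> exists F M r, [/\
  forall l, List.In l F -> scalar_form j l /\ nonzero_form j l,
  forall l, List.In l M -> scalar_form j l, 0 <= r &
  forall f, List.In f fs -> linear_on_regions j F M r r0 f].
Proof.
move=> Hj fs r0; elim: fs => [|f fs IH] Dfs; first by exists [::], [::], 0.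
have [F1 [M1 [r1 [F1s M1s r10 H1]]]] := Hj f r0 (Dfs f (or_introl erefl)).
have [|F2 [M2 [r2 [F2s M2s r20 H2]]]] := IH; first by move=> g Hg; apply: Dfs; right.
exists (F1 ++ F2)%list, (M1 ++ M2)%list, (Num.max r1 r2); split.
- by move=> l /List.in_app_iff[/F1s|/F2s].
- by move=> l /List.in_app_iff[/M1s|/M2s].
- by rewrite le_max r10.
move=> g [<-|/H2 Hg].
  apply: linear_on_regions_sub H1; rewrite ?le_max ?lexx // => l Hl;
    by apply/List.in_app_iff; left.
apply: linear_on_regions_sub Hg; rewrite ?le_max ?lexx ?orbT // => l Hl;
  by apply/List.in_app_iff; right.
Qed.

Lemma regions0 : regions_thm 0.
Proof.
move=> f r0 Df; have [K HK] := bounded_on_box DO nomul r0 Df.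
exists [::], [:: fun=> 0], (Num.max 0 K); split=> //; first by rewrite le_max lexx.
move=> e [g1 _]; exists (fun=> 0), (f e); split; first by left.
  by rewrite le_max HK ?orbT // => i; apply: g1.
move=> e' _ [s1 _]; rewrite /lin big_ord0 add0r; congr f; apply: funext => i.
by rewrite s1.
Qed.

Definition lift_form (j : nat) l : nat -> R := fun i => if (i < j)%N then l i else 0.
Definition top_form (j : nat) l : nat -> R := fun i => if (i < j)%N then - l i else 1.

Lemma lin_lift j l e : lin j.+1 (lift_form j l) e = lin j l e.
Proof.
rewrite lin_recr /lift_form ltnn mul0r addr0.
by apply: eq_lin => // i ->.
Qed.

Lemma lin_top j l e : lin j.+1 (top_form j l) e = e j - lin j l e.
Proof.
rewrite lin_recr /top_form ltnn mul1r addrC; congr (_ + _).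
rewrite /lin -sumrN; apply: eq_bigr => i _; by rewrite ltn_ord mulNr.
Qed.

Lemma lin_upd j l e a : lin j l (upd e j a) = lin j l e.
Proof. by apply: eq_lin => // i Hi; rewrite /upd ltn_eqF. Qed.

Lemma upd_upd e j a b : upd (upd e j a) j b = upd e j b.
Proof. by apply: funext => i; rewrite /upd; case: eqP. Qed.

Lemma upd_id e j : upd e j (e j) = e.
Proof. by apply: funext => i; rewrite /upd; case: eqP => [->|]. Qed.

(** As a function of coordinate [j] alone, [f] is piecewise affine, with break points that depend on
    the other coordinates. The induction hypothesis applies to these break points, to base points
    next to them, and to the values and slopes of [f] there; the order of the break points becomes
    constant on each region. *)
Lemma regionsS j : regions_thm j -> regions_thm j.+1.
Proof.
move=> IH f r0 Df.
have Dfj : dfam D (fun e t => f (upd e j t)) by rewrite /dfam; dtac.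
have [cs [Ls [r1 [Dcs HLs r10 Haff]]]] := piecewise_affine DO nomul Dfj.
(* The zero function guarantees a break point even if [cs] is empty. *)
pose cs1 := (fun=> 0) :: cs.
have Dcs1 c : List.In c cs1 -> dfun D c by move=> [<-|/Dcs//]; apply: dfun_cst.
(* Base points next to a break point [c]: [c + 1] for the interval above it and [c - 2] for the one
   below, so that [g] and [g + 1] both fall inside. *)
pose gs := (List.map (fun c e => c e + 1) cs1 ++ List.map (fun c e => c e - 2) cs1)%list.
have Dgs g : List.In g gs -> dfun D g.
  by move=> /List.in_app_iff[] /List.in_map_iff[c [<- /Dcs1 Dc]]; dtac.
pose hs := List.map (fun g e => f (upd e j (g e))) gs.
pose ss := List.map (fun g e => f (upd e j (g e + 1)) - f (upd e j (g e))) gs.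
have [|F0 [M0' [r_ [HF0 HM0' r_0 Hreg']]]] :=
  @regions_list j IH (cs1 ++ gs ++ hs ++ ss)%list (Num.max 0 r0).
  move=> g /List.in_app_iff[/Dcs1//|/List.in_app_iff[/Dgs//|/List.in_app_iff[]]].
    by move=> /List.in_map_iff[g' [<- /Dgs Dg]]; dtac.
  by move=> /List.in_map_iff[g' [<- /Dgs Dg]]; dtac.
pose M0 := (fun=> 0) :: M0'.
have HM0 l : List.In l M0 -> scalar_form j l.
  by move=> [<-|/HM0'//] i _; apply: dscalar0.
have Hreg g : List.In g (cs1 ++ gs ++ hs ++ ss)%list ->
    linear_on_regions j F0 M0 r_ (Num.max 0 r0) g.
  by move=> /Hreg'; apply: linear_on_regions_sub => // l Hl; right.
have [B B0 HB] := list_bound Ls (fun l : R => `|l|).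
(* With [2 * r_] the bounded constant terms do not affect comparisons of forms; [r1 + 3] is the
   distance to be kept from the break points; [B] excludes a nonconstant slope; [B * r_] occurs in
   the new constant term. *)
pose r := 2 * r_ + r1 + 3 + B + B * r_.
have Br : 0 <= B * r_ by rewrite mulr_ge0.
pose diffs := List.flat_map (fun m => List.map (fun m' i => m i - m' i) M0) M0.
pose F := (List.map (lift_form j) F0 ++ List.map (top_form j) M0 ++
  List.map (lift_form j) (List.filter (fun l => `[< nonzero_form j l >]) diffs))%list.
pose comb m m' (a : R) : nat -> R := fun i => if (i < j)%N then m i - a * m' i else a.
pose M := List.flat_map (fun m => List.flat_map (fun m' => List.map (comb m m') Ls) M0) M0.
have lin_comb m m' a e : lin j.+1 (comb m m' a) e = lin j m e - a * lin j m' e + a * e j.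
  rewrite lin_recr /comb ltnn; congr (_ + _); rewrite -lin_scale -lin_sub.
  by apply: eq_lin => // i ->.
have In_top m : List.In m M0 -> List.In (top_form j m) F.
  by move=> Hm; apply/List.in_app_iff; right; apply/List.in_app_iff; left; apply: List.in_map.
have In_diff m m' : List.In m M0 -> List.In m' M0 -> nonzero_form j (fun i => m i - m' i) ->
    List.In (lift_form j (fun i => m i - m' i)) F.
  move=> Hm Hm' nz; apply/List.in_app_iff; right; apply/List.in_app_iff; right.
  apply: List.in_map; apply/List.filter_In; split; last exact/asboolP.
  apply/List.in_flat_map; exists m; split=> //; apply/List.in_map_iff; by exists m'.
exists F, M, r; split.
- move=> l /List.in_app_iff[|/List.in_app_iff[]] /List.in_map_iff[m [<- Hm]].
  + have [sm [i Hi mi]] := HF0 m Hm; split; last first.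
      by exists i; rewrite ?/lift_form ?Hi // ltnW.
    by move=> k _; rewrite /lift_form; case: ifP => [/sm//|_]; apply: dscalar0.
  + have sm := HM0 m Hm; split; last by exists j => //; rewrite /top_form ltnn oner_neq0.
    move=> k _; rewrite /top_form; case: ifP => [/sm|_]; last exact: dscalar1.
    exact: dscalarN.
  + move: Hm => /List.filter_In[/List.in_flat_map[a [Ha /List.in_map_iff[b [<- Hb]]]] /asboolP].
    move=> [i Hi mi]; split; last by exists i; rewrite ?/lift_form ?Hi // ltnW.
    move=> k _; rewrite /lift_form; case: ifP => [kj|_]; last exact: dscalar0.
    by apply: dscalarD; [apply: (HM0 a)|apply/dscalarN/(HM0 b)].
- move=> l /List.in_flat_map[a [Ha /List.in_flat_map[b [Hb /List.in_map_iff[c [<- Hc]]]]]].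
  have Dc : dscalar D c.
    apply: HLs; elim: (Ls) Hc => //= x s IHs [->|/IHs]; first by rewrite mem_head.
    by rewrite in_cons => ->; rewrite orbT.
  move=> k _; rewrite /comb; case: ifP => // kj; apply: dscalarD; first exact: (HM0 a).
  by apply/dscalarN/dscalarM => //; apply: (HM0 b).
- by rewrite /r; lra.
have rr_ : r_ <= r by rewrite /r; lra.
move=> e ge.
pose z (e : nat -> R) := upd e j 0.
have gz e' : generic j.+1 F r r0 e' -> generic j F0 r_ (Num.max 0 r0) (z e').
  move=> [g1 g2]; split.
    move=> i ij; rewrite /z /upd; case: eqP => [_|/eqP ne]; first by rewrite normr0 le_max lexx.
    by rewrite le_max g1 ?orbT // ltn_neqAle eq_sym ne.
  move=> l Hl; rewrite /z lin_upd -lin_lift; apply: le_lt_trans rr_ _; apply: g2.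
  by apply/List.in_app_iff; left; apply: List.in_map.
have sz e' : same_region j.+1 F e e' -> same_region j F0 (z e) (z e').
  move=> [s1 s2]; split.
    move=> i ij; rewrite /z /upd; case: eqP => // /eqP ne; apply: s1.
    by rewrite ltn_neqAle eq_sym ne.
  move=> l Hl; rewrite /z !lin_upd -(lin_lift j l e) -(lin_lift j l e'); apply: s2.
  by apply/List.in_app_iff; left; apply: List.in_map.
pose ok e' := generic j.+1 F r r0 e' /\ same_region j.+1 F e e'.
have oke : ok e by split.
have val g : List.In g (cs1 ++ gs ++ hs ++ ss)%list -> exists m b, [/\ List.In m M0, `|b| <= r_ &
    forall e', ok e' -> g (z e') = lin j m e' + b].
  move=> Hg; have [m [b [Hm Hb H]]] := Hreg g Hg _ (gz _ ge).
  exists m, b; split=> // e' [ge' se']; rewrite H ?/z ?lin_upd //; [exact: gz|exact: sz].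
have diff_sign m m' e' : List.In m M0 -> List.In m' M0 -> ok e' ->
    (forall e, lin j m e = lin j m' e) \/
    [/\ r < `|lin j m e - lin j m' e|, r < `|lin j m e' - lin j m' e'| &
     (0 < lin j m e - lin j m' e) = (0 < lin j m e' - lin j m' e')].
  move=> Hm Hm' [ge' se'].
  case: (pselect (nonzero_form j (fun i => m i - m' i))) => nz; last first.
    by left=> e1; have := lin_zero_form e1 nz; rewrite lin_sub; lra.
  have Hin := In_diff _ _ Hm Hm' nz; right; rewrite -!lin_sub -(lin_lift j _ e) -(lin_lift j _ e').
  by split; [apply: ge.2|apply: ge'.2|apply: se'.2].
have side c e' : List.In c cs1 -> ok e' ->
    [/\ r1 + 3 < `|e j - c (z e)|, r1 + 3 < `|e' j - c (z e')| &
     (c (z e) < e j) = (c (z e') < e' j)].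
  move=> Hc oke'; have [|m [b [Hm Hb H]]] := val c; first by apply/List.in_app_iff; left.
  have := ge.2 _ (In_top m Hm); have := oke'.1.2 _ (In_top m Hm).
  have := oke'.2.2 _ (In_top m Hm); rewrite !lin_top (H e oke) (H e' oke').
  set u := e j - _; set u' := e' j - _ => uu u'r ur.
  have -> : e j - (lin j m e + b) = u - b by rewrite /u; ring.
  have -> : e' j - (lin j m e' + b) = u' - b by rewrite /u'; ring.
  rewrite -[in X in _ = X]subr_gt0 -[in X in X = _]subr_gt0.
  have -> : e j - (lin j m e + b) = u - b by rewrite /u; ring.
  have -> : e' j - (lin j m e' + b) = u' - b by rewrite /u'; ring.
  have Hr : r1 + 3 + r_ + r_ <= r by rewrite /r; lra.
  have key (x : R) : r < `|x| -> r1 + 3 < `|x - b| /\ (0 < x - b) = (0 < x).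
    move=> Hx; have bb : - r_ <= b <= r_ by rewrite -ler_norml.
    case/andP: bb => b1 b2; have [x0|x0] := lerP 0 x.
      rewrite ger0_norm // in Hx; split; first by rewrite ger0_norm; lra.
      by apply/idP/idP => _; lra.
    rewrite ltr0_norm // in Hx; split; first by rewrite ltr0_norm; lra.
    by apply/idP/idP => ?; lra.
  by have [k1 ->] := key _ ur; have [k2 ->] := key _ u'r.
have cmp c c' e' : List.In c cs1 -> List.In c' cs1 -> ok e' -> c (z e) <= c' (z e) ->
    c (z e') <= c' (z e').
  move=> Hc Hc' oke'.
  have [|m [b [Hm Hb H]]] := val c; first by apply/List.in_app_iff; left.
  have [|m' [b' [Hm' Hb' H']]] := val c'; first by apply/List.in_app_iff; left.
  rewrite !H // !H' // => le.
  have /andP[b1 b2] : - r_ <= b <= r_ by rewrite -ler_norml.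
  have /andP[b'1 b'2] : - r_ <= b' <= r_ by rewrite -ler_norml.
  have [E|[d1 d2 d3]] := diff_sign m m' e' Hm Hm' oke'; first by move: le; rewrite !E; lra.
  have Hr : 2 * r_ <= r by rewrite /r; lra.
  have neg : lin j m e - lin j m' e <= 0.
    rewrite leNgt; apply/negP => pos; rewrite gtr0_norm // in d1; lra.
  have neg' : lin j m e' - lin j m' e' <= 0 by rewrite leNgt -d3 -leNgt.
  rewrite ler0_norm // in d2; lra.
(* The base point is next to the largest break point below [e j], or next to the smallest one if all
   are above. The choice made at [e] remains valid on the whole region. *)
have [g [gg Hg]] : exists g, List.In g gs /\ forall e', ok e' -> exists p q,
    [/\ forall c, List.In c cs -> ~ (p < c (z e') < q), r1 < q - p, p < e' j < q,
     p < g (z e') & g (z e') + 1 < q].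
  case: (pselect (exists c, List.In c cs1 /\ c (z e) < e j)) => Hlow.
    have [c [Hc ce Hmax]] := list_argmax (fun c => c (z e)) Hlow.
    exists (fun e => c e + 1); split.
      by apply/List.in_app_iff; left; apply/List.in_map_iff; exists c.
    move=> e' oke'; have [_ s1 s2] := side c e' Hc oke'.
    have ce' : c (z e') < e' j by rewrite -s2.
    rewrite gtr0_norm ?subr_gt0 // in s1.
    exists (c (z e')), (e' j + (r1 + 3)); split.
    - move=> c' Hc' /andP[l1 l2]; have Hc1' : List.In c' cs1 by right.
      have [_ t1 t2] := side c' e' Hc1' oke'.
      have [lt|ge'] := ltrP (c' (z e')) (e' j).
        have : c' (z e') <= c (z e') by apply: cmp => //; apply: Hmax => //; rewrite t2.
        by rewrite leNgt l1.
      by rewrite ler0_norm ?subr_le0 // in t1; lra.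
    - lra.
    - by apply/andP; split; lra.
    - lra.
    - lra.
  have Hhigh c : List.In c cs1 -> e j < c (z e).
    move=> Hc; have [s1 _ _] := side c e Hc oke.
    rewrite ltNge le_eqVlt; apply/negP => /orP[/eqP E|lt]; last by apply: Hlow; exists c.
    by move: s1; rewrite E subrr normr0; lra.
  have [|c [Hc _ Hmin]] := @list_argmax _ R cs1 (fun=> True) (fun c => - c (z e)).
    by exists (fun=> 0); split=> //; left.
  exists (fun e => c e - 2); split.
    by apply/List.in_app_iff; right; apply/List.in_map_iff; exists c.
  move=> e' oke'.
  have high' c' : List.In c' cs1 -> e' j + (r1 + 3) < c' (z e').
    move=> Hc'; have [_ s1 s2] := side c' e' Hc' oke'.
    have : ~~ (c' (z e') < e' j) by rewrite -s2 -leNgt ltW // Hhigh.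
    by rewrite -leNgt => H; rewrite ler0_norm ?subr_le0 // in s1; lra.
  have := high' c Hc; exists (e' j - (r1 + 3)), (c (z e')); split.
  - move=> c' Hc' /andP[_ l2]; have Hc1' : List.In c' cs1 by right.
    have : c (z e') <= c' (z e') by apply: cmp => //; have := Hmin c' Hc1' I; rewrite lerN2.
    by rewrite leNgt l2.
  - lra.
  - by apply/andP; split; lra.
  - lra.
  - lra.
have slope e' : ok e' -> exists2 l, List.In l Ls &
    f e' = f (upd e' j (g (z e'))) + l * (e' j - g (z e')) /\
    f (upd e' j (g (z e') + 1)) - f (upd e' j (g (z e'))) = l.
  move=> oke'; have [p [q [free len /andP[ep eq] gp gq]]] := Hg e' oke'.
  have [l [b [lLs Hl]]] := Haff (z e') p q free len.
  have {}Hl x : p < x < q -> f (upd e' j x) = l * x + b by move=> /Hl; rewrite /z upd_upd.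
  exists l; first exact: In_mem.
  rewrite -{1}(upd_id e' j) !Hl; [split; ring|apply/andP; split; lra..].
have [|mg [bg [Hmg Hbg Eg]]] := val g.
  by apply/List.in_app_iff; right; apply/List.in_app_iff; left.
have [|mh [bh [Hmh Hbh Eh]]] := val (fun e => f (upd e j (g e))).
  apply/List.in_app_iff; right; apply/List.in_app_iff; right; apply/List.in_app_iff; left.
  by apply/List.in_map_iff; exists g.
have [|ms [bs [Hms Hbs Es]]] := val (fun e => f (upd e j (g e + 1)) - f (upd e j (g e))).
  apply/List.in_app_iff; right; apply/List.in_app_iff; right; apply/List.in_app_iff; right.
  by apply/List.in_map_iff; exists g.
(* The slope is bounded by [B], as it belongs to [Ls]; its linear part would exceed [r] if it were
   nonzero, so it vanishes. *)
have const_slope e' : ok e' -> f (upd e' j (g (z e') + 1)) - f (upd e' j (g (z e'))) = bs.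
  move=> oke'; have := Es e' oke'; rewrite /z !upd_upd -!/(z _) => E.
  have [l lLs [_ El]] := slope e' oke'.
  have [E0|[_ d2 _]] := diff_sign ms (fun=> 0) e' Hms (or_introl erefl) oke'.
    by rewrite E E0 /lin big1 ?add0r // => i _; rewrite mul0r.
  have E0 : lin j (fun=> 0) e' = 0 by rewrite /lin big1 // => i _; rewrite mul0r.
  rewrite E0 subr0 in d2; have lB := HB l lLs; rewrite -El E in lB.
  have : `|lin j ms e'| <= `|lin j ms e' + bs| + `|bs|.
    by rewrite -{1}(addrK bs (lin j ms e')); apply: ler_normB.
  by move: d2; rewrite /r; lra.
have bsLs : List.In bs Ls.
  by have [l lLs [_ El]] := slope e oke; rewrite -(const_slope e oke) El.
exists (comb mh mg bs), (bh - bs * bg); split.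
- apply/List.in_flat_map; exists mh; split=> //; apply/List.in_flat_map; exists mg; split=> //.
  exact: List.in_map.
- apply: le_trans (ler_normB _ _) _; rewrite normrM.
  have : `|bs| * `|bg| <= B * r_ by apply: ler_pM => //; apply: HB.
  by rewrite /r; lra.
move=> e' ge' se'; have oke' : ok e' by [].
have [l _ [Ef El]] := slope e' oke'; rewrite (const_slope e' oke') in El.
have := Eh e' oke'; rewrite /z upd_upd -!/(z _) => Eh'.
by rewrite Ef Eh' Eg // lin_comb -El; ring.
Qed.

Theorem linear_regions j : regions_thm j.
Proof. by elim: j => [|j]; [apply: regions0|apply: regionsS]. Qed.

(* Apply the previous theorem to an indicator function: its linear parts are bounded,
   so they vanish once the nonzero ones are required to be large. *)
Theorem sign_regions j P r0 : D P -> exists F r, [/\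
  forall l, List.In l F -> scalar_form j l /\ nonzero_form j l, 0 <= r &
  forall e e', generic j F r r0 e -> generic j F r r0 e' -> same_region j F e e' -> P e -> P e'].
Proof.
move=> DP; have D1 : dfun D (fun e => if `[< P e >] then 1 else 0) by dtac.
have [F [M [r [HF HM r_0 H]]]] := linear_regions j r0 D1.
pose F' := (F ++ List.filter (fun l => `[< nonzero_form j l >]) M)%list.
exists F', (r + 1); split.
- move=> l /List.in_app_iff[/HF//|/List.filter_In[lM /asboolP nz]]; split=> //; exact: HM.
- lra.
have gF e : generic j F' (r + 1) r0 e -> generic j F r r0 e.
  move=> [g1 g2]; split=> // l Hl; have : r + 1 < `|lin j l e|; last lra.
  by apply: g2; apply/List.in_app_iff; left.
move=> e e' ge ge' [s1 s2] Pe.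
have [l [c [lM cr Hl]]] := H e (gF _ ge).
have se : same_region j F e e by [].
have se' : same_region j F e e'.
  by split=> // m Hm; apply: s2; apply/List.in_app_iff; left.
have E1 := Hl e (gF _ ge) se; have E2 := Hl e' (gF _ ge') se'.
have Hz e1 : generic j F' (r + 1) r0 e1 -> (if `[< P e1 >] then 1 else 0) = lin j l e1 + c ->
    lin j l e1 = 0.
  move=> g1 E; apply: lin_zero_form => nz.
  have : r + 1 < `|lin j l e1|.
    by apply: g1.2; apply/List.in_app_iff; right; apply/List.filter_In; split=> //; apply/asboolP.
  have : `|lin j l e1| <= `|lin j l e1 + c| + `|c|.
    by rewrite -{1}(addrK c (lin j l e1)); apply: ler_normB.
  by rewrite -E; case: asboolP => _; rewrite ?normr1 ?normr0; lra.
have Z1 := Hz e ge E1; have Z2 := Hz e' ge' E2; rewrite Z1 in E1; rewrite Z2 in E2.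
move: E1 E2; case: asboolP => // _ <-; case: asboolP => // _ /eqP.
by rewrite eq_sym oner_eq0.
Qed.

End GenericLinearity.

(** * Counting in k-free relations *)

Section Counting.
Variables (R : rcfType) (d1 d2 : nat).
Implicit Types (P Q : seq R -> seq R -> Prop) (B : seq (seq R)).

Definition cnt P B1 B2 := grid_count (fun x y => `[< P x y >]) B1 B2.

Lemma cntE P B1 B2 : cnt P B1 B2 = (\sum_(x <- B1) \sum_(y <- B2) `[< P x y >])%N.
Proof.
rewrite /cnt /grid_count; apply: eq_bigr => x _; rewrite -sum1_count big_mkcond /=.
by apply: eq_bigr => y _; case: asboolP.
Qed.

Lemma cnt_swap P B1 B2 : cnt P B1 B2 = cnt (fun y x => P x y) B2 B1.
Proof. by rewrite !cntE exchange_big. Qed.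

Lemma cnt_sub P Q B1 B2 : (forall x y, x \in B1 -> y \in B2 -> P x y -> Q x y) ->
  (cnt P B1 B2 <= cnt Q B1 B2)%N.
Proof.
move=> PQ; rewrite !cntE big_seq [leqRHS]big_seq; apply: leq_sum => x xB.
rewrite big_seq [leqRHS]big_seq; apply: leq_sum => y yB.
by case: asboolP => // /PQ H; case: asboolP => // nQ; case: nQ; apply: H.
Qed.

Lemma cnt_or P Q B1 B2 : (cnt (fun x y => P x y \/ Q x y) B1 B2 <= cnt P B1 B2 + cnt Q B1 B2)%N.
Proof.
rewrite !cntE -big_split; apply: leq_sum => x _; rewrite -big_split; apply: leq_sum => y _ /=.
case: asboolP => // -[HP|HQ]; first by case: asboolP.
by case: (asboolP (Q x y)) => // _; rewrite addn1.
Qed.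

Lemma cnt_functional P B1 B2 : uniq B2 ->
  (forall x y y', x \in B1 -> y \in B2 -> y' \in B2 -> P x y -> P x y' -> y = y') ->
  (cnt P B1 B2 <= size B1)%N.
Proof.
move=> u2 H; rewrite /cnt /grid_count -sum1_size big_seq [leqRHS]big_seq.
apply: leq_sum => x xB; rewrite -size_filter.
have : uniq [seq y <- B2 | `[< P x y >]] by apply: filter_uniq.
have : forall y, y \in [seq y <- B2 | `[< P x y >]] -> P x y /\ y \in B2.
  by move=> y; rewrite mem_filter => /andP[/asboolP].
case: [seq y <- B2 | _] => [|y [|y' s]] //= Hy; rewrite in_cons => /andP[/norP[/eqP yy _] _].
have [p1 b1] := Hy y (mem_head _ _); have [|p2 b2] := Hy y'; first by rewrite !in_cons eqxx orbT.
by case: yy; apply: (H x).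
Qed.

Definition linear_count P := exists (N : nat) (m : R), 0 <= m /\
  forall n B1 B2, is_grid d1 d2 n B1 B2 -> m_distant m B1 -> m_distant m B2 ->
  (cnt P B1 B2 <= N * n)%N.

Lemma m_distant_le (m m' : R) B : m <= m' -> m_distant m' B -> m_distant m B.
Proof. by move=> mm H x y xB yB xy; apply: le_lt_trans mm (H _ _ xB yB xy). Qed.

Lemma linear_count_or P Q : linear_count P -> linear_count Q ->
  linear_count (fun x y => P x y \/ Q x y).
Proof.
move=> [N1 [m1 [m10 H1]]] [N2 [m2 [m20 H2]]]; exists (N1 + N2)%N, (Num.max m1 m2).
split; first by rewrite le_max m10.
move=> n B1 B2 gB D1 D2; apply: leq_trans (cnt_or _ _ _ _) _; rewrite mulnDl leq_add //.
  by apply: H1 => //; [apply: m_distant_le D1|apply: m_distant_le D2]; rewrite le_max lexx.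
by apply: H2 => //; [apply: m_distant_le D1|apply: m_distant_le D2]; rewrite le_max lexx orbT.
Qed.

Lemma linear_count_sub P Q : (forall x y, size x = d1 -> size y = d2 -> P x y -> Q x y) ->
  linear_count Q -> linear_count P.
Proof.
move=> PQ [N [m [m0 H]]]; exists N, m; split=> // n B1 B2 gB D1 D2.
apply: leq_trans (H n B1 B2 gB D1 D2); apply: cnt_sub => x y xB yB; apply: PQ.
  by case: gB => _ _ _ _ /andP[/allP /(_ x xB) /eqP].
by case: gB => _ _ _ _ /andP[_ /allP /(_ y yB) /eqP].
Qed.

Lemma dist_le (d : nat) (m : R) (x y : seq R) : 0 <= m -> size x = d -> size y = d ->
  (forall k, (k < d)%N -> `|nth 0 x k - nth 0 y k| <= m) -> dist x y <= m.
Proof.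
move=> m0; elim: d x y => [|d IH] [|a x] [|b y] // [sx] [sy] H.
rewrite /dist /= ge_max (H 0%N isT) /=; apply: IH => // k Hk; exact: (H k.+1 Hk).
Qed.

(** A fibre of bounded diameter contains at most one point of a sufficiently distant set, so in one
    direction the relation is a partial function on the grid. *)
Lemma linear_count_fibres P (m : R) : 0 <= m ->
  (forall x y y', size x = d1 -> size y = d2 -> size y' = d2 -> P x y -> P x y' ->
     forall k, (k < d2)%N -> `|nth 0 y k - nth 0 y' k| <= m) \/
  (forall x x' y, size x = d1 -> size x' = d1 -> size y = d2 -> P x y -> P x' y ->
     forall k, (k < d1)%N -> `|nth 0 x k - nth 0 x' k| <= m) ->
  linear_count P.
Proof.
move=> m0 H; exists 1%N, m; split=> // n B1 B2 [u1 u2 n1 n2 /andP[/allP s1 /allP s2]] D1 D2.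
rewrite mul1n; have {}s1 x : x \in B1 -> size x = d1 by move/s1/eqP.
have {}s2 x : x \in B2 -> size x = d2 by move/s2/eqP.
case: H => H.
  rewrite -n1; apply: cnt_functional => // x y y' xB yB y'B Py Py'.
  apply/eqP; apply: contrapT => /negP ne; have := D2 _ _ yB y'B ne.
  rewrite ltNge => /negP; apply; apply: dist_le; rewrite ?(s2 y) ?(s2 y') //.
  by apply: (H x) => //; [apply: s1|apply: s2|apply: s2].
rewrite -n2 cnt_swap; apply: cnt_functional => // y x x' yB xB x'B Px Px'.
apply/eqP; apply: contrapT => /negP ne; have := D1 _ _ xB x'B ne.
rewrite ltNge => /negP; apply; apply: dist_le; rewrite ?(s1 x) ?(s1 x') //.
by apply: (H x x' y) => //; [apply: s1|apply: s1|apply: s2].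
Qed.

End Counting.

(** * The linear bound for relations without large grids *)

Section UpperBound.
Variables (R : rcfType) (D : dclass R).
Hypothesis DO : forall P, D P -> field_class R P.
Hypothesis nomul : ~ has_mul D.
Variables (d1 d2 : nat) (E : seq R -> seq R -> bool) (k : nat).
Hypothesis DE : D (fun e => E (mkseq e d1) (mkseq (fun i => e (d1 + i)%N) d2)).
Hypothesis kfree : k_free d1 d2 k E.
Implicit Types (A : nat -> nat -> R) (w : nat -> R).

(* [A] is a linear map into the product space: the form [A i] gives the [i]-th coordinate,
   those of the second factor coming after the [d1] of the first. *)
Definition near_image j A (r0 : R) w (x y : seq R) :=
  (forall i, (i < d1)%N -> `|nth 0 x i - lin j (A i) w| <= r0) /\
  (forall i, (i < d2)%N -> `|nth 0 y i - lin j (A (d1 + i)%N) w| <= r0).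

Lemma lin_subr j l w w' : lin j l (fun i => w i - w' i) = lin j l w - lin j l w'.
Proof. by rewrite /lin -sumrB; apply: eq_bigr => i _; rewrite mulrBr. Qed.

Lemma lin_addr j l w w' : lin j l (fun i => w i + w' i) = lin j l w + lin j l w'.
Proof. by rewrite /lin -big_split; apply: eq_bigr => i _; rewrite mulrDr. Qed.

Lemma lin_scaler j l (a : R) w : lin j l (fun i => a * w i) = a * lin j l w.
Proof. by rewrite /lin mulr_sumr; apply: eq_bigr => i _; rewrite mulrCA. Qed.

(** The inclusion of kernels lets the matrix of [X] factor through that of [Y]; [K] is the sum of
    the absolute values of the entries of the factor. *)
Lemma dependent_bound j p q (X Y : nat -> nat -> R) :
  (forall w, (forall i, (i < q)%N -> lin j (Y i) w = 0) ->
     forall i, (i < p)%N -> lin j (X i) w = 0) ->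
  exists2 K, 0 <= K & forall w (s : R), 0 <= s -> (forall i, (i < q)%N -> `|lin j (Y i) w| <= s) ->
     forall i, (i < p)%N -> `|lin j (X i) w| <= K * s.
Proof.
move=> H.
pose MX : 'M[R]_(j, p) := \matrix_(i, c) X c i.
pose MY : 'M[R]_(j, q) := \matrix_(i, c) Y c i.
have linX w (c : 'I_p) : lin j (X c) w = ((\row_i w (nat_of_ord i)) *m MX) 0 c.
  by rewrite mxE; apply: eq_bigr => i _; rewrite !mxE mulrC.
have linY w (c : 'I_q) : lin j (Y c) w = ((\row_i w (nat_of_ord i)) *m MY) 0 c.
  by rewrite mxE; apply: eq_bigr => i _; rewrite !mxE mulrC.
have ker (v : 'rV[R]_j) : v *m MY = 0 -> v *m MX = 0.
  move=> v0; pose w (i : nat) := if insub i is Some o then v 0 o else 0.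
  have Ev : \row_(i < j) w (nat_of_ord i) = v.
    by apply/rowP => i; rewrite mxE /w insubT //= => Hi; congr (v 0 _); apply: val_inj.
  apply/rowP => c; rewrite -Ev -linX mxE; apply: (H w) => // i Hi.
  by rewrite (linY w (Ordinal Hi)) Ev v0 mxE.
pose Z := pinvmx MY *m MX.
have EX : MX = MY *m Z.
  apply/eqP; rewrite -subr_eq0; apply/eqP/row_matrixP => i.
  rewrite row0 /Z mulmxA -[X in X - _]mul1mx -mulmxBl row_mul; apply: ker.
  by rewrite -row_mul mulmxBl mul1mx mulmxKpV // subrr row0.
exists (\sum_(a < q) \sum_(c < p) `|Z a c|).
  by apply: sumr_ge0 => a _; apply: sumr_ge0.
move=> w s s0 Hs i Hi; rewrite (linX w (Ordinal Hi)) EX mulmxA mxE.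
apply: le_trans (ler_norm_sum _ _ _) _; rewrite mulr_suml; apply: ler_sum => a _.
rewrite normrM mulrC -linY; apply: ler_pM => //; last exact: Hs.
by rewrite (bigD1 (Ordinal Hi)) //= lerDl sumr_ge0.
Qed.

(** The two conditions say that the image of [A] contains no horizontal, respectively no vertical
    direction. One component of a point then determines the other up to a bounded error. *)
Lemma near_image_count j A r0 : 0 <= r0 ->
  (forall w, (forall i, (i < d2)%N -> lin j (A (d1 + i)%N) w = 0) ->
     forall i, (i < d1)%N -> lin j (A i) w = 0) \/
  (forall w, (forall i, (i < d1)%N -> lin j (A i) w = 0) ->
     forall i, (i < d2)%N -> lin j (A (d1 + i)%N) w = 0) ->
  linear_count d1 d2 (fun x y => E x y /\ exists w, near_image j A r0 w x y).
Proof.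
move=> r00 [] /dependent_bound[K K0 HK].
  apply: (@linear_count_fibres _ _ _ _ (2 * r0 + K * (2 * r0))).
    by have := mulr_ge0 K0 r00; lra.
  right=> x x' y sx sx' sy [_ [w [wx wy]]] [_ [w' [w'x w'y]]] i Hi.
  have : `|lin j (A i) (fun i => w i - w' i)| <= K * (2 * r0).
    apply: HK Hi; first lra.
    move=> t Ht; rewrite lin_subr; have := wy t Ht; have := w'y t Ht.
    rewrite !ler_norml => /andP[? ?] /andP[? ?]; apply/andP; split; lra.
  rewrite lin_subr; have := wx i Hi; have := w'x i Hi.
  rewrite !ler_norml => /andP[? ?] /andP[? ?] /andP[? ?]; apply/andP; split; lra.
apply: (@linear_count_fibres _ _ _ _ (2 * r0 + K * (2 * r0))).
  by have := mulr_ge0 K0 r00; lra.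
left=> x y y' sx sy sy' [_ [w [wx wy]]] [_ [w' [w'x w'y]]] i Hi.
have : `|lin j (A (d1 + i)%N) (fun i => w i - w' i)| <= K * (2 * r0).
  apply: (HK _ _ _ _ i Hi); first lra.
  move=> t Ht; rewrite lin_subr; have := wx t Ht; have := w'x t Ht.
  rewrite !ler_norml => /andP[? ?] /andP[? ?]; apply/andP; split; lra.
rewrite lin_subr; have := wy i Hi; have := w'y i Hi.
rewrite !ler_norml => /andP[? ?] /andP[? ?] /andP[? ?]; apply/andP; split; lra.
Qed.

Lemma dfun_lin j l (s : (nat -> R) -> nat -> R) : scalar_form D j l ->
  (forall i, dfun D (fun e => s e i)) -> dfun D (fun e => lin j l (s e)).
Proof.
move=> sl Ds; elim: j sl => [|j IH] sl.
  by apply: dfun_ext (dfun_cst D 0) => e; rewrite /lin big_ord0.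
have D1 : dfun D (fun e => l j * s e j) by apply: (dfun1_app (sl j (ltnSn j))).
apply: dfun_ext (dfun_add (IH (fun i Hi => sl i (ltnW Hi))) D1) => e.
by rewrite lin_recr.
Qed.

(* If the image of [A] contains a horizontal and a vertical direction, then a generic
   point of [E] near it spans a grid in [E]. *)
Lemma near_image_slabs j A r0 w1 w2 :
  (forall i, scalar_form D j (A i)) -> 0 <= r0 ->
  (forall i, (i < d2)%N -> lin j (A (d1 + i)%N) w1 = 0) ->
  (exists2 i, (i < d1)%N & lin j (A i) w1 != 0) ->
  (forall i, (i < d1)%N -> lin j (A i) w2 = 0) ->
  (exists2 i, (i < d2)%N & lin j (A (d1 + i)%N) w2 != 0) ->
  exists F r, [/\ forall l, List.In l F -> scalar_form D j l /\ nonzero_form j l, 0 <= r &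
   forall x y w, size x = d1 -> size y = d2 -> E x y -> near_image j A r0 w x y ->
   exists2 l, List.In l F & `|lin j l w| <= r].
Proof.
move=> sA r00 y1 [i1 Hi1 x1] x2 [i2 Hi2 y2].
(* The coordinates below [j] parametrize the image, and those from [j] on hold the bounded error. *)
pose T (e : nat -> R) i := lin j (A i) e + e (j + i)%N.
have DT : D (fun e => E (mkseq (T e) d1) (mkseq (fun i => T e (d1 + i)%N) d2)).
  apply: (dset_app (s := T) DE) => i; apply: dfun_add; last by dtac.
  by apply: (@dfun_lin j (A i) id) => //; dtac.
have [F [r [HF r_0 Hreg]]] := sign_regions DO nomul j r0 DT.
exists F, r; split=> // x y w sx sy Exy [nx ny].
apply: contrapT => Hno.
have big l : List.In l F -> r < `|lin j l w|.
  by move=> Hl; rewrite ltNge; apply/negP => H; apply: Hno; exists l.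
pose b i := if (i < d1)%N then nth 0 x i - lin j (A i) w else
   if (i < d1 + d2)%N then nth 0 y (i - d1) - lin j (A i) w else 0.
have bB i : `|b i| <= r0.
  rewrite /b; case: ltnP => [/nx//|d1i]; case: ltnP => [id|_]; last by rewrite normr0.
  by have := ny (i - d1)%N; rewrite subnKC // ltn_subLR //; apply.
pose ee (s t : R) i := if (i < j)%N then w i + s * w1 i + t * w2 i else b (i - j)%N.
have lin_ee l s t : lin j l (ee s t) = lin j l w + s * lin j l w1 + t * lin j l w2.
  rewrite -!lin_scaler -!lin_addr; apply: eq_lin => // i Hi; by rewrite /ee Hi.
have T_ee s t i : T (ee s t) i = lin j (A i) w + s * lin j (A i) w1 + t * lin j (A i) w2 + b i.
  by rewrite /T lin_ee /ee ltnNge leq_addr /= addKn.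
(* A step so small that moving by [s * w1 + t * w2], with [s] and [t] between 0 and [d], keeps every
   form of [F] beyond [r] and preserves its sign. *)
have [d d0 Hd] : exists2 d, 0 < d & forall l, List.In l F ->
    r + d * (`|lin j l w1| + `|lin j l w2|) < `|lin j l w|.
  elim: (F) big => [|l F' IH] big'; first by exists 1.
  have [|d d0 Hd] := IH; first by move=> l' Hl'; apply: big'; right.
  have rl := big' l (or_introl erefl).
  pose q := (`|lin j l w| - r) / (`|lin j l w1| + `|lin j l w2| + 1).
  have S0 : 0 <= `|lin j l w1| + `|lin j l w2| by rewrite addr_ge0.
  have S1 : 0 < `|lin j l w1| + `|lin j l w2| + 1 by lra.
  have q0 : 0 < q by rewrite divr_gt0 // subr_gt0.
  have m0 : 0 < Num.min d q by rewrite lt_min d0.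
  exists (Num.min d q) => // l' [<-|Hl'].
    have : Num.min d q <= q by rewrite ge_min lexx orbT.
    rewrite {2}/q ler_pdivlMr //; set mm := Num.min d q in m0 *; rewrite mulrDr; lra.
  apply: le_lt_trans (Hd l' Hl'); rewrite lerD2l ler_wpM2r ?addr_ge0 //.
  by rewrite ge_min lexx.
have close l s t : List.In l F -> 0 <= s <= d -> 0 <= t <= d ->
    r < `|lin j l (ee s t)| /\ (0 < lin j l w) = (0 < lin j l (ee s t)).
  move=> Hl /andP[s0 sd] /andP[t0 td]; have := Hd l Hl; rewrite lin_ee mulrDr.
  set u := lin j l w; set u1 := lin j l w1; set u2 := lin j l w2 => H.
  have /andP[a1 a2] : - (d * `|u1|) <= s * u1 <= d * `|u1|.
    by rewrite -ler_norml normrM ger0_norm // ler_wpM2r.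
  have /andP[c1 c2] : - (d * `|u2|) <= t * u2 <= d * `|u2|.
    by rewrite -ler_norml normrM ger0_norm // ler_wpM2r.
  have b1 : 0 <= d * `|u1| by rewrite mulr_ge0 // ltW.
  have b2 : 0 <= d * `|u2| by rewrite mulr_ge0 // ltW.
  have [u0|u0] := lerP 0 u.
    rewrite (ger0_norm u0) in H; split; first by rewrite ger0_norm; lra.
    by apply/idP/idP => _; lra.
  rewrite (ltr0_norm u0) in H; split; first by rewrite ltr0_norm; lra.
  by apply/idP/idP => ?; lra.
have gen s t : 0 <= s <= d -> 0 <= t <= d -> generic j F r r0 (ee s t).
  move=> Hs Ht; split=> [i ji|l Hl]; last by have [] := close l s t Hl Hs Ht.
  by rewrite /ee ltnNge ji /=; apply: bB.
have H0 : 0 <= (0 : R) <= d by rewrite lexx ltW.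
have inE s t : 0 <= s <= d -> 0 <= t <= d ->
    E (mkseq (T (ee s t)) d1) (mkseq (fun i => T (ee s t) (d1 + i)%N) d2).
  move=> Hs Ht; apply: (Hreg (ee 0 0) (ee s t)); [exact: gen|exact: gen| |].
    split=> [i ji|l Hl]; first by rewrite /ee ltnNge ji.
    by have [_ <-] := close l 0 0 Hl H0 H0; have [_ <-] := close l s t Hl Hs Ht.
  have -> : mkseq (T (ee 0 0)) d1 = x.
    apply: (@eq_from_nth _ 0); rewrite size_mkseq ?sx // => i Hi.
    by rewrite nth_mkseq // T_ee /b Hi !mul0r !addr0; ring.
  have -> // : mkseq (fun i => T (ee 0 0) (d1 + i)%N) d2 = y.
  apply: (@eq_from_nth _ 0); rewrite size_mkseq ?sy // => i Hi.
  rewrite nth_mkseq // T_ee /b ltnNge leq_addr /= ltn_add2l Hi addKn !mul0r !addr0; ring.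
(* Distinct parameters between 0 and [d]. Moving along [w1] changes only the first component and
   moving along [w2] only the second, so the points obtained form a grid. *)
pose st (i : nat) : R := d / i.+1%:R.
have stB i : 0 <= st i <= d.
  have i0 : 0 < i.+1%:R :> R by rewrite ltr0n.
  apply/andP; split; first by rewrite divr_ge0 // ltW.
  by rewrite ler_pdivrMr // ler_peMr ?ler1n // ltW.
have st_inj : injective st.
  move=> a c /(mulfI (lt0r_neq0 d0)) /invr_inj /eqP; rewrite eqr_nat => /eqP []//.
apply: kfree.
exists [seq mkseq (T (ee (st i) 0)) d1 | i <- iota 0 k],
  [seq mkseq (fun c => T (ee 0 (st i)) (d1 + c)%N) d2 | i <- iota 0 k]; split.
  split; rewrite ?size_map ?size_iota //.
  - rewrite map_inj_uniq ?iota_uniq // => a c /(congr1 (fun s => nth 0 s i1)).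
    rewrite !nth_mkseq // !T_ee !mul0r !addr0 => /addIr /addrI /(mulIf x1); exact: st_inj.
  - rewrite map_inj_uniq ?iota_uniq // => a c /(congr1 (fun s => nth 0 s i2)).
    rewrite !nth_mkseq // !T_ee !mul0r !addr0 => /addIr /addrI /(mulIf y2); exact: st_inj.
  - by apply/andP; split; apply/allP => ? /mapP[? _ ->]; rewrite size_mkseq.
move=> ? ? /mapP[a _ ->] /mapP[c _ ->].
have := inE (st a) (st c) (stB a) (stB c).
have -> : mkseq (T (ee (st a) (st c))) d1 = mkseq (T (ee (st a) 0)) d1.
  apply: (@eq_from_nth _ 0); rewrite !size_mkseq // => i Hi.
  by rewrite !nth_mkseq // !T_ee x2 // !mulr0.
have -> // : mkseq (fun i => T (ee (st a) (st c)) (d1 + i)%N) d2 =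
             mkseq (fun i => T (ee 0 (st c)) (d1 + i)%N) d2.
apply: (@eq_from_nth _ 0); rewrite !size_mkseq // => i Hi.
by rewrite !nth_mkseq // !T_ee y1 // !mulr0.
Qed.

(* A slab [|l w| <= r] is eliminated by solving for a variable with nonzero coefficient. *)
Lemma slab_elimination j A r0 l (r : R) : (forall i, scalar_form D j.+1 (A i)) ->
  scalar_form D j.+1 l -> nonzero_form j.+1 l -> 0 <= r0 -> 0 <= r ->
  exists A' r0', [/\ forall i, scalar_form D j (A' i), 0 <= r0' & forall x y w,
    near_image j.+1 A r0 w x y -> `|lin j.+1 l w| <= r ->
    exists w', near_image j A' r0' w' x y].
Proof.
move=> sA sl [p Hp lp] r00 r_0; pose o := Ordinal Hp.
(* The variable [w p] is expressed by [lin j.+1 l w] and the other variables, which [bump p]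
   enumerates by skipping [p]. Dropping the slab value from the forms costs an error of at most
   [C * r]. *)
pose A' i c := A i (bump p c) - A i p * (l p)^-1 * l (bump p c).
have bumpj c : (c < j)%N -> (bump p c < j.+1)%N.
  by move=> Hc; rewrite /bump ltnS; case: (p <= c)%N; rewrite // add0n ltnW.
have [C C0 HC] : exists2 C, 0 <= C & forall i, (i < d1 + d2)%N -> `|A i p / l p| <= C.
  elim: (d1 + d2)%N => [|n [C C0 HC]]; first by exists 0.
  exists (Num.max C `|A n p / l p|); first by rewrite le_max C0.
  move=> i; rewrite ltnS leq_eqVlt => /orP[/eqP->|/HC H]; rewrite le_max ?lexx ?orbT //.
  by rewrite H.
have linE a w : lin j.+1 a w = a p * w p + lin j (fun c => a (bump p c)) (fun c => w (bump p c)).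
  by rewrite /lin (bigD1_ord o) //=.
have linA i w : lin j.+1 (A i) w = lin j (A' i) (fun c => w (bump p c)) + A i p / l p * lin j.+1 l w.
  rewrite /A' lin_sub lin_scale !linE; field; exact: lp.
exists A', (r0 + C * r); split.
- move=> i c Hc; rewrite /A'; apply: dscalarD; first by apply: sA; apply: bumpj.
  apply/dscalarN/dscalarM; last by apply: sl; apply: bumpj.
  by apply: dscalarM; [apply: sA|apply/dscalarV/sl].
- by rewrite addr_ge0 // mulr_ge0.
move=> x y w [nx ny] lr; exists (fun c => w (bump p c)).
have err i : (i < d1 + d2)%N -> `|A i p / l p * lin j.+1 l w| <= C * r.
  by move=> Hi; rewrite normrM; apply: ler_pM => //; apply: HC.
split=> i Hi.
  have := nx i Hi; have := err i (ltn_addr _ Hi); rewrite linA !ler_norml.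
  by move=> /andP[? ?] /andP[? ?]; apply/andP; split; lra.
have Hi' : (d1 + i < d1 + d2)%N by rewrite ltn_add2l.
have := ny i Hi; have := err _ Hi'; rewrite linA !ler_norml.
by move=> /andP[? ?] /andP[? ?]; apply/andP; split; lra.
Qed.

Lemma near_image_linear_count j A r0 : (forall i, scalar_form D j (A i)) -> 0 <= r0 ->
  linear_count d1 d2 (fun x y => E x y /\ exists w, near_image j A r0 w x y).
Proof.
elim: j A r0 => [|j IH] A r0 sA r00.
  by apply: near_image_count => //; left=> w _ i _; rewrite /lin big_ord0.
case: (pselect (forall w, (forall i, (i < d2)%N -> lin j.+1 (A (d1 + i)%N) w = 0) ->
     forall i, (i < d1)%N -> lin j.+1 (A i) w = 0)) => [H|nX].
  by apply: near_image_count => //; left.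
case: (pselect (forall w, (forall i, (i < d1)%N -> lin j.+1 (A i) w = 0) ->
     forall i, (i < d2)%N -> lin j.+1 (A (d1 + i)%N) w = 0)) => [H|nY].
  by apply: near_image_count => //; right.
have [w1 [y1 x1]] : exists w, (forall i, (i < d2)%N -> lin j.+1 (A (d1 + i)%N) w = 0) /\
    exists2 i, (i < d1)%N & lin j.+1 (A i) w != 0.
  apply: contrapT => Hno; apply: nX => w Hw i Hi; apply/eqP; apply: contrapT => /negP ne.
  by apply: Hno; exists w; split=> //; exists i.
have [w2 [x2 y2]] : exists w, (forall i, (i < d1)%N -> lin j.+1 (A i) w = 0) /\
    exists2 i, (i < d2)%N & lin j.+1 (A (d1 + i)%N) w != 0.
  apply: contrapT => Hno; apply: nY => w Hw i Hi; apply/eqP; apply: contrapT => /negP ne.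
  by apply: Hno; exists w; split=> //; exists i.
have [F [r [HF r_0 HE]]] := near_image_slabs sA r00 y1 x1 x2 y2.
apply: (@linear_count_sub _ _ _ _ (fun x y => E x y /\
   exists w, near_image j.+1 A r0 w x y /\ exists2 l, List.In l F & `|lin j.+1 l w| <= r)).
  move=> x y sx sy [Exy [w nw]]; split=> //; exists w; split=> //.
  exact: HE nw.
(* The slabs are treated one at a time; each lies near the image of a map with one parameter
   fewer. *)
elim: F HF {HE} => [|l F IHF] HF.
  by exists 0%N, 0; split=> // n B1 B2 _ _ _; rewrite cntE big1 // => x _; rewrite big1 // => y _;
    case: asboolP => // -[_ [w [_ []]]].
have [sl nl] := HF l (or_introl erefl).
have [A' [r0' [sA' r0'0 HA']]] := slab_elimination sA sl nl r00 r_0.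
have /IHF H2 : forall l, List.In l F -> scalar_form D j.+1 l /\ nonzero_form j.+1 l.
  by move=> l' Hl'; apply: HF; right.
apply: linear_count_sub (linear_count_or (IH A' r0' sA' r0'0) H2).
move=> x y _ _ [Exy [w [nw [l' [<-|Hl'] lr]]]].
  by left; split=> //; apply: HA' nw lr.
by right; split=> //; exists w; split=> //; exists l'.
Qed.

Theorem kfree_linear_count : linear_count d1 d2 (fun x y => E x y).
Proof.
(* The descent starts with the identity map and error 0, for which every point is near the image. *)
pose A (i c : nat) : R := (i == c)%:R.
have sA i : scalar_form D (d1 + d2) (A i).
  by move=> c _; rewrite /A; case: eqP => _; [apply: dscalar1|apply: dscalar0].
apply: linear_count_sub (near_image_linear_count sA (lexx 0)) => x y sx sy Exy; split=> //.
have linA i w : (i < d1 + d2)%N -> lin (d1 + d2) (A i) w = w i.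
  move=> Hi; rewrite /lin (bigD1 (Ordinal Hi)) //= /A eqxx mul1r big1 ?addr0 // => c ne.
  by rewrite eq_sym (negbTE (ne : (c : nat) != i)) mul0r.
exists (nth 0 (x ++ y)); split=> i Hi.
  by rewrite linA ?ltn_addr // nth_cat sx Hi subrr normr0.
by rewrite linA ?ltn_add2l // nth_cat sx ltnNge leq_addr /= addKn subrr normr0.
Qed.

End UpperBound.

(** * Point-line incidences *)

Module PowerBounds.
Import Stdlib.Reals.Reals Stdlib.micromega.Lra.
Local Open Scope R_scope.

Lemma Rpower_ge_base (n : nat) (b : R) : 1 <= b -> INR n <= Rpower (INR n) b.
Proof.
(* [Rpower] is an exponential by definition, hence positive, which settles [n = 0]. *)
move=> b1; case: n => [|n]; first by rewrite /=; apply/Rlt_le/exp_pos.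
have n1 : 1 <= INR n.+1 by rewrite S_INR; have := pos_INR n; Lra.lra.
rewrite -{1}(Rpower_1 (INR n.+1)); last Lra.lra.
exact: Rle_Rpower.
Qed.

Lemma linear_le_power (N n c : nat) (b : R) : 1 <= b -> (c <= N * n)%coq_nat ->
  INR c <= (INR N + 1) * Rpower (INR n) b.
Proof.
move=> b1 /le_INR; rewrite mult_INR => H; apply: Rle_trans H _.
have N0 := pos_INR N; have n0 := pos_INR n; have := Rpower_ge_base n b1.
by move=> H; apply: Rmult_le_compat => //; Lra.lra.
Qed.

Lemma power_lt_four_thirds (a b : R) : 0 < a -> b < INR 4 / INR 3 ->
  exists N : nat, (0 < N)%coq_nat /\
    a * Rpower (INR (4 * (N * N * N))%coq_nat) b < INR (4 * (N * N * N) * N)%coq_nat.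
Proof.
move=> a0 b43; have {}b43 : 0 < 4 - 3 * b by move: b43; rewrite /=; Lra.lra.
have [q Eq] : exists q, q = 4 by exists 4.
(* After taking logarithms the claim reads [ln a + b ln 4 + 3 b ln N < ln 4 + 4 ln N]. As [ln 4] and
   [4 - 3 b] are positive, [ln N > K] is enough. *)
pose K := (ln a + b * ln q) / (4 - 3 * b).
have [N HN] := INR_unbounded (exp K).
have eK := exp_pos K.
have N0 : 0 < INR N by Lra.lra.
exists N; split; first exact/INR_lt.
have lnN : K < ln (INR N) by rewrite -(ln_exp K); apply: ln_increasing.
rewrite !mult_INR; have -> : INR 4 = q by rewrite Eq /=; Lra.lra.
have NNN : 0 < INR N * INR N * INR N by do 2 (apply: Rmult_lt_0_compat => //).
have q1 : 1 < q by Lra.lra.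
clear Eq.
have l1 : 0 < a * Rpower (q * (INR N * INR N * INR N)) b.
  by apply: Rmult_lt_0_compat => //; apply: exp_pos.
apply: ln_lt_inv => //; first by do 2 (apply: Rmult_lt_0_compat => //); Lra.lra.
rewrite ln_mult //; last exact: exp_pos.
rewrite /Rpower ln_exp !ln_mult //; try Lra.lra; try by apply: Rmult_lt_0_compat.
- have : K * (4 - 3 * b) < ln (INR N) * (4 - 3 * b) by apply: Rmult_lt_compat_r.
  rewrite /K /Rdiv Rmult_assoc Rinv_l; last Lra.lra.
  have : 0 < ln q by rewrite -ln_1; apply: ln_increasing; Lra.lra.
  Lra.lra.
- by apply: Rmult_lt_0_compat => //; Lra.lra.
Qed.

End PowerBounds.


Section Incidences.
Variable R : rcfType.

Definition incident (l p : seq R) : bool :=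
  nth 0 p 1 == nth 0 l 0 * nth 0 p 0 + nth 0 l 1.

Lemma incident_2free : k_free 2 2 2 incident.
Proof.
move=> [B1 [B2 [[u1 u2 s1 s2 /andP[a1 a2]] H]]].
case: B1 u1 s1 a1 H => [|l1 [|l2 [|? ?]]] //= u1 _ /and3P[]; case: B2 u2 s2 a2 => [|p1 [|p2 [|? ?]]] //=.
move=> u2 _ /and3P[].
case: p1 u2 => [|x1 [|y1 [|? ?]]] // u2 _; case: p2 u2 => [|x2 [|y2 [|? ?]]] // u2 _ _.
case: l1 u1 => [|c1 [|b1 [|? ?]]] // u1 _; case: l2 u1 => [|c2 [|b2 [|? ?]]] // u1 _ _ H.
have I l p : l \in [:: [:: c1; b1]; [:: c2; b2]] -> p \in [:: [:: x1; y1]; [:: x2; y2]] ->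
  incident l p by apply: H.
have mem2nd (T : eqType) (u v : T) : v \in [:: u; v] by rewrite !inE eqxx orbT.
have /eqP /= e11 := I [:: c1; b1] [:: x1; y1] (mem_head _ _) (mem_head _ _).
have /eqP /= e12 := I [:: c1; b1] [:: x2; y2] (mem_head _ _) (mem2nd _ _ _).
have /eqP /= e21 := I [:: c2; b2] [:: x1; y1] (mem2nd _ _ _) (mem_head _ _).
have /eqP /= e22 := I [:: c2; b2] [:: x2; y2] (mem2nd _ _ _) (mem2nd _ _ _).
have /eqP : (c1 - c2) * (x1 - x2) = 0.
  have -> : (c1 - c2) * (x1 - x2) = (c1 * x1 + b1) - (c2 * x1 + b2) - ((c1 * x2 + b1) - (c2 * x2 + b2)).
    by ring.
  by rewrite -e11 -e12 -e21 -e22; ring.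
rewrite mulf_eq0 !subr_eq0 => /orP[/eqP Ec|/eqP Ex].
  have Eb : b1 = b2 by apply: (addrI (c2 * x1)); rewrite -e21 e11 Ec.
  by move: u1; rewrite Ec Eb inE eqxx.
have Ey : y1 = y2 by rewrite e11 e12 Ex.
by move: u2; rewrite Ex Ey inE eqxx.
Qed.

(** The second coordinate is dilated by the square of the factor of the first, so that slope times
    abscissa has the scale of the ordinates and incidences of integer points and lines are
    preserved. *)
Definition scaled_grid (c : R) (a b : nat) : seq (seq R) :=
  [seq [:: c * i%:R; c ^+ 2 * j%:R] | i <- iota 0 a, j <- iota 0 b].

Lemma natr_dist (i j : nat) : i != j -> 1 <= `|i%:R - j%:R : R|.
Proof.
rewrite neq_ltn => /orP[ij|ij]; [rewrite distrC|]; rewrite -natrB ?(ltnW ij) // normr_nat ler1n.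
  by rewrite subn_gt0.
by rewrite subn_gt0.
Qed.

Lemma scaled_grid_inj (c : R) : 0 < c ->
  injective (fun q : nat * nat => [:: c * q.1%:R; c ^+ 2 * q.2%:R]).
Proof.
move=> c0 [i j] [i' j'] /= []; have cn : c != 0 by rewrite gt_eqF.
move=> /(mulfI cn)/eqP; rewrite eqr_nat => /eqP ->.
by move=> /(mulfI (expf_neq0 2 cn))/eqP; rewrite eqr_nat => /eqP ->.
Qed.

Lemma scaled_grid_uniq (c : R) a b : 0 < c -> uniq (scaled_grid c a b).
Proof.
move=> c0; apply: allpairs_uniq; rewrite ?iota_uniq // => -[i j] [i' j'] _ _ /= E.
exact: (scaled_grid_inj c0 (x1 := (i, j)) (x2 := (i', j')) E).
Qed.

(** Since [m + 1 >= 1], its square is at least [m + 1] too, and both dilations move distinct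
    integers more than [m] apart. *)
Lemma scaled_grid_distant (m : R) a b : 0 <= m -> m_distant m (scaled_grid (m + 1) a b).
Proof.
move=> m0 x y /allpairsP[[i j] /= [_ _ ->]] /allpairsP[[i' j'] /= [_ _ ->]] ne.
have c1 : 1 <= m + 1 by lra.
have c0 : 0 <= m + 1 by lra.
rewrite /dist /= !lt_max -!mulrBr (normrM (m + 1)) (normrM ((m + 1) ^+ 2)) (ger0_norm c0) (ger0_norm (exprn_ge0 2 c0)).
have [ii|ii] := eqVneq i i'; last first.
  apply/orP; left; apply: (@lt_le_trans _ _ (m + 1)); first lra.
  by rewrite -{1}(mulr1 (m + 1)) ler_wpM2l // natr_dist.
have jj : j != j' by apply: contraNneq ne => ->; rewrite ii.
apply/orP; right; apply/orP; left; apply: (@lt_le_trans _ _ (m + 1)); first lra.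
apply: (@le_trans _ _ ((m + 1) ^+ 2)); first by rewrite expr2 ler_peMr.
by rewrite -{1}(mulr1 ((m + 1) ^+ 2)) ler_wpM2l ?exprn_ge0 // natr_dist.
Qed.

Lemma size_scaled_grid (c : R) a b : size (scaled_grid c a b) = (a * b)%N.
Proof. by rewrite size_allpairs !size_iota. Qed.

(** Up to dilation, slopes [a < 2 N], intercepts [b < 2 N^2] and abscissas [i < N] give ordinates
    [a * i + b < 4 N^2], so each of the [4 N^3] lines passes through at least [N] of the points. *)
Lemma incidences (c : R) (N : nat) : 0 < c ->
  (4 * (N * N * N) * N <= grid_count incident (scaled_grid c (2 * N) (2 * (N * N)))
     (scaled_grid c N (4 * (N * N))))%N.
Proof.
move=> c0; set B1 := scaled_grid _ _ _; set B2 := scaled_grid _ _ _.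
have -> : (4 * (N * N * N) = size B1)%N by rewrite size_scaled_grid; lia.
rewrite /grid_count mulnC -sum1_size big_distrr /= big_seq [leqRHS]big_seq.
apply: leq_sum => l; rewrite muln1 => /allpairsP[[a b] /=]; rewrite !mem_iota !add0n /= => -[aN bN ->].
rewrite -size_filter.
have -> : N = size [seq [:: c * i%:R; c ^+ 2 * (a * i + b)%:R] | i <- iota 0 N].
  by rewrite size_map size_iota.
apply: uniq_leq_size.
  rewrite map_inj_uniq ?iota_uniq // => i i' /(congr1 (nth 0 ^~ 0%N)) /=.
  by move=> /(mulfI (lt0r_neq0 c0))/eqP; rewrite eqr_nat => /eqP.
move=> p /mapP[i]; rewrite mem_iota add0n /= => iN ->; rewrite mem_filter; apply/andP; split.
  by rewrite /incident /= natrD natrM; apply/eqP; ring.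
apply/allpairsP; exists (i, (a * i + b)%N); split=> //=; rewrite mem_iota add0n //=; nia.
Qed.

End Incidences.

Theorem theorem3p16 (R : rcfType) (S : Type) (I : S -> seq R -> Prop)
  (beta : Reals.Rdefinitions.R) :
  is_reduct I ->
  zdefinable I 2 (@lt_set R) ->
  zdefinable I 3 (@add_graph R) ->
  Reals.Rdefinitions.Rle Reals.Rdefinitions.R1 beta ->
  Reals.Rdefinitions.Rlt beta
    (Reals.Rdefinitions.Rdiv (Reals.Raxioms.INR 4%N) (Reals.Raxioms.INR 3%N)) ->
  (~ definable I 3 (@mul_graph R) <-> zarankiewicz_bound I beta).
Proof.
move=> Ired zlt zadd b1 b2; pose D := structure_class zlt zadd.
split.
- move=> nomul d1 d2 _ _ E /(definable_class zlt zadd) DE.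
  have DO P : D P -> field_class R P by apply: reduct_class.
  have {}nomul : ~ has_mul D.
    move=> Dmul; apply: nomul; apply: (@class_definable _ _ _ zlt zadd).
    exact: (dset_eq Dmul (dfun_var D 2)).
  have {}DE : D (fun e => E (mkseq e d1) (mkseq (fun i => e (d1 + i)%N) d2)).
    apply: dset_ext DE => e.
    have -> : take d1 (mkseq e (d1 + d2)) = mkseq e d1.
      apply: (@eq_from_nth _ 0); first by rewrite size_takel size_mkseq ?leq_addr.
      move=> i; rewrite size_takel ?size_mkseq ?leq_addr // => Hi.
      by rewrite nth_take // !nth_mkseq // ltn_addr.
    have -> // : drop d1 (mkseq e (d1 + d2)) = mkseq (fun i => e (d1 + i)%N) d2.
    apply: (@eq_from_nth _ 0); first by rewrite size_drop !size_mkseq addKn.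
    move=> i; rewrite size_drop size_mkseq addKn => Hi.
    by rewrite nth_drop !nth_mkseq // ltn_add2l.
  (* [alpha] and [m] must be given before [k]: either no [k] exists and any values will do, or one
     [k] is fixed and the resulting bound concerns [E] alone. *)
  case: (pselect (exists k, k_free d1 d2 k E)) => [[k kf]|nok]; last first.
    by exists Reals.Rdefinitions.R1, 0; split; [apply: Reals.RIneq.Rlt_0_1|].
  have [N [m [m0 H]]] := kfree_linear_count DO nomul DE kf.
  (* Adding 1 makes [alpha] positive even for [N = 0]. *)
  exists (Reals.Rdefinitions.Rplus (Reals.Raxioms.INR N) Reals.Rdefinitions.R1), m.
  split; first by apply: Reals.RIneq.Rplus_le_lt_0_compat; [apply: Reals.RIneq.pos_INR|apply: Reals.RIneq.Rlt_0_1].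
  split=> // _ n B1 B2 gB D1 D2; apply: PowerBounds.linear_le_power => //.
  apply/ssrnat.leP; have := H n B1 B2 gB D1 D2; rewrite /cnt /grid_count; congr (_ <= _)%N.
  by apply: eq_bigr => x _; apply: eq_count => y; rewrite asboolb.
move=> bound /(definable_class zlt zadd) Dmul.
have Dm : dfun D (fun e => e 0%N * e 1%N).
  have := d_ren (fun i => match i with 0 => 1 | 1 => 2 | _ => 0 end)%N Dmul.
  by apply: dset_ext => e; rewrite /mul_graph /=; split=> ->.
have rd : rel_definable I 2 2 (@incident R).
  apply: (@class_definable _ _ _ zlt zadd).
  have D1 : D (fun e => e 3%N = e 0%N * e 2%N + e 1%N).
    have D2 : dfun D (fun e => e 0%N * e 2%N).
      apply: (@dfun_app _ D _ (fun e i => if i is 0 then e 0%N else e 2%N) Dm) => -[|i]; dtac.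
    by dtac.
  by apply: dset_ext D1 => e; rewrite /incident /=; split=> /eqP.
have [a [m [a0 [m0 H]]]] := bound 2%N 2%N isT isT _ rd.
have [N [N0 HN]] := PowerBounds.power_lt_four_thirds a0 b2.
have c0 : 0 < m + 1 by lra.
have kf : exists k, k_free 2 2 k (@incident R) by exists 2%N; apply: incident_2free.
have := H kf (4 * (N * N * N))%N
  (scaled_grid (m + 1) (2 * N) (2 * (N * N))) (scaled_grid (m + 1) N (4 * (N * N))).
have gr : is_grid 2 2 (4 * (N * N * N))%N
  (scaled_grid (m + 1) (2 * N) (2 * (N * N))) (scaled_grid (m + 1) N (4 * (N * N))).
  split; rewrite ?scaled_grid_uniq ?size_scaled_grid //; [lia|lia|].
  by apply/andP; split; apply/allP => x /allpairsP[[i j] [_ _ ->]].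
have dg := @scaled_grid_distant R m _ _ m0.
move=> /(_ gr (dg _ _) (dg _ _)) Hle.
have /ssrnat.leP/Reals.RIneq.le_INR Hinc := incidences N c0.
have := Reals.RIneq.Rle_lt_trans _ _ _ (Reals.RIneq.Rle_trans _ _ _ Hinc Hle) HN.
exact: Reals.RIneq.Rlt_irrefl.
Qed.
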